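(* Let $X\in\mathcal{X}_2$ be a dicritical germ of holomorphic vector field with an isolated singularity at $0\in\mathbb{C}^2$. Then $d(X)\leq 4$. Moreover: (a) If $d(X)=3$ then $X$ is equivalent, modulo a multiplicative constant, to $x\frac{\partial}{\partial x}+n\,y\frac{\partial}{\partial y}$ for some integer $n\geq 2$. (b) If $d(X)=4$ then $X$ is equivalent, modulo a multiplicative constant, to the radial vector field $x\frac{\partial}{\partial x}+y\frac{\partial}{\partial y}$.
   Context: $\mathcal{X}_2$ is the set of germs at $0\in\mathbb{C}^2$ of holomorphic vector fields, $C(X)=\{Y\in\mathcal{X}_2\mid[X,Y]=0\}$ and $d(X)=\dim_{\mathbb{C}}C(X)$. ''Isolated singularity at $0$'' means $X(0)=0$ and $0$ is an isolated zero of $X$. A separatrix of $X$ is a germ of irreducible analytic curve through $0$, regular outside $0$ and invariant by $X$; $X$ is dicritical if it has infinitely many separatrices. ''Equivalent, modulo a multiplicative constant, to $Z$'' means that there are $c\in\mathbb{C}^*$ and a germ of biholomorphism $\phi$ of $(\mathbb{C}^2,0)$ fixing $0$ with $\phi_*(X)=c\,Z$. *)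

(* Defs.v *)
From mathcomp Require Import all_boot all_order all_algebra.
From mathcomp Require Import all_classical all_reals all_analysis.
Set Implicit Arguments.
Unset Strict Implicit.
Unset Printing Implicit Defensive.
Import Order.TTheory GRing.Theory Num.Theory.
Import numFieldNormedType.Exports.
Local Open Scope classical_set_scope.
Local Open Scope ring_scope.

(* The definitions are written for a numClosedFieldType K, for which
   MathComp-Analysis provides the norm topology; the complex numbers are
   K = R[i] with R : realType. *)
Definition C2 (K : numClosedFieldType) := (K * K)%type.

(* Germs at 0 are handled through representatives, which are total functions
   whose values away from 0 are irrelevant: equality of germs is equality on
   a neighbourhood of 0, and every notion below depends on germs only. *)
Definition germ_eq (K : numClosedFieldType) (T : Type) (f g : C2 K -> T) :
    Prop :=
  \forall z \near (0 : C2 K), f z = g z.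

Definition set_germ_eq (K : numClosedFieldType) (S T : set (C2 K)) : Prop :=
  \forall z \near (0 : C2 K), S z <-> T z.

Definition psum2 (K : numFieldType) (a : nat -> nat -> K) (N : nat) : K :=
  \sum_(j < N) \sum_(k < N) a j k.

(* Holomorphy at 0: f is, near 0, the sum of an absolutely convergent power
   series in the two coordinates (so the germs form C{x,y}). *)
Definition holo (K : numClosedFieldType) (f : C2 K -> K) : Prop :=
  exists a : nat -> nat -> K,
    \forall z \near (0 : C2 K),
      (exists M : K,
         forall N, psum2 (fun j k => `|a j k * z.1 ^+ j * z.2 ^+ k|) N <= M) /\
      psum2 (fun j k => a j k * z.1 ^+ j * z.2 ^+ k) @ \oo --> f z.

Definition holo_map (K : numClosedFieldType) (F : C2 K -> C2 K) : Prop :=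
  holo (fun z => (F z).1) /\ holo (fun z => (F z).2).

Definition dx (K : numClosedFieldType) (f : C2 K -> K) (z : C2 K) : K :=
  derive1 (fun s : K => f (s, z.2)) z.1.
Definition dy (K : numClosedFieldType) (f : C2 K -> K) (z : C2 K) : K :=
  derive1 (fun s : K => f (z.1, s)) z.2.

(* A vector field a d/dx + b d/dy is the map z |-> (a z, b z). *)
Definition lieD (K : numClosedFieldType) (X : C2 K -> C2 K) (f : C2 K -> K)
    (z : C2 K) : K :=
  (X z).1 * dx f z + (X z).2 * dy f z.

(* The differential of F at z applied to X z. *)
Definition lieDmap (K : numClosedFieldType) (X F : C2 K -> C2 K)
    (z : C2 K) : C2 K :=
  (lieD X (fun w => (F w).1) z, lieD X (fun w => (F w).2) z).

Definition bracket (K : numClosedFieldType) (X Y : C2 K -> C2 K)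
    (z : C2 K) : C2 K :=
  lieDmap X Y z - lieDmap Y X z.

Definition centralizer (K : numClosedFieldType) (X : C2 K -> C2 K) :
    set (C2 K -> C2 K) :=
  [set Y | holo_map Y /\ germ_eq (bracket X Y) (fun=> 0)].

(* d(X) = n: the complex vector space of germs C(X) has a basis of n germs.
   No n satisfies this when C(X) is infinite-dimensional. *)
Definition centralizer_dim (K : numClosedFieldType) (X : C2 K -> C2 K)
    (n : nat) : Prop :=
  exists Y : 'I_n -> (C2 K -> C2 K),
    [/\ forall i, centralizer X (Y i),
        forall c : 'I_n -> K,
          germ_eq (fun z => \sum_i c i *: Y i z) (fun=> 0) ->
          forall i, c i = 0
      & forall W, centralizer X W ->
          exists c : 'I_n -> K,
            germ_eq W (fun z => \sum_i c i *: Y i z)].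

Definition isolated_singularity (K : numClosedFieldType) (X : C2 K -> C2 K) :
    Prop :=
  X 0 = 0 /\ \forall z \near (0 : C2 K), X z = 0 -> z = 0.

(* Irreducibility in the local ring of germs: the units are the germs that do
   not vanish at 0. *)
Definition irreducible_germ (K : numClosedFieldType) (f : C2 K -> K) : Prop :=
  [/\ holo f, f 0 = 0, ~ germ_eq f (fun=> 0)
    & forall g h, holo g -> holo h -> germ_eq f (fun z => g z * h z) ->
        g 0 <> 0 \/ h 0 <> 0].

(* The germ at 0 of S is an irreducible analytic curve {f = 0}, f irreducible,
   smooth off 0 (f being reduced, the smooth points of {f = 0} are those where
   df does not vanish), and X is tangent to it at each of its points. *)
Definition separatrix (K : numClosedFieldType) (X : C2 K -> C2 K)
    (S : set (C2 K)) : Prop :=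
  exists f : C2 K -> K,
    [/\ irreducible_germ f,
        set_germ_eq S [set z | f z = 0],
        \forall z \near (0 : C2 K), S z -> z <> 0 -> (dx f z, dy f z) <> 0
      & \forall z \near (0 : C2 K), S z -> lieD X f z = 0].

(* Infinitude of the set of separatrix germs, as an injective sequence. *)
Definition dicritical (K : numClosedFieldType) (X : C2 K -> C2 K) : Prop :=
  exists S : nat -> set (C2 K),
    (forall i, separatrix X (S i)) /\
    (forall i j, i <> j -> ~ set_germ_eq (S i) (S j)).

Definition biholo_germ (K : numClosedFieldType) (phi : C2 K -> C2 K) : Prop :=
  [/\ holo_map phi, phi 0 = 0
    & exists psi : C2 K -> C2 K,
        [/\ holo_map psi, psi 0 = 0, germ_eq (psi \o phi) id
          & germ_eq (phi \o psi) id]].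

(* phi_* X = c Z, written at the source point: D phi (z) (X z) = c Z (phi z). *)
Definition equiv_mod_const (K : numClosedFieldType) (X Z : C2 K -> C2 K) :
    Prop :=
  exists (c : K) (phi : C2 K -> C2 K),
    [/\ c <> 0, biholo_germ phi
      & germ_eq (lieDmap X phi) (fun z => c *: Z (phi z))].

(* x d/dx + n y d/dy *)
Definition diag_field (K : numClosedFieldType) (n : nat) (z : C2 K) : C2 K :=
  (z.1, n%:R * z.2).

(* x d/dx + y d/dy *)
Definition radial_field (K : numClosedFieldType) (z : C2 K) : C2 K := z.

(* Main.v *)
(* A field X is a derivation of O = C{x,y}. If its zero is isolated, its two components
   generate an ideal containing powers of x and y, and infinitely many separatrices are
   infinitely many non-associated irreducible f_j in O with f_j | X(f_j). A first
   integral is constant along each {f_j = 0}, hence constant. For Y in C(X), the germ h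
   = X ^ Y satisfies X(h) = div(X) h; it vanishes only for Y in C.X, so if d(X) >= 3
   there are two independent germs h of this form. They span a pencil whose members,
   once the common factor is removed, are eigenfunctions of X with a common factor l.
   The space of these h has finite dimension and is stable under h |-> Y(h) - div(Y) h,
   so that there are h and Y, not proportional to X, with Y(h) = (div(Y) + c) h and c
   <> 0. Writing h / (X ^ Y) = u / v in lowest terms and comparing X and Y along a
   branch f of u and a branch f' of v then shows that f and f' are coordinates, X(f) =
   a f, X(f') = b f', with a(0) : b(0) a positive rational. No small divisors occur
   when the eigenvalues have a positive ratio, and X becomes s (m x d/dx + n y d/dy).
   Its centralizer consists of the fields whose components are combinations of resonant
   monomials; there are two of these in all unless m or n divides the other one, three
   if the quotient is at least 2, and four if m = n. *)
From HB Require Import structures.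
Require Import Defs.
From mathcomp Require Import all_boot all_order all_algebra.
From mathcomp.real_closed Require Import complex.
From mathcomp Require Import all_classical all_reals all_analysis.
From mathcomp Require Import ring zify.
Set Implicit Arguments.
Unset Strict Implicit.
Unset Printing Implicit Defensive.
Import Order.TTheory GRing.Theory Num.Theory.
Import numFieldNormedType.Exports.
Local Open Scope classical_set_scope.
Local Open Scope ring_scope.

(** * Formal and convergent power series in two variables *)

(** The work is done in the ring [cps K] of convergent series. Branches are never parametrized: a
    ratio u/v that X kills along {f = 0} is shown constant by eliminating down to C{x}, where a
    relation of least degree has proportional coefficients and splits into linear factors over the
    closed field. This serves for first integrals, for the members of a pencil and for the ratio of
    two commuting fields. Zero sets are treated algebraically: two germs either share a non-unit
    factor or generate an ideal containing powers of x and y. The eigenvalue ratio is rational for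
    the following reason. Let k, k' be the constants for which Y - k X = f T and Y - k' X = f' T'.
    Then (k' - k) X = f T - f' T', while T(f) and T'(f') take at 0 the values c / e and - c / e',
    where e and e' are the multiplicities of f in u and of f' in v. So c <> 0 makes k and k'
    distinct, makes f and f' coordinates, and gives the ratio e' : e. *)

Definition fps (A : Type) := nat -> A.

HB.instance Definition _ (A : Type) := gen_eqMixin (fps A).
HB.instance Definition _ (A : Type) := gen_choiceMixin (fps A).

Section FormalPowerSeries.
Variable A : comNzRingType.
Implicit Types a b c : fps A.

Definition fps_add a b : fps A := fun n => a n + b n.
Definition fps_opp a : fps A := fun n => - a n.
Definition fps_const (k : A) : fps A := fun n => if n is 0 then k else 0.
Definition fps_mul a b : fps A := fun n => \sum_(i < n.+1) a i * b (n - i)%N.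

Lemma fps_addA : associative fps_add.
Proof. by move=> a b c; apply/funext => n; rewrite /fps_add addrA. Qed.
Lemma fps_addC : commutative fps_add.
Proof. by move=> a b; apply/funext => n; rewrite /fps_add addrC. Qed.
Lemma fps_add0 : left_id (fps_const 0) fps_add.
Proof. by move=> a; apply/funext => -[|n]; rewrite /fps_add /= add0r. Qed.
Lemma fps_addN : left_inverse (fps_const 0) fps_opp fps_add.
Proof.
by move=> a; apply/funext => -[|n]; rewrite /fps_add /fps_opp /= addNr.
Qed.

HB.instance Definition _ :=
  GRing.isZmodule.Build (fps A) fps_addA fps_addC fps_add0 fps_addN.

Let trunc n a : {poly A} := \poly_(i < n.+1) a i.

(** The coefficient of degree m sees only terms of degree at most n, so the ring laws below are
    inherited from [{poly A}]. *)
Lemma fps_mul_trunc n m a b : (m <= n)%N ->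
  fps_mul a b m = (trunc n a * trunc n b)`_m.
Proof.
move=> mn; rewrite coefM; apply: eq_bigr => -[i im] _ /=.
by rewrite !coef_poly !ifT //; lia.
Qed.

Lemma fps_mulC : commutative fps_mul.
Proof.
by move=> a b; apply/funext => n; rewrite !(@fps_mul_trunc n) // mulrC.
Qed.
Lemma fps_mulA : associative fps_mul.
Proof.
move=> a b c; apply/funext => n.
have trM x y : forall i : nat, (i <= n)%N ->
    (trunc n (fps_mul x y))`_i = (trunc n x * trunc n y)`_i.
  by move=> i le_in; rewrite coef_poly ltnS le_in (@fps_mul_trunc n).
rewrite [LHS](@fps_mul_trunc n) // [RHS](@fps_mul_trunc n) //.
transitivity ((trunc n a * trunc n b * trunc n c)`_n).
  rewrite -mulrA !coefM; apply: eq_bigr => -[i lt_in] _ /=.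
  by rewrite trM // leq_subr.
rewrite !coefM; apply: eq_bigr => -[i lt_in] _ /=.
by rewrite trM // -ltnS.
Qed.
Lemma fps_mul1 : left_id (fps_const 1) fps_mul.
Proof.
move=> a; apply/funext => n; rewrite /fps_mul big_ord_recl /= subn0 mul1r.
by rewrite big1 ?addr0 // => i _; rewrite mul0r.
Qed.
Lemma fps_mulDl : left_distributive fps_mul fps_add.
Proof.
move=> a b c; apply/funext => n; rewrite /fps_mul /fps_add -big_split /=.
by apply: eq_bigr => i _; rewrite mulrDl.
Qed.
Lemma fps_one_neq0 : fps_const 1 != 0.
Proof.
apply/eqP => /(congr1 (fun f : fps A => f 0%N)) /= /eqP.
by rewrite oner_eq0.
Qed.

HB.instance Definition _ := GRing.Zmodule_isComNzRing.Build (fps A)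
  fps_mulA fps_mulC fps_mul1 fps_mulDl fps_one_neq0.

Lemma fps0E n : (0 : fps A) n = 0. Proof. by case: n. Qed.
Lemma fpsDE a b n : (a + b) n = a n + b n. Proof. by []. Qed.
Lemma fpsME a b n : (a * b) n = \sum_(i < n.+1) a i * b (n - i)%N.
Proof. by []. Qed.
Lemma fps_sumE (I : Type) (r : seq I) (P : pred I) (F : I -> fps A) n :
  (\sum_(i <- r | P i) F i) n = \sum_(i <- r | P i) F i n.
Proof.
by elim/big_rec2: _ => [|i y1 y2 _ <-]; rewrite ?fps0E.
Qed.
End FormalPowerSeries.

Section TwoVariables.
Variable K : comNzRingType.
Notation ps := (fps (fps K)).
Implicit Types a b : ps.

Lemma ps0E i j : (0 : ps) i j = 0. Proof. by rewrite fps0E fps0E. Qed.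
Lemma ps1E i j : (1 : ps) i j = ((i == 0%N) && (j == 0%N))%:R.
Proof. by case: i j => [|i] [|j]. Qed.
Lemma psNE a i j : (- a) i j = - a i j. Proof. by []. Qed.
Lemma psME a b i j :
  (a * b) i j = \sum_(p < i.+1) \sum_(q < j.+1) a p q * b (i - p)%N (j - q)%N.
Proof. by rewrite fpsME fps_sumE. Qed.
Lemma ps_ext a b : (forall i j, a i j = b i j) -> a = b.
Proof. by move=> ab; apply/funext => i; apply/funext => j. Qed.

(* The inner index is the exponent of y. *)
Definition ps_mono (k : K) (m n : nat) : ps :=
  fun i j => if (i == m) && (j == n) then k else 0.

Lemma ps_monoM k m n a i j : (ps_mono k m n * a) i j =
  if (m <= i)%N && (n <= j)%N then k * a (i - m)%N (j - n)%N else 0.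
Proof.
rewrite psME; case: ifP => [/andP[mi nj]|mnij].
  rewrite (bigD1 (Ordinal (_ : m < i.+1)%N)) //= (bigD1 (Ordinal (_ : n < j.+1)%N)) //=.
  rewrite /ps_mono !eqxx /= big1 ?addr0 => [|[q qj] /eqP qn]; last first.
    rewrite ifF ?mul0r //=; apply/negbTE/eqP => e; apply: qn; exact/val_inj.
  rewrite big1 ?addr0 // => -[p pi] /eqP pm; rewrite big1 // => q _.
  by rewrite ifF ?mul0r //=; apply/negbTE/negP => /andP[/eqP e _]; apply: pm; exact/val_inj.
rewrite big1 // => -[p pi] _; rewrite big1 // => -[q qj] _ /=; rewrite /ps_mono.
case: andP => [[/eqP e1 /eqP e2]|]; last by rewrite mul0r.
by move: mnij pi qj; rewrite e1 e2 !ltnS => /negbT /negP + u v; rewrite u v.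
Qed.
End TwoVariables.

(** * Sums over square boxes of indices *)

Section BoxSums.
Variable K : numFieldType.
Implicit Types (F G : nat -> nat -> K) (N : nat).

Lemma eq_psum2 F G N :
  (forall i j, (i < N)%N -> (j < N)%N -> F i j = G i j) ->
  psum2 F N = psum2 G N.
Proof.
by move=> FG; apply: eq_bigr => i _; apply: eq_bigr => j _; exact: FG.
Qed.

Lemma ler_psum2 F G N :
  (forall i j, (i < N)%N -> (j < N)%N -> F i j <= G i j) ->
  psum2 F N <= psum2 G N.
Proof.
by move=> FG; apply: ler_sum => i _; apply: ler_sum => j _; exact: FG.
Qed.

Lemma psum2_ge0 F N : (forall i j, 0 <= F i j) -> 0 <= psum2 F N.
Proof. by move=> F0; apply: sumr_ge0 => i _; apply: sumr_ge0 => j _. Qed.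

Lemma psum2D F G N :
  psum2 (fun i j => F i j + G i j) N = psum2 F N + psum2 G N.
Proof.
rewrite /psum2 -big_split /=; apply: eq_bigr => i _.
by rewrite big_split.
Qed.

Lemma psum2N F N : psum2 (fun i j => - F i j) N = - psum2 F N.
Proof. by rewrite /psum2 -sumrN; apply: eq_bigr => i _; rewrite -sumrN. Qed.

Lemma psum2B F G N :
  psum2 (fun i j => F i j - G i j) N = psum2 F N - psum2 G N.
Proof. by rewrite psum2D psum2N. Qed.

Lemma psum2Zr F (k : K) N : psum2 (fun i j => F i j * k) N = psum2 F N * k.
Proof. by rewrite /psum2 mulr_suml; apply: eq_bigr => i _; rewrite mulr_suml. Qed.

Lemma psum2Zl F (k : K) N : psum2 (fun i j => k * F i j) N = k * psum2 F N.
Proof. by rewrite mulrC -psum2Zr; apply: eq_psum2 => *; rewrite mulrC. Qed.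

Lemma psum2_norm F N : `|psum2 F N| <= psum2 (fun i j => `|F i j|) N.
Proof.
by apply: le_trans (ler_norm_sum _ _ _) _; apply: ler_sum => i _; exact: ler_norm_sum.
Qed.

Lemma psum2_exchange (F : nat -> nat -> nat -> nat -> K) N N' :
  psum2 (fun i j => psum2 (F i j) N') N =
  psum2 (fun p q => psum2 (fun i j => F i j p q) N) N'.
Proof.
rewrite /psum2.
under eq_bigr do rewrite exchange_big /=.
rewrite exchange_big /=; apply: eq_bigr => p _.
under eq_bigr do rewrite exchange_big /=.
by rewrite exchange_big.
Qed.

Lemma psum2_mono F N N' : (forall i j, 0 <= F i j) -> (N <= N')%N ->
  psum2 F N <= psum2 F N'.
Proof.
move=> F0 NN'; rewrite /psum2 -(big_mkord xpredT (fun i => \sum_(j < N) F i j)).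
rewrite -(big_mkord xpredT (fun i => \sum_(j < N') F i j)).
rewrite (@big_cat_nat _ _ _ N 0 N') //= -[leLHS]addr0; apply: lerD; last first.
  by rewrite sumr_ge0// => i _; rewrite sumr_ge0.
apply: ler_sum => i _; rewrite -!(big_mkord xpredT (F i)).
by rewrite (@big_cat_nat _ _ _ N 0 N') //= lerDl sumr_ge0.
Qed.

Lemma sum_shift_le (g : nat -> K) p N : (forall i, 0 <= g i) ->
  \sum_(i < N) (if (p <= i)%N then g (i - p)%N else 0) <= \sum_(i < N) g i.
Proof.
move=> g0; have [Np|/ltnW pN] := leqP N p.
  rewrite big1 ?sumr_ge0// => -[i iN] _ /=.
  by rewrite ifF //; apply/negbTE; lia.
rewrite -(subnKC pN); set m := (N - p)%N.
rewrite big_split_ord /= big1 ?add0r => [|[i ip] _ /=]; last first.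
  by rewrite ifF //; apply/negbTE; lia.
rewrite addnC big_split_ord /= -[leLHS]addr0; apply: lerD; last exact: sumr_ge0.
by apply: ler_sum => i _; rewrite leq_addr addKn.
Qed.
End BoxSums.

(** * Weighted l1 norms and the ring of convergent series *)

Section WeightedNorms.
Variable K : numFieldType.
Notation ps := (fps (fps K)).
Implicit Types (a b c : ps) (s r M : K).

Definition norm_le s r a M :=
  forall N, psum2 (fun i j => `|a i j| * (s ^+ i * r ^+ j)) N <= M.

Lemma norm_le_ge0 s r a M : norm_le s r a M -> 0 <= M.
Proof. by move=> /(_ 0%N); rewrite /psum2 big_ord0. Qed.

Lemma norm_leW s r a M M' : M <= M' -> norm_le s r a M -> norm_le s r a M'.
Proof. by move=> MM' aM N; exact: le_trans (aM N) _. Qed.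

(** Shrinking the radii gains the factor k as soon as it does so on the support of [a]; this is how
    missing monomials are turned into small norms. *)
Lemma norm_le_small s r s' r' k a M : 0 <= s <= s' -> 0 <= r <= r' -> 0 <= k ->
  (forall i j, a i j != 0 -> s ^+ i * r ^+ j <= k * (s' ^+ i * r' ^+ j)) ->
  norm_le s' r' a M -> norm_le s r a (k * M).
Proof.
move=> /andP[s0 ss'] /andP[r0 rr'] k0 small aM N.
apply: le_trans (ler_wpM2l k0 (aM N)); rewrite -psum2Zl; apply: ler_psum2 => i j _ _.
have [->|aij] := eqVneq (a i j) 0; first by rewrite normr0 !mul0r mulr0.
by rewrite [leRHS]mulrCA ler_wpM2l // small.
Qed.

Lemma norm_le_shrink s r s' r' a M : 0 <= s <= s' -> 0 <= r <= r' ->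
  norm_le s' r' a M -> norm_le s r a M.
Proof.
move=> ss' rr' aM; rewrite -[M]mul1r; apply: norm_le_small aM => // i j _.
case/andP: ss' => s0 ss'; case/andP: rr' => r0 rr'.
by rewrite mul1r ler_pM ?exprn_ge0 ?lerXn2r ?nnegrE // (le_trans _ ss', le_trans _ rr').
Qed.

Lemma norm_leD s r a b M M' : 0 <= s -> 0 <= r ->
  norm_le s r a M -> norm_le s r b M' -> norm_le s r (a + b) (M + M').
Proof.
move=> s0 r0 aM bM N; apply: le_trans (lerD (aM N) (bM N)); rewrite -psum2D.
apply: ler_psum2 => i j _ _; rewrite -mulrDl ler_wpM2r ?mulr_ge0 ?exprn_ge0 //.
exact: ler_normD.
Qed.

Lemma norm_leN s r a M : norm_le s r a M -> norm_le s r (- a) M.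
Proof.
by move=> aM N; apply: le_trans (aM N); apply: ler_psum2 => i j _ _; rewrite psNE normrN.
Qed.

Lemma norm_le_mono s r k m n : 0 <= s -> 0 <= r ->
  norm_le s r (ps_mono k m n) (`|k| * (s ^+ m * r ^+ n)).
Proof.
move=> s0 r0 N; pose N' := (maxn N (maxn m n).+1).
have [mN nN] : (m < N')%N /\ (n < N')%N by split; lia.
apply: le_trans (psum2_mono (N' := N') _ _) _.
- by move=> i j; rewrite !mulr_ge0 ?exprn_ge0.
- lia.
rewrite /psum2 (bigD1 (Ordinal mN)) //= (bigD1 (Ordinal nN)) //= /ps_mono !eqxx /=.
rewrite big1 ?addr0 => [|j /eqP jn]; last first.
  by rewrite ifF ?normr0 ?mul0r //; apply/eqP => e; apply: jn; exact/val_inj.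
rewrite big1 ?addr0 // => i /eqP im; rewrite big1 // => j _.
rewrite ifF ?normr0 ?mul0r //; apply/negP => /andP[/eqP e _].
by apply: im; exact/val_inj.
Qed.

Lemma psum2_shift (g : nat -> nat -> K) p q N : (forall i j, 0 <= g i j) ->
  psum2 (fun i j => if (p <= i)%N && (q <= j)%N
                    then g (i - p)%N (j - q)%N else 0) N <= psum2 g N.
Proof.
move=> g0; rewrite /psum2.
apply: le_trans (sum_shift_le p N (g := fun i => \sum_(j < N) g i j) _); last first.
  by move=> i; exact: sumr_ge0.
apply: ler_sum => i _; case: ifP => [pi|_] /=; last by rewrite big1.
exact: (sum_shift_le q N (g := g (i - p)%N)).
Qed.

(** The convolution is written over a box that does not depend on (i, j), so that it can be
    exchanged with the sum over (i, j). *)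
Lemma psME_box a b i j N : (i < N)%N -> (j < N)%N ->
  (a * b) i j = psum2 (fun p q => if (p <= i)%N && (q <= j)%N then
    a p q * b (i - p)%N (j - q)%N else 0) N.
Proof.
move=> iN jN; rewrite psME /psum2.
rewrite (big_ord_widen N (fun p => \sum_(q < j.+1) a p q * b (i - p)%N (j - q)%N)) //.
rewrite big_mkcond /=; apply: eq_bigr => p _; rewrite ltnS; case: ifP => pi /=; last first.
  by rewrite big1.
rewrite (big_ord_widen N (fun q => a p q * b (i - p)%N (j - q)%N)) //.
by rewrite big_mkcond.
Qed.

(** After exchanging the sums, each coefficient of [a] contributes a shifted copy of [b], whose norm
    is controlled by [psum2_shift]. *)
Lemma norm_leM s r a b M M' : 0 <= s -> 0 <= r ->
  norm_le s r a M -> norm_le s r b M' -> norm_le s r (a * b) (M * M').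
Proof.
move=> s0 r0 aM bM N.
have w0 i j : 0 <= s ^+ i * r ^+ j by rewrite mulr_ge0 ?exprn_ge0.
pose g i j := `|b i j| * (s ^+ i * r ^+ j).
pose F i j p q := if (p <= i)%N && (q <= j)%N then
  `|a p q| * (s ^+ p * r ^+ q) * g (i - p)%N (j - q)%N else 0.
apply: (@le_trans _ _ (psum2 (fun i j => psum2 (F i j) N) N)).
  apply: ler_psum2 => i j iN jN; rewrite (psME_box _ _ iN jN) mulrC.
  apply: le_trans (ler_wpM2l (w0 _ _) (psum2_norm _ _)) _.
  rewrite -psum2Zl; apply: ler_psum2 => p q _ _; rewrite /F /g.
  case: ifP => [/andP[pi qj]|_]; last by rewrite normr0 mulr0.
  rewrite -{1}(subnKC pi) -{1}(subnKC qj) !exprD normrM.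
  by rewrite le_eqVlt; apply/orP; left; apply/eqP; ring.
rewrite psum2_exchange; apply: le_trans (ler_pM _ _ (aM N) (bM N)); first last.
- by apply: psum2_ge0 => i j; rewrite mulr_ge0.
- by apply: psum2_ge0 => i j; rewrite mulr_ge0.
rewrite -psum2Zr; apply: ler_psum2 => p q _ _.
have -> : psum2 (fun i j => F i j p q) N = `|a p q| * (s ^+ p * r ^+ q) *
   psum2 (fun i j => if (p <= i)%N && (q <= j)%N then g (i - p)%N (j - q)%N else 0) N.
  by rewrite -psum2Zl; apply: eq_psum2 => i j _ _; rewrite /F; case: ifP; rewrite ?mulr0.
apply: ler_wpM2l; first by rewrite mulr_ge0.
by apply: psum2_shift => i j; rewrite mulr_ge0.
Qed.

Definition conv a := exists r M, 0 < r /\ norm_le r r a M.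

Lemma conv2 a b : conv a -> conv b -> exists r M M',
  [/\ 0 < r, norm_le r r a M & norm_le r r b M'].
Proof.
move=> [r [M [r0 aM]]] [r' [M' [r'0 bM]]].
have /orP[rr'|rr'] := real_leVge (gtr0_real r0) (gtr0_real r'0).
  by exists r, M, M'; split=> //; apply: norm_le_shrink bM; rewrite ltW.
by exists r', M, M'; split=> //; apply: norm_le_shrink aM; rewrite ltW.
Qed.

Lemma conv_aniso s r a M : 0 < s -> 0 < r -> norm_le s r a M -> conv a.
Proof.
move=> s0 r0 aM; have /orP[sr|sr] := real_leVge (gtr0_real s0) (gtr0_real r0).
  by exists s, M; split => //; apply: norm_le_shrink aM; rewrite ltW //=.
by exists r, M; split => //; apply: norm_le_shrink aM; rewrite ltW //=.
Qed.

Definition conv_pred : {pred ps} := fun a => `[< conv a >].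

Lemma conv_mono k m n : conv (ps_mono k m n).
Proof.
by exists 1, (`|k| * (1 ^+ m * 1 ^+ n)); split; [exact: ltr01|exact: norm_le_mono].
Qed.

Lemma ps_mono1 : ps_mono 1 0 0 = 1 :> ps.
Proof. by apply: ps_ext => i j; rewrite ps1E /ps_mono; case: ifP. Qed.

Lemma conv_subring : subring_closed conv_pred.
Proof.
split=> [|a b /asboolP ca /asboolP cb|a b /asboolP ca /asboolP cb]; apply/asboolP.
- by rewrite -ps_mono1; exact: conv_mono.
- have [r [M [M' [r0 aM bM]]]] := conv2 ca cb; exists r, (M + M'); split => //.
  by apply: norm_leD (norm_leN bM); rewrite ?ltW.
- have [r [M [M' [r0 aM bM]]]] := conv2 ca cb; exists r, (M * M'); split => //.
  by apply: norm_leM; rewrite ?ltW.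
Qed.
HB.instance Definition _ := GRing.isSubringClosed.Build _ conv_pred conv_subring.

(* C{x,y}: the ring of germs of holomorphic functions, as convergent series. *)
Record cps := Cps { cf : ps; _ : cf \in conv_pred }.
HB.instance Definition _ := [isSub for cf].
HB.instance Definition _ := [Choice of cps by <:].
HB.instance Definition _ := [SubChoice_isSubComNzRing of cps by <:].

Definition cc (f : cps) : nat -> nat -> K := cf f.
Coercion cc : cps >-> Funclass.

Lemma cpsP (f : cps) : conv f.
Proof. by case: f => a /= /asboolP. Qed.

Definition mk_cps a (ca : conv a) : cps := Cps (asboolT ca : a \in conv_pred).

Lemma cps_ext (f g : cps) : (forall i j, f i j = g i j) -> f = g.
Proof. by move=> fg; apply/val_inj; exact: ps_ext. Qed.

Lemma c0E i j : (0 : cps) i j = 0. Proof. exact: ps0E. Qed.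
Lemma c1E i j : (1 : cps) i j = ((i == 0%N) && (j == 0%N))%:R. Proof. exact: ps1E. Qed.
Lemma cDE (f g : cps) i j : (f + g : cps) i j = f i j + g i j. Proof. by []. Qed.
Lemma cNE (f : cps) i j : (- f : cps) i j = - f i j. Proof. by []. Qed.
Lemma cBE (f g : cps) i j : (f - g : cps) i j = f i j - g i j. Proof. by []. Qed.
Lemma cME (f g : cps) i j :
  (f * g : cps) i j = \sum_(p < i.+1) \sum_(q < j.+1) f p q * g (i - p)%N (j - q)%N.
Proof. exact: psME. Qed.
Lemma c_sumE (I : Type) (r : seq I) (P : pred I) (F : I -> cps) i j :
  (\sum_(k <- r | P k) F k : cps) i j = \sum_(k <- r | P k) F k i j.
Proof. by elim/big_rec2: _ => [|k y1 y2 _ <-]; rewrite ?c0E. Qed.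

Definition cmono k m n : cps := mk_cps (conv_mono k m n).
Lemma cmonoM k m n (f : cps) i j : (cmono k m n * f : cps) i j =
  if (m <= i)%N && (n <= j)%N then k * f (i - m)%N (j - n)%N else 0.
Proof. exact: ps_monoM. Qed.
End WeightedNorms.

Section FpsDerivation.
Variable A : comNzRingType.
Definition fps_deriv (a : fps A) : fps A := fun n => a n.+1 *+ n.+1.

Lemma fps_derivM a b : fps_deriv (a * b) = fps_deriv a * b + a * fps_deriv b.
Proof.
apply/funext => n; rewrite /fps_deriv fpsDE !fpsME.
transitivity (\sum_(i < n.+2) (a i *+ i) * b (n.+1 - i)%N +
              \sum_(i < n.+2) a i * (b (n.+1 - i)%N *+ (n.+1 - i))).
  rewrite -big_split -sumrMnl; apply: eq_bigr => -[i lt_in] _ /=.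
  by rewrite mulrnAl mulrnAr -mulrnDr subnKC // -ltnS.
congr (_ + _).
  rewrite big_ord_recl /= mulr0n mul0r add0r; apply: eq_bigr => i _.
  by rewrite /bump /= add1n subSS.
rewrite big_ord_recr /= subnn mulr0n mulr0 addr0; apply: eq_bigr => -[i lt_in] _ /=.
by rewrite subSn.
Qed.
End FpsDerivation.

Section ConvergentSeries.
Variable K : numFieldType.
Notation O := (cps K).
Implicit Types (f g h : O) (k : K).

Definition cst k : O := cmono k 0 0.
Definition vx : O := cmono 1 1 0.
Definition vy : O := cmono 1 0 1.

Lemma cmonoE k m n i j : cmono k m n i j = if (i == m) && (j == n) then k else 0.
Proof. by []. Qed.

Lemma cstE k i j : cst k i j = if (i == 0%N) && (j == 0%N) then k else 0.
Proof. by []. Qed.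

Lemma cstM k f i j : (cst k * f : O) i j = k * f i j.
Proof. by rewrite cmonoM /= !subn0. Qed.

Lemma cst_is_additive : {morph cst : a b / a - b}.
Proof.
move=> a b; apply: cps_ext => i j; rewrite cBE !cstE; case: ifP => // _.
by rewrite subr0.
Qed.
Lemma cst_is_multiplicative : monoid_morphism cst.
Proof.
split; last first.
  move=> a b; apply: cps_ext => i j; rewrite cstM !cstE; case: ifP => // _.
  by rewrite mulr0.
by apply: cps_ext => i j; rewrite cstE c1E; case: ifP.
Qed.
HB.instance Definition _ := GRing.isZmodMorphism.Build K O cst cst_is_additive.
HB.instance Definition _ := GRing.isMonoidMorphism.Build K O cst cst_is_multiplicative.

Lemma vxM f i j : (vx * f : O) i j = if i is i'.+1 then f i' j else 0.
Proof. by rewrite cmonoM; case: i => [|i] //=; rewrite mul1r subn1 subn0. Qed.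
Lemma vyM f i j : (vy * f : O) i j = if j is j'.+1 then f i j' else 0.
Proof. by rewrite cmonoM; case: j => [|j] //=; rewrite mul1r subn1 subn0. Qed.

Lemma cmonoMm k m n k' m' n' :
  cmono k m n * cmono k' m' n' = cmono (k * k') (m + m') (n + n') :> O.
Proof.
apply: cps_ext => i j; rewrite cmonoM !cmonoE.
have [mi|im] := leqP m i; have [nj|jn] := leqP n j; rewrite /=.
- have -> : (i - m == m')%N = (i == m + m')%N by lia.
  have -> : (j - n == n')%N = (j == n + n')%N by lia.
  by case: ifP; rewrite ?mulr0.
- by rewrite ifF //; lia.
- by rewrite ifF //; lia.
- by rewrite ifF //; lia.
Qed.

Lemma cmono_cst k m n : cmono k m n = cst k * cmono 1 m n :> O.
Proof. by rewrite cmonoMm mulr1. Qed.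
Lemma cmonoX m n : cmono 1 m n = vx ^+ m * vy ^+ n :> O.
Proof.
have vxX : forall m, vx ^+ m = cmono 1 m 0.
  elim=> [|p IH]; last by rewrite exprS IH cmonoMm mulr1.
  by apply: cps_ext => i j; rewrite expr0 c1E cmonoE; case: ifP.
have vyX : forall n, vy ^+ n = cmono 1 0 n.
  elim=> [|p IH]; last by rewrite exprS IH cmonoMm mulr1.
  by apply: cps_ext => i j; rewrite expr0 c1E cmonoE; case: ifP.
by rewrite vxX vyX cmonoMm mulr1 addn0.
Qed.
Lemma vxXM n f i j : (vx ^+ n * f : O) i j = if (n <= i)%N then f (i - n)%N j else 0.
Proof.
have -> : vx ^+ n = cmono 1 n 0 by rewrite cmonoX mulr1.
by rewrite cmonoM /= andbT subn0 mul1r.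
Qed.
Lemma vyXM n f i j : (vy ^+ n * f : O) i j = if (n <= j)%N then f i (j - n)%N else 0.
Proof.
have -> : vy ^+ n = cmono 1 0 n by rewrite cmonoX mul1r.
by rewrite cmonoM /= subn0 mul1r.
Qed.

Lemma cM00 f g : (f * g : O) 0%N 0%N = f 0%N 0%N * g 0%N 0%N.
Proof. by rewrite cME !big_ord1. Qed.
Lemma cst00 k : cst k 0%N 0%N = k. Proof. by []. Qed.

(* [lead f i j]: x^i y^j is the least monomial of f, ordering first by total
   degree and then by the exponent of x. *)
Definition lead f i j := f i j <> 0 /\
  forall p q, f p q <> 0 -> (i + j < p + q)%N \/ (p + q = i + j /\ i <= p)%N.

Lemma lead_ex f : f <> 0 -> exists i j, lead f i j.
Proof.
move=> f0; pose P n := `[< exists i, (i <= n)%N /\ f i (n - i)%N <> 0 >].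
have exP : exists n, P n.
  have [|nP] := pselect (exists n, P n); first by [].
  exfalso; apply: f0; apply: cps_ext => i j; rewrite c0E; apply: contrapT => fij.
  by apply: nP; exists (i + j)%N; apply/asboolP; exists i; rewrite leq_addr addKn.
case: (ex_minnP exP) => n /asboolP exn minn.
pose Q i := `[< (i <= n)%N /\ f i (n - i)%N <> 0 >].
have exQ : exists i, Q i by case: exn => i; exists i; exact/asboolP.
case: (ex_minnP exQ) => i /asboolP[le_in fi] mini; exists i, (n - i)%N; split=> // p q fpq.
rewrite (subnKC le_in).
have npq : (n <= p + q)%N.
  by apply: minn; apply/asboolP; exists p; rewrite leq_addr addKn.
have [eq|ne] := eqVneq (p + q)%N n; last by left; lia.
right; split=> //; apply: mini; apply/asboolP; by rewrite -eq leq_addr addKn.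
Qed.
End ConvergentSeries.

(** * Order of vanishing and derivations *)

Section Domain.
Variable K : numFieldType.
Notation O := (cps K).
Implicit Types (f g h : O) (k : K).

(** The monomial order is compatible with products, so only the two leading terms meet in this
    degree. This makes [cps K] a domain. *)
Lemma lead_mulE f g i j i' j' : lead f i j -> lead g i' j' ->
  (f * g : O) (i + i')%N (j + j')%N = f i j * g i' j'.
Proof.
move=> [_ lf] [_ lg]; rewrite cME.
have hi : (i < (i + i').+1)%N by lia.
have hj : (j < (j + j').+1)%N by lia.
rewrite (bigD1 (Ordinal hi)) //= (bigD1 (Ordinal hj)) //=.
have vanish p q : (p <= i + i')%N -> (q <= j + j')%N -> (p, q) <> (i, j) ->
    f p q * g (i + i' - p)%N (j + j' - q)%N = 0.
  move=> pi qj ne; apply: contrapT => /eqP; rewrite mulf_eq0 negb_or => /andP[/eqP fpq /eqP gpq].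
  have := lf _ _ fpq; have := lg _ _ gpq => h1 h2.
  by apply: ne; congr (_, _); lia.
rewrite big1 ?addr0 => [|[q qj] /eqP /= neq]; last first.
  by apply: vanish => // -[e]; apply: neq; exact/val_inj.
rewrite big1 ?addr0 ?addKn // => -[p pi] /eqP /= neq; rewrite big1 // => -[q qj] _ /=; apply: vanish => // -[e _]; apply: neq; exact/val_inj.
Qed.

Lemma lead_mul f g i j i' j' : lead f i j -> lead g i' j' ->
  lead (f * g) (i + i')%N (j + j')%N.
Proof.
move=> lf lg; split; first by rewrite (lead_mulE lf lg); apply/eqP; rewrite mulf_neq0 //; apply/eqP; [case: lf|case: lg].
case: lf => _ lf; case: lg => _ lg p q; rewrite cME => fg.
have : exists a b, [/\ (a <= p)%N, (b <= q)%N, f a b <> 0 & g (p - a)%N (q - b)%N <> 0].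
  apply: contrapT => nex; apply: fg; rewrite big1 // => -[a ap] _; rewrite big1 // => -[b bq] _ /=.
  apply: contrapT => /eqP; rewrite mulf_eq0 negb_or => /andP[/eqP fab /eqP gab].
  by apply: nex; exists a, b.
move=> [a [b [ap bq fab gab]]]; have := lf _ _ fab; have := lg _ _ gab; lia.
Qed.

Lemma lead_neq0 f i j : lead f i j -> f <> 0.
Proof. by move=> [fij _] f0; apply: fij; rewrite f0 c0E. Qed.

Lemma cmul_eq0 f g : f * g = 0 -> f = 0 \/ g = 0.
Proof.
move=> fg; have [->|f0] := pselect (f = 0); first by left.
right; apply: contrapT => g0; have [i [j lf]] := lead_ex f0; have [i' [j' lg]] := lead_ex g0.
exact: (lead_neq0 (lead_mul lf lg)).
Qed.

Lemma cmulI f g h : f <> 0 -> f * g = f * h -> g = h.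
Proof.
move=> f0 /eqP; rewrite -subr_eq0 -mulrBr => /eqP /cmul_eq0[//|/eqP].
by rewrite subr_eq0 => /eqP.
Qed.

Lemma cmul_neq0 f g : f <> 0 -> g <> 0 -> f * g <> 0.
Proof. by move=> f0 g0 /cmul_eq0[]. Qed.
Lemma cexp_neq0 f n : f <> 0 -> f ^+ n <> 0.
Proof.
move=> f0; elim: n => [|n IH]; last by rewrite exprS; exact: cmul_neq0.
by rewrite expr0; apply/eqP; exact: oner_neq0.
Qed.

Lemma vx_neq0 : vx K <> 0.
Proof. by move=> /(congr1 (fun f : O => f 1 0)%N); rewrite c0E => /eqP; rewrite oner_eq0. Qed.
Lemma vy_neq0 : vy K <> 0.
Proof. by move=> /(congr1 (fun f : O => f 0 1)%N); rewrite c0E => /eqP; rewrite oner_eq0. Qed.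

(** Membership in the n-th power of the maximal ideal m. *)
Definition ordge n f := forall i j, (i + j < n)%N -> f i j = 0.

Lemma ordge0 f : (forall n, ordge n f) -> f = 0.
Proof. by move=> fn; apply: cps_ext => i j; rewrite c0E (fn (i + j).+1). Qed.
Lemma ordgeD n f g : ordge n f -> ordge n g -> ordge n (f + g).
Proof. by move=> fn gn i j ij; rewrite cDE fn ?gn ?addr0. Qed.
Lemma ordgeN n f : ordge n f -> ordge n (- f).
Proof. by move=> fn i j ij; rewrite cNE fn ?oppr0. Qed.
Lemma ordgeB n f g : ordge n f -> ordge n g -> ordge n (f - g).
Proof. by move=> fn gn; apply: ordgeD => //; exact: ordgeN. Qed.
Lemma ordgeM m n f g : ordge m f -> ordge n g -> ordge (m + n) (f * g).
Proof.
move=> fm gn i j ij; rewrite cME big1 // => -[p pi] _; rewrite big1 // => -[q qj] _ /=.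
have [pq|pq] := ltnP (p + q) m; first by rewrite fm ?mul0r.
by rewrite gn ?mulr0 //; lia.
Qed.
Lemma ordgeW m n f : (m <= n)%N -> ordge n f -> ordge m f.
Proof. by move=> mn fn i j ij; apply: fn; lia. Qed.
Lemma ordge_0 f : ordge 0 f. Proof. by []. Qed.
Lemma ordgeMl n f g : ordge n g -> ordge n (f * g).
Proof. by move=> gn; rewrite -[n]add0n; apply: ordgeM. Qed.
Lemma ordge1 f : f 0%N 0%N = 0 <-> ordge 1 f.
Proof.
split=> [f0 i j ij|]; last by move=> /(_ 0%N 0%N); apply.
by move: i j ij => [|i] [|j].
Qed.
Lemma ordgeX n f m : ordge n f -> ordge (n * m) (f ^+ m).
Proof.
move=> fn; elim: m => [|m IH]; first by rewrite muln0.
by rewrite exprS mulnS; exact: ordgeM.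
Qed.
Lemma ordge_zero n : ordge n 0. Proof. by move=> i j _; exact: c0E. Qed.

(** The coefficients of the x-derivative, named after the loss of radius in [norm_le_dx]: the factor
    i + 1 <= 2 ^ i is paid for by halving the radii. *)
Definition shrink_dx (a : fps (fps K)) : fps (fps K) := fun i j => (i.+1)%:R * a i.+1 j.

Lemma succ_le_exp2 n : (n.+1)%:R <= 2 ^+ n :> K.
Proof. by rewrite -natrX ler_nat; exact: ltn_expl. Qed.

Lemma norm_le_dx r M (a : fps (fps K)) : 0 < r -> norm_le r r a M ->
  norm_le (r / 2) (r / 2) (shrink_dx a) (M / r).
Proof.
move=> r0 fM; have r20 : 0 < r / 2 by rewrite divr_gt0.
move=> N; rewrite ler_pdivlMr //.
apply: le_trans (fM N.+1); rewrite -psum2Zr /psum2.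
apply: (@le_trans _ _ (\sum_(i < N) \sum_(j < N) `|a i.+1 j| * (r ^+ i.+1 * r ^+ j))); last first.
  rewrite [leRHS]big_ord_recl /= -[leLHS]add0r; apply: lerD.
    by apply: sumr_ge0 => j _; rewrite !mulr_ge0 ?exprn_ge0 // ltW.
  apply: ler_sum => i _; rewrite [leRHS]big_ord_recr /= lerDl.
  by rewrite !mulr_ge0 ?exprn_ge0 // ltW.
apply: ler_sum => i _; apply: ler_sum => j _; rewrite /shrink_dx normrM normr_nat.
rewrite [leLHS](_ : _ = `|a i.+1 j| * r ^+ i.+1 * (i.+1%:R * (1 / 2) ^+ i) * (r / 2) ^+ j); last first.
  by rewrite exprS !expr_div_n expr1n; ring.
have [r0' r20'] := (ltW r0, ltW r20).
rewrite [leRHS]mulrA ler_pM // ?mulr_ge0 ?exprn_ge0 ?divr_ge0 //.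
- rewrite -[leRHS]mulr1 ler_wpM2l ?mulr_ge0 ?exprn_ge0 //.
  by rewrite expr_div_n expr1n mul1r ler_pdivrMr ?exprn_gt0 // mul1r succ_le_exp2.
- by rewrite lerXn2r ?nnegrE // ler_pdivrMr // ler_peMr // ler1n.
Qed.

Lemma conv_dx f : conv (shrink_dx f).
Proof.
have [r [M [r0 fM]]] := cpsP f; exists (r / 2), (M / r).
by split; [rewrite divr_gt0|exact: norm_le_dx].
Qed.

Definition swap_fun (a : fps (fps K)) : fps (fps K) := fun i j => a j i.
Lemma conv_swap f : conv (swap_fun f).
Proof.
have [r [M [r0 fM]]] := cpsP f; exists r, M; split=> // N; apply: le_trans (fM N).
rewrite /psum2 exchange_big le_eqVlt; apply/orP; left; apply/eqP.
by apply: eq_bigr => i _; apply: eq_bigr => j _; congr (_ * _); exact: mulrC.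
Qed.
(** Exchanging x and y transports statements proved for one variable to the other. *)
Definition swap f : O := mk_cps (conv_swap f).
Lemma swapE f i j : swap f i j = f j i. Proof. by []. Qed.
Lemma swapK f : swap (swap f) = f. Proof. exact: cps_ext. Qed.
Lemma swap_is_additive : {morph swap : a b / a - b}.
Proof. by move=> a b; exact: cps_ext. Qed.
Lemma swap_is_multiplicative : monoid_morphism swap.
Proof.
split=> [|a b]; apply: cps_ext => i j; first by rewrite swapE !c1E andbC.
by rewrite swapE !cME exchange_big.
Qed.
HB.instance Definition _ := GRing.isZmodMorphism.Build O O swap swap_is_additive.
HB.instance Definition _ := GRing.isMonoidMorphism.Build O O swap swap_is_multiplicative.
Lemma swap_vx : swap (vx K) = vy K.
Proof. by apply: cps_ext => i j; rewrite swapE !cmonoE andbC. Qed.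
Lemma swap_vy : swap (vy K) = vx K.
Proof. by rewrite -swap_vx swapK. Qed.
Lemma swap_cst k : swap (cst k) = cst k.
Proof. by apply: cps_ext => i j; rewrite swapE !cstE andbC. Qed.
Lemma swap_eq0 f : swap f = 0 -> f = 0.
Proof. by move=> f0; rewrite -(swapK f) f0 rmorph0. Qed.

Definition dX f : O := mk_cps (conv_dx f).
Definition dY f : O := swap (dX (swap f)).
Lemma dXE f i j : dX f i j = (i.+1)%:R * f i.+1 j. Proof. by []. Qed.
Lemma dYE f i j : dY f i j = (j.+1)%:R * f i j.+1. Proof. by []. Qed.
Lemma dX_is_additive : {morph dX : a b / a - b}.
Proof. by move=> a b; apply: cps_ext => i j; rewrite cBE !dXE mulrBr. Qed.
HB.instance Definition _ := GRing.isZmodMorphism.Build O O dX dX_is_additive.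
Lemma dY_is_additive : {morph dY : a b / a - b}.
Proof. by move=> a b; rewrite /dY !rmorphB !raddfB. Qed.
HB.instance Definition _ := GRing.isZmodMorphism.Build O O dY dY_is_additive.
Lemma dXM f g : dX (f * g) = dX f * g + f * dX g.
Proof.
have dXcf h : cf (dX h) = fps_deriv (cf h).
  have fpsMn (u : fps K) n j : (u *+ n) j = u j *+ n.
    by elim: n => [|n IH]; rewrite ?mulr0n ?fps0E // !mulrS fpsDE IH.
  by apply: ps_ext => i j; rewrite [LHS]dXE /fps_deriv fpsMn mulr_natl.
apply/val_inj; have := fps_derivM (cf f) (cf g); rewrite -!dXcf => e.
exact: etrans (dXcf (f * g)) e.
Qed.
Lemma dYM f g : dY (f * g) = dY f * g + f * dY g.
Proof. by rewrite /dY rmorphM dXM rmorphD /= !rmorphM /= !swapK. Qed.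
Lemma dX_dY f : dX (dY f) = dY (dX f).
Proof. by apply: cps_ext => i j; rewrite dXE !dYE dXE; ring. Qed.
Lemma dX_cst k : dX (cst k) = 0.
Proof. by apply: cps_ext => i j; rewrite dXE cstE c0E mulr0. Qed.
Lemma dY_cst k : dY (cst k) = 0.
Proof. by rewrite /dY swap_cst dX_cst rmorph0. Qed.
Lemma dX00 f : dX f 0%N 0%N = f 1%N 0%N. Proof. by rewrite dXE mul1r. Qed.
Lemma dY00 f : dY f 0%N 0%N = f 0%N 1%N. Proof. by rewrite dYE mul1r. Qed.

Lemma conv_shift f : conv (fun i j => f i.+1 j).
Proof.
have [r [M [r0 fM]]] := cpsP f; exists r, (M / r); split=> // N; rewrite ler_pdivlMr //.
apply: le_trans (fM N.+1); rewrite -psum2Zr /psum2.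
rewrite [leRHS]big_ord_recl /= -[leLHS]add0r; apply: lerD.
  by apply: sumr_ge0 => j _; rewrite !mulr_ge0 ?exprn_ge0 // ltW.
apply: ler_sum => i _; rewrite [leRHS]big_ord_recr /= -[leLHS]addr0; apply: lerD.
  by apply: ler_sum => j _; rewrite exprS le_eqVlt; apply/orP; left; apply/eqP; ring.
by rewrite !mulr_ge0 ?exprn_ge0 // ltW.
Qed.
Lemma vx_factor f : (forall j, f 0%N j = 0) -> exists g, f = vx K * g.
Proof.
move=> f0; exists (mk_cps (conv_shift f)); apply: cps_ext => -[|i] j; first by rewrite f0 vxM.
by rewrite vxM.
Qed.
Lemma vxX_factor n f : (forall i j, (i < n)%N -> f i j = 0) -> exists g, f = vx K ^+ n * g.
Proof.
elim: n f => [|n IH] f fn; first by exists f; rewrite expr0 mul1r.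
have [|g fg] := @vx_factor f; first by move=> j; exact: fn.
have [|h gh] := IH g; last by exists h; rewrite fg gh exprS mulrA.
by move=> i j lt_in; have := fn i.+1 j lt_in; rewrite fg vxM.
Qed.
Lemma vyX_factor n f : (forall i j, (j < n)%N -> f i j = 0) -> exists g, f = vy K ^+ n * g.
Proof.
move=> fn; have [|g fg] := @vxX_factor n (swap f); first by move=> i j; exact: fn.
by exists (swap g); rewrite -(swapK f) fg rmorphM rmorphXn /= swap_vx.
Qed.

(* The Wronskians force the leading monomials of a and b to coincide; apply
   this to a - c b, with c the ratio of the leading coefficients. *)
Lemma wronskian_proportional f g : g <> 0 ->
  dX f * g = f * dX g -> dY f * g = f * dY g -> exists k, f = cst k * g.
Proof.
move=> g0 wx wy; have [p [q lg]] := lead_ex g0.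
have same_lead h i j : dX h * g = h * dX g -> dY h * g = h * dY g -> lead h i j ->
    i = p /\ j = q.
  move=> hx hy lh; have [[hij _] [gpq _]] := (lh, lg).
  have lhn : h i j * g p q <> 0 by apply/eqP; rewrite mulf_neq0 //; exact/eqP.
  have ex u a b : (vx K * dX u : O) a b = a%:R * u a b.
    by rewrite vxM; case: a => [|a]; rewrite ?mul0r.
  have ey u a b : (vy K * dY u : O) a b = b%:R * u a b.
    by rewrite vyM; case: b => [|b]; rewrite ?mul0r.
  have E u v a b c d (D : O -> O) (w : nat -> nat -> nat) : lead u a b -> lead v c d ->
      (forall u a b, D u a b = (w a b)%:R * u a b) ->
      (D u * v : O) (a + c)%N (b + d)%N = (w a b)%:R * (u a b * v c d).
    move=> lu lv ED; have [w0|w0] := eqVneq (w a b) 0%N.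
      rewrite w0 mul0r.
      apply: contrapT => nz; case: lu lv => _ lu [_ lv]; apply: nz; rewrite cME.
      rewrite big1 // => -[s sa] _; rewrite big1 // => -[t tb] _ /=; rewrite ED.
      apply: contrapT => /eqP; rewrite !mulf_eq0 !negb_or -andbA => /and3P[/eqP ws /eqP us /eqP vs].
      have := lu _ _ us; have := lv _ _ vs => h1 h2.
      have es : s = a by lia. have et : t = b by lia.
      by apply: ws; rewrite es et w0.
    have lD : lead (D u) a b.
      case: lu => uab lu; split; first by rewrite ED; apply/eqP; rewrite mulf_neq0 ?pnatr_eq0 //; exact/eqP.
      by move=> s t; rewrite ED => Du; apply: lu => us; apply: Du; rewrite us mulr0.
    by rewrite (lead_mulE lD lv) ED mulrA.
  have := congr1 (fun u : O => u (i + p)%N (j + q)%N) (congr1 (fun u => vx K * u) hx).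
  have := congr1 (fun u : O => u (i + p)%N (j + q)%N) (congr1 (fun u => vy K * u) hy).
  rewrite !mulrA [vy K * h]mulrC [vx K * h]mulrC -[h * _ * _]mulrA -[h * vx K * _]mulrA.
  rewrite ![h * (_ * _)]mulrC.
  rewrite (E _ _ _ _ _ _ (fun u => vy K * dY u) (fun _ b => b) lh lg ey).
  rewrite (E _ _ _ _ _ _ (fun u => vx K * dX u) (fun a _ => a) lh lg ex).
  rewrite [(i + p)%N]addnC [(j + q)%N]addnC.
  rewrite (E _ _ _ _ _ _ (fun u => vy K * dY u) (fun _ b => b) lg lh ey).
  rewrite (E _ _ _ _ _ _ (fun u => vx K * dX u) (fun a _ => a) lg lh ex).
  rewrite [g p q * _]mulrC => /(mulIf (introN eqP lhn)) /eqP + /(mulIf (introN eqP lhn)) /eqP.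
  by rewrite !eqr_nat => /eqP -> /eqP ->.
have gpq := lg.1; pose k := f p q / g p q; exists k.
apply/eqP; rewrite -subr_eq0; apply/eqP; apply: contrapT => d0.
have [i [j ld]] := lead_ex d0; have [||ei ej] := same_lead _ _ _ _ _ ld.
- by rewrite raddfB /= dXM dX_cst mul0r add0r !mulrBl wx; congr (_ - _); ring.
- by rewrite raddfB /= dYM dY_cst mul0r add0r !mulrBl wy; congr (_ - _); ring.
case: ld => + _; apply; rewrite ei ej cBE cstM /k divfK ?subrr //; exact/eqP.
Qed.
End Domain.

(** * Weierstrass division and divisibility *)

Section LinearRecursion.
Variables (K : numFieldType) (D : nat).
Hypothesis D_gt0 : (0 < D)%N.
Variables (g : nat -> nat -> K) (T : nat -> nat -> nat -> nat -> K).
Let deg i j := (j + D * i)%N.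
Hypothesis T_triangular : forall i j p q, T i j p q != 0 -> (deg p q < deg i j)%N.

Fixpoint rec_approx n : nat -> nat -> K :=
  if n is n'.+1 then
    fun i j => g i j + psum2 (fun p q => T i j p q * rec_approx n' p q) (deg i j)
  else fun _ _ => 0.

Lemma rec_approx_stable n m i j : (deg i j < n)%N -> (deg i j < m)%N ->
  rec_approx n i j = rec_approx m i j.
Proof.
elim: n m i j => [|n IH] [|m] i j //= ltn ltm; congr (_ + _).
apply: eq_psum2 => p q _ _; have [->|Tij] := eqVneq (T i j p q) 0; first by rewrite !mul0r.
by have lt := T_triangular Tij; congr (_ * _); apply: IH; apply: leq_trans lt _.
Qed.

(** Triangularity makes the recursion well founded on [deg]. It is stated for every large enough
    box, so that several indices can share the same N. *)
Lemma linear_recursion : exists u : nat -> nat -> K, forall i j N, (deg i j <= N)%N ->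
  u i j = g i j + psum2 (fun p q => T i j p q * u p q) N.
Proof.
exists (fun i j => rec_approx (deg i j).+1 i j) => i j N degN; rewrite /=; congr (_ + _).
transitivity (psum2 (fun p q => T i j p q * rec_approx (deg p q).+1 p q) (deg i j)).
  apply: eq_psum2 => p q _ _; have [->|Tij] := eqVneq (T i j p q) 0; first by rewrite !mul0r.
  by congr (_ * _); apply: rec_approx_stable => //; exact: T_triangular.
rewrite /psum2 (big_ord_widen N (fun p => \sum_(q < deg i j) T i j p q * rec_approx (deg p q).+1 p q)) //.
rewrite big_mkcond /=; apply: eq_bigr => p _; have degpq q : (p <= deg p q)%N /\ (q <= deg p q)%N.
  by split; [apply: leq_trans (leq_addl _ _); rewrite leq_pmull|exact: leq_addr].
case: ifP => pdeg.
  rewrite (big_ord_widen N (fun q => T i j p q * rec_approx (deg p q).+1 p q)) //.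
  rewrite big_mkcond /=; apply: eq_bigr => q _; case: ifP => // qdeg.
  have [->|Tij] := eqVneq (T i j p q) 0; first by rewrite !mul0r.
  by have := T_triangular Tij; have := (degpq q).2; lia.
rewrite big1 // => q _.
have [->|Tij] := eqVneq (T i j p q) 0; first by rewrite !mul0r.
by have := T_triangular Tij; have := (degpq q).1; lia.
Qed.

(** T has norm at most 1/2, so that S <= M + S / 2 for the norm S of u. To subtract S / 2 before S
    is known to be finite, the argument is run on the entries with [deg] below n, a range stable
    under the recursion by triangularity. *)
Lemma linear_recursion_bound (u : nat -> nat -> K) (s r M : K) : 0 <= s -> 0 <= r ->
  (forall i j N, (deg i j <= N)%N ->
    u i j = g i j + psum2 (fun p q => T i j p q * u p q) N) ->
  norm_le s r g M ->
  (forall p q N, psum2 (fun i j => `|T i j p q| * (s ^+ i * r ^+ j)) N <=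
                 2^-1 * (s ^+ p * r ^+ q)) ->
  norm_le s r u (2 * M).
Proof.
move=> s0 r0 uE gM TM N.
have w0 i j : 0 <= s ^+ i * r ^+ j by rewrite mulr_ge0 ?exprn_ge0.
pose v n i j := if (deg i j < n)%N then `|u i j| * (s ^+ i * r ^+ j) else 0.
have v0 n i j : 0 <= v n i j by rewrite /v; case: ifP => // _; rewrite mulr_ge0.
have bound n : psum2 (v n) n <= 2 * M.
  have : psum2 (v n) n <= M + 2^-1 * psum2 (v n) n.
    apply: le_trans (lerD (gM n) _); last first.
      rewrite -psum2Zl; apply: (@ler_psum2 _ (fun p q => psum2 (fun i j =>
        `|T i j p q| * (s ^+ i * r ^+ j)) n * (if (deg p q < n)%N then `|u p q| else 0))).
      move=> p q _ _; rewrite /v; case: ifP => _; last by rewrite !mulr0.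
      by rewrite mulrCA mulrC ler_wpM2l.
    under [X in _ <= _ + X]eq_psum2 => p q _ _ do rewrite -psum2Zr.
    rewrite -psum2_exchange -psum2D; apply: ler_psum2 => i j _ _.
    rewrite {1}/v; case: ifP => [lt|_]; last first.
      apply: addr_ge0; first exact: mulr_ge0.
      by apply: psum2_ge0 => p q; apply: mulr_ge0; [exact: mulr_ge0|case: ifP].
    rewrite (uE i j n (ltnW lt)).
    apply: le_trans (ler_wpM2r (w0 i j) (ler_normD _ _)) _.
    rewrite mulrDl lerD2l; apply: le_trans (ler_wpM2r (w0 i j) (psum2_norm _ _)) _.
    rewrite -psum2Zr; apply: ler_psum2 => p q _ _.
    have [->|Tij] := eqVneq (T i j p q) 0; first by rewrite !(mul0r, normr0).
    rewrite ifT; last exact: ltn_trans (T_triangular Tij) lt.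
    by rewrite normrM mulrAC.
  set S := psum2 _ _ => le.
  have -> : S = 2 * (S - 2^-1 * S) by field.
  by rewrite ler_wpM2l // lerBlDr.
apply: le_trans (bound (N + D * N)%N).
apply: (@le_trans _ _ (psum2 (v (N + D * N)%N) N)); last by apply: psum2_mono => //; exact: leq_addr.
apply: ler_psum2 => i j iN jN; rewrite /v ifT // /deg -addSn leq_add // leq_mul2l ltnW // orbT //.
Qed.
End LinearRecursion.

Section Weierstrass.
Variable K : numFieldType.
Notation O := (cps K).
Implicit Types (a b f g h : O).

(** Regularity of order d in y, the hypothesis of the Weierstrass theorems. *)
Definition yreg d f := (forall k, (k < d)%N -> f 0%N k = 0) /\ f 0%N d <> 0.

Lemma yreg_ex f j : f 0%N j <> 0 -> exists d, yreg d f.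
Proof.
move=> fj; pose P n := f 0%N n != 0.
have exP : exists n, P n by exists j; exact/eqP.
case: (ex_minnP exP) => d /eqP fd mind; exists d; split=> // k kd.
by apply: contrapT => /eqP /mind; lia.
Qed.

Lemma yregP f : (exists g, f = vx K * g) \/ exists d, yreg d f.
Proof.
have [f0|] := pselect (forall j, f 0%N j = 0); first by left; exact: vx_factor.
by move=> /existsNP[j /yreg_ex]; right.
Qed.

Lemma row0M f g j : (f * g : O) 0%N j = \sum_(q < j.+1) f 0%N q * g 0%N (j - q)%N.
Proof. by rewrite cME big_ord1. Qed.

Lemma yregM d e f g : yreg d f -> yreg e g -> yreg (d + e) (f * g).
Proof.
move=> [fd fd0] [ge ge0]; split=> [k kde|].
  rewrite row0M big1 // => -[q qk] _ /=; have [qd|dq] := ltnP q d.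
    by rewrite fd ?mul0r.
  by rewrite ge ?mulr0 //; lia.
rewrite row0M; have hd : (d < (d + e).+1)%N by lia.
rewrite (bigD1 (Ordinal hd)) //= addKn big1 ?addr0 => [|[q qde] /eqP neq /=]; last first.
  have [qd|dq] := ltnP q d; first by rewrite fd ?mul0r.
  rewrite ge ?mulr0 //; have : q <> d by move=> e'; apply: neq; exact/val_inj.
  by lia.
by apply/eqP; rewrite mulf_neq0 //; exact/eqP.
Qed.

Lemma yreg_uniq d e f : yreg d f -> yreg e f -> d = e.
Proof.
by move=> [fd fd0] [fe fe0]; case: (ltngtP d e) => [/fe|/fd|].
Qed.

Lemma yreg_row f g d : yreg d f -> (forall j, (f * g : O) 0%N j = 0) -> exists h, g = vx K * h.
Proof.
move=> fd fg0; have [//|[e ge]] := yregP g.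
by case: (yregM fd ge) => _; rewrite fg0.
Qed.

Lemma yreg_fact f g d : yreg d (f * g) ->
  exists d1 d2, [/\ yreg d1 f, yreg d2 g & d = (d1 + d2)%N].
Proof.
move=> [fg fgd]; have [[h fh]|[d1 fd1]] := yregP f.
  by exfalso; apply: fgd; rewrite fh -mulrA vxM.
have [[h gh]|[d2 gd2]] := yregP g.
  by exfalso; apply: fgd; rewrite gh mulrCA vxM.
by exists d1, d2; split=> //; apply: yreg_uniq (yregM fd1 gd2).
Qed.

(** Polynomials of degree < d in y over C{x}: the remainders of Weierstrass division. *)
Definition ydeg_lt d f := forall i j, (d <= j)%N -> f i j = 0.

(** If q = x^n h with h(0, y) of finite order e, then the row n of q a has a nonzero coefficient at
    y^(e + d), which is excluded. Hence every power of x divides q. *)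
Lemma weierstrass_uniq d a q : yreg d a -> ydeg_lt d (q * a) -> q = 0.
Proof.
move=> ad qa; apply: cps_ext => i j; rewrite c0E.
elim: i {-2}i (leqnn i) j => [|n IH] i le_in j.
  have [[h qh]|[e qe]] := yregP q.
    by rewrite qh vxM; move: le_in; case: i.
  by case: (yregM qe ad) => _; rewrite qa //; lia.
have [le_in'|lt_ni] := leqP i n; first exact: IH.
have ei : i = n.+1 by lia. subst i.
have [|h qh] := @vxX_factor _ n.+1 q; first by move=> i' j' lt; apply: IH; lia.
have [[h' hh]|[e he]] := yregP h; first by rewrite qh vxXM leqnn subnn hh vxM.
case: (yregM he ad) => _ []; rewrite -(qa n.+1 (e + d)%N) ?leq_addl //.
by rewrite qh -mulrA vxXM leqnn subnn.
Qed.

(** First r is chosen, to control y^j with j > d; then s, which may depend on r ^ d, to control the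
    multiples of x. These are the monomials that remain when the leading y^d is removed from a
    regular series. *)
Lemma small_radius (rho C : K) d : 0 < rho -> 0 < C -> exists s r : K,
  [/\ 0 < s <= rho, 0 < r <= rho & forall i j, (0 < i)%N || (d < j)%N ->
   s ^+ i * r ^+ j <= r ^+ d / C * (rho ^+ i * rho ^+ j)].
Proof.
move=> rho0 C0.
(* The number x / (C + x) lies below both 1 and x / C, which spares a minimum in a field with a
   partial order. *)
have frac (x : K) : 0 < x -> exists t, [/\ 0 < t, t <= 1 & t * C <= x].
  move=> x0; have D0 : 0 < C + x by rewrite addr_gt0.
  exists (x / (C + x)); split; first exact: divr_gt0.
    by rewrite ler_pdivrMr // mul1r lerDr ltW.
  by rewrite mulrAC ler_pdivrMr // ler_pM2l // lerDl ltW.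
have rd0 : 0 < rho ^+ d by rewrite exprn_gt0.
have [t [t0 t1 tC]] := frac _ rd0.
have [r rE] : exists r : K, r = t * rho by exists (t * rho).
have r0 : 0 < r by rewrite rE mulr_gt0.
have rd'0 : 0 < r ^+ d by rewrite exprn_gt0.
have [t' [t'0 t'1 t'C]] := frac _ rd'0.
have [s sE] : exists s : K, s = t' * rho by exists (t' * rho).
have s0 : 0 < s by rewrite sE mulr_gt0.
have srho : s <= rho by rewrite sE ler_piMl // ltW.
have rrho : r <= rho by rewrite rE ler_piMl // ltW.
exists s, r; split; rewrite ?s0 ?r0 //= => i j ij.
rewrite mulrAC ler_pdivlMr // [_ * C]mulrC.
have [rho0' r0' s0' C0'] : [/\ 0 <= rho, 0 <= r, 0 <= s & 0 <= C] by rewrite !ltW.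
have [t0' t'0'] : 0 <= t /\ 0 <= t' by rewrite !ltW.
case: i ij => [|i] /= ij.
  rewrite !expr0 !mul1r -(subnKC ij) !exprD !exprS.
  have -> : C * (r * r ^+ d * r ^+ (j - d.+1)) = (t * C * rho) * (r ^+ d * r ^+ (j - d.+1)).
    by rewrite {1}rE; ring.
  have -> : r ^+ d * (rho * rho ^+ d * rho ^+ (j - d.+1)) =
      (rho ^+ d * rho) * (r ^+ d * rho ^+ (j - d.+1)) by ring.
  apply: ler_pM; rewrite ?mulr_ge0 ?exprn_ge0 //; first exact: ler_wpM2r.
  by apply: ler_wpM2l; rewrite ?exprn_ge0 // lerXn2r.
rewrite !exprS.
have -> : C * (s * s ^+ i * r ^+ j) = (t' * C * rho) * (s ^+ i * r ^+ j) by rewrite {1}sE; ring.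
have -> : r ^+ d * (rho * rho ^+ i * rho ^+ j) = (r ^+ d * rho) * (rho ^+ i * rho ^+ j) by ring.
apply: ler_pM; rewrite ?mulr_ge0 ?exprn_ge0 //; first exact: ler_wpM2r.
by apply: ler_pM; rewrite ?exprn_ge0 ?lerXn2r.
Qed.

Lemma psum2_shift_down (h : nat -> nat -> K) d N : (forall i j, 0 <= h i j) ->
  psum2 (fun i k => h i (k + d)%N) N <= psum2 h (N + d).
Proof.
move=> h0; apply: (@le_trans _ _ (\sum_(i < N) \sum_(j < N + d) h i j)).
  apply: ler_sum => i _; rewrite [in leRHS]addnC big_split_ord /= -[leLHS]add0r.
  apply: lerD; first exact: sumr_ge0.
  by apply: ler_sum => j _; rewrite addnC.
rewrite /psum2 [leRHS]big_split_ord /= lerDl.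
by apply: sumr_ge0 => i _; exact: sumr_ge0.
Qed.

(* Dividing g by a = y^d - b amounts to solving q = tau (g + b q), tau dropping
   the monomials of degree < d in y and dividing by y^d; this is a contraction
   for the norm with radii s << r << 1. *)
Lemma weierstrass_monic d a g : yreg d a -> a 0%N d = 1 ->
  exists q r, g = q * a + r /\ ydeg_lt d r.
Proof.
move=> [ad _] ad1.
pose b : nat -> nat -> K := fun i j => if (i == 0)%N && (j <= d)%N then 0 else a i j.
pose T i k p q := if (p <= i)%N && (q <= k + d)%N then - b (i - p)%N (k + d - q)%N else 0.
(* Division by y^d can lower the exponent of y by at most d when that of x increases, which the
   weight d + 1 of x outbalances. When the exponent of x stays the same, [b] contributes only powers
   of y above d. *)
have Ttri i k p q : T i k p q != 0 -> (q + d.+1 * p < k + d.+1 * i)%N.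
  rewrite /T; case: ifP => [/andP[pi qk]|]; last by rewrite eqxx.
  rewrite oppr_eq0 /b; case: ifP => [|/negbT]; first by rewrite eqxx.
  rewrite negb_and -ltnNge subn_eq0 -ltnNge => /orP[lt_pi|lt] _; last by nia.
  have : (d.+1 * p.+1 <= d.+1 * i)%N by rewrite leq_mul2l lt_pi orbT.
  by rewrite mulnS; lia.
have [rho [Ma [Mg [rho0 aM gM]]]] := conv2 (cpsP a) (cpsP g).
have Ma0 := norm_le_ge0 aM.
have C0 : 0 < 2 * Ma + 1 by rewrite ltr_wpDl ?mulr_ge0.
have [s [r [/andP[s0 srho] /andP[r0 rrho] small]]] := small_radius d rho0 C0.
have rd0 : 0 < r ^+ d by rewrite exprn_gt0.
have w0 i j : 0 <= s ^+ i * r ^+ j by rewrite mulr_ge0 ?exprn_ge0 // ltW.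
have bM : norm_le s r b (r ^+ d / 2).
  have bMa : norm_le rho rho b Ma.
    move=> N; apply: le_trans (aM N); apply: ler_psum2 => i j _ _.
    rewrite /b; case: ifP => // _; rewrite normr0 mul0r mulr_ge0 //.
    by rewrite mulr_ge0 ?exprn_ge0 // ltW.
  have k0 : 0 <= r ^+ d / (2 * Ma + 1) by rewrite divr_ge0 ?ltW.
  have bnz i j : b i j != 0 -> s ^+ i * r ^+ j <=
      r ^+ d / (2 * Ma + 1) * (rho ^+ i * rho ^+ j).
    rewrite /b; case: ifP => [|/negbT]; first by rewrite eqxx.
    by rewrite negb_and -ltnNge -lt0n => nz _; exact: small.
  have sr : 0 <= s <= rho by rewrite ltW.
  have rr : 0 <= r <= rho by rewrite ltW.
  apply: norm_leW (norm_le_small sr rr k0 bnz bMa).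
  rewrite mulrAC ler_pdivrMr // mulrAC ler_pdivlMr // -mulrA ler_wpM2l ?(ltW rd0) //.
  by rewrite mulrC lerDl.
pose g' : nat -> nat -> K := fun i k => g i (k + d)%N.
have g'M : norm_le s r g' (Mg / r ^+ d).
  have gM' : norm_le s r g Mg by apply: norm_le_shrink gM; rewrite ltW.
  move=> N; rewrite ler_pdivlMr // -psum2Zr.
  apply: le_trans (gM' (N + d)%N).
  apply: le_trans (psum2_shift_down d N _); last by move=> i j; rewrite mulr_ge0.
  by apply: ler_psum2 => i k _ _; rewrite exprD !mulrA.
have TM p q N : psum2 (fun i k => `|T i k p q| * (s ^+ i * r ^+ k)) N <=
    2^-1 * (s ^+ p * r ^+ q).
  rewrite -(ler_pM2r rd0) -psum2Zr.
  pose h i j := (if (p <= i)%N && (q <= j)%N then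
    `|b (i - p)%N (j - q)%N| * (s ^+ (i - p) * r ^+ (j - q)) else 0).
  have h0 i j : 0 <= h i j by rewrite /h; case: ifP => // _; rewrite mulr_ge0.
  apply: (@le_trans _ _ (psum2 (fun i k => h i (k + d)%N) N * (s ^+ p * r ^+ q))).
    rewrite -psum2Zr; apply: ler_psum2 => i k _ _; rewrite /T /h.
    case: ifP => [/andP[pi qk]|_]; last by rewrite normr0 !mul0r.
    have es : s ^+ i = s ^+ p * s ^+ (i - p) by rewrite -exprD subnKC.
    have er : r ^+ k * r ^+ d = r ^+ q * r ^+ (k + d - q) by rewrite -!exprD subnKC.
    rewrite normrN -!mulrA er es le_eqVlt; apply/orP; left; apply/eqP; ring.
  rewrite [leRHS]mulrAC ler_wpM2r //.
  apply: le_trans (psum2_shift_down d N h0) _.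
  apply: le_trans (psum2_shift p q _ (g := fun i j => `|b i j| * (s ^+ i * r ^+ j)) _) _.
    by move=> i j; rewrite mulr_ge0.
  by apply: le_trans (bM _) _; rewrite mulrC.
have [u uE] := linear_recursion (ltn0Sn d) g' Ttri.
have uM := linear_recursion_bound Ttri (ltW s0) (ltW r0) uE g'M TM.
pose q : O := mk_cps (conv_aniso s0 r0 uM).
exists q, (g - q * a); split=> [|i j dj]; first by rewrite addrC subrK.
rewrite cBE -(subnK dj); set k := (j - d)%N.
pose N := (k + d.+1 * i + i + (k + d) + 1)%N.
have := uE i k N; rewrite (_ : (_ <= _)%N); last by rewrite /N; lia.
move=> /(_ isT); rewrite -/(g' i k) => uik.
have -> : (q * a : O) i (k + d)%N = psum2 (fun p q' => if (p <= i)%N && (q' <= k + d)%N then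
    u p q' * a (i - p)%N (k + d - q')%N else 0) N.
  by apply: (@psME_box _ (cf q) (cf a)); rewrite /N; lia.
have hi : (i < N)%N by rewrite /N; lia.
have hk : (k < N)%N by rewrite /N; lia.
have -> : psum2 (fun p q' => if (p <= i)%N && (q' <= k + d)%N then
    u p q' * a (i - p)%N (k + d - q')%N else 0) N =
  u i k - psum2 (fun p q' => T i k p q' * u p q') N.
  have -> : u i k = psum2 (fun p q' => if (p == i) && (q' == k) then u i k else 0) N.
    rewrite /psum2 (bigD1 (Ordinal hi)) //= (bigD1 (Ordinal hk)) //= !eqxx /=.
    rewrite big1 ?addr0 => [|q' /eqP ne]; last first.
      by rewrite ifF //; apply/eqP => e; apply: ne; exact/val_inj.
    rewrite big1 ?addr0 // => p /eqP ne; rewrite big1 // => q' _; rewrite ifF //.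
    by apply/negP => /andP[/eqP e _]; apply: ne; exact/val_inj.
  rewrite -psum2B; apply: eq_psum2 => p q' _ _; rewrite /T.
  case: ifP => [/andP[pi qk]|npq]; last first.
    rewrite mul0r subr0 ifF //; apply/negP => /andP[/eqP e /eqP e'].
    by move/negbT: npq; rewrite e e' leqnn leq_addr.
  rewrite mulNr opprK /b subn_eq0.
  have [->|nepi] := eqVneq p i; last first.
    have -> : (i <= p)%N = false by lia.
    by rewrite /= add0r mulrC.
  rewrite subnn leqnn /=; have [->|neqk] := eqVneq q' k.
    by rewrite addKn leqnn ad1 mul0r addr0 mulr1.
  rewrite add0r; have [lt_qk|le_kq] := leqP (k + d - q') d; last by rewrite mulrC.
  by rewrite ad ?mulr0 ?mul0r //; lia.
by rewrite uik addrK subrr.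
Qed.

Lemma weierstrass_division d a g : yreg d a ->
  exists q r, g = q * a + r /\ ydeg_lt d r.
Proof.
move=> ad; have [ad0 ad1] := ad; pose k := a 0%N d.
have k0 : k != 0 by exact/eqP.
have a'd : yreg d (cst k^-1 * a).
  split=> [j jd|]; first by rewrite cstM ad0 ?mulr0.
  by rewrite cstM mulVf //; apply/eqP; exact: oner_neq0.
have [|q [r [gE rd]]] := weierstrass_monic g a'd; first by rewrite cstM mulVf.
by exists (q * cst k^-1), r; rewrite -mulrA.
Qed.

(** A unit is regular of order 0, and a remainder of degree < 0 in y is zero. *)
Lemma unit_inv f : f 0%N 0%N <> 0 -> exists g, g * f = 1.
Proof.
move=> f0; have [|q [r [E r0]]] := @weierstrass_division 0 f 1; first by split.
exists q; rewrite E; suff -> : r = 0 by rewrite addr0.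
by apply: cps_ext => i j; rewrite c0E r0.
Qed.
End Weierstrass.

(** * Divisibility, coprimality and factorization in C{x,y} *)

Section Divisibility.
Variable K : numFieldType.
Notation O := (cps K).
Notation x := (vx K).
Notation y := (vy K).
Implicit Types (a b c f g h u v w q s t : O).

Definition dvd a b := exists q, b = q * a.

Lemma dvdd a : dvd a a. Proof. by exists 1; rewrite mul1r. Qed.
Lemma dvd0 a : dvd a 0. Proof. by exists 0; rewrite mul0r. Qed.
Lemma dvdMl a b c : dvd a c -> dvd a (b * c).
Proof. by move=> [q ->]; exists (b * q); rewrite mulrA. Qed.
Lemma dvdMr a b c : dvd a b -> dvd a (b * c).
Proof. by rewrite mulrC; exact: dvdMl. Qed.
Lemma dvdD a b c : dvd a b -> dvd a c -> dvd a (b + c).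
Proof. by move=> [q ->] [q' ->]; exists (q + q'); rewrite mulrDl. Qed.
Lemma dvdN a b : dvd a b -> dvd a (- b).
Proof. by move=> [q ->]; exists (- q); rewrite mulNr. Qed.
Lemma dvdB a b c : dvd a b -> dvd a c -> dvd a (b - c).
Proof. by move=> ab ac; apply: dvdD => //; exact: dvdN. Qed.
Lemma dvd_trans b a c : dvd a b -> dvd b c -> dvd a c.
Proof. by move=> [q ->] [q' ->]; exists (q' * q); rewrite mulrA. Qed.
Lemma dvd_addl a b c : dvd a c -> dvd a (b + c) -> dvd a b.
Proof. by move=> ac abc; rewrite -(addrK c b); exact: dvdB. Qed.
Lemma dvd_unit f g h : f 0%N 0%N <> 0 -> dvd g (f * h) -> dvd g h.
Proof. by move=> /unit_inv[f' f'f] /(dvdMl f'); rewrite mulrA f'f mul1r. Qed.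
Lemma dvd00 a b : dvd a b -> a 0%N 0%N = 0 -> b 0%N 0%N = 0.
Proof. by move=> [q ->] a0; rewrite cM00 a0 mulr0. Qed.
Lemma dvd_swap a b : dvd (swap a) (swap b) -> dvd a b.
Proof. by move=> [q e]; exists (swap q); rewrite -(swapK b) e rmorphM /= swapK. Qed.

Definition xonly c := ydeg_lt 1 c.
Lemma ydeg_ltMx d c f : xonly c -> ydeg_lt d f -> ydeg_lt d (c * f).
Proof.
move=> cx fd i j dj; rewrite cME big1 // => -[p pi] _; rewrite big1 // => -[q qj] _ /=.
case: q qj => [|q] qj; first by rewrite subn0 fd ?mulr0.
by rewrite cx ?mul0r.
Qed.
Lemma ydeg_ltB d f g : ydeg_lt d f -> ydeg_lt d g -> ydeg_lt d (f - g).
Proof. by move=> fd gd i j dj; rewrite cBE fd ?gd ?subr0. Qed.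
Lemma ydeg_lt0 d : ydeg_lt d (0 : O). Proof. by move=> i j _; exact: c0E. Qed.
Lemma ydeg_lt_sum d (I : Type) (r : seq I) (P : pred I) (F : I -> O) :
  (forall i, P i -> ydeg_lt d (F i)) -> ydeg_lt d (\sum_(i <- r | P i) F i).
Proof.
move=> Fd; elim/big_rec: _ => [|i z Pi zd]; first exact: ydeg_lt0.
by rewrite -[z]opprK; apply: ydeg_ltB; [exact: Fd|move=> p q dq; rewrite cNE zd ?oppr0].
Qed.
Lemma xonly_cst (k : K) : xonly (cst k).
Proof. by move=> i [|j] // _; rewrite cstE andbF. Qed.
Lemma xonly_dX c : xonly c -> xonly (dX c).
Proof. by move=> cx i j ij; rewrite dXE cx ?mulr0. Qed.
Lemma xonly_dY c : xonly c -> dY c = 0.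
Proof. by move=> cx; apply: cps_ext => i j; rewrite dYE cx ?mulr0 ?c0E. Qed.

Lemma yreg_vyX n : yreg n (y ^+ n).
Proof.
split=> [k kn|]; rewrite -[y ^+ n]mulr1 vyXM; first by rewrite leqNgt kn.
by rewrite leqnn subnn c1E; apply/eqP; exact: oner_neq0.
Qed.

Lemma ydeg_top e f : ydeg_lt e.+1 f -> exists c g, [/\ xonly c, ydeg_lt e g & f = c * y ^+ e + g].
Proof.
move=> fe; have [c [g [fE ge]]] := weierstrass_division f (yreg_vyX e).
exists c, g; split=> // i j j1; have := fe i (j + e)%N; rewrite fE cDE mulrC vyXM leq_addl addnK.
by rewrite ge ?leq_addl // addr0 => ->; rewrite ?ltnS //; lia.
Qed.

(** Too many vectors in a free C{x}-module of rank e; Gaussian elimination without fractions on the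
    coefficient of y^(e-1). *)
Lemma xonly_relation e (r : 'I_e.+1 -> O) : (forall i, ydeg_lt e (r i)) ->
  exists c : 'I_e.+1 -> O, [/\ forall i, xonly (c i), exists i, c i <> 0 &
    \sum_i c i * r i = 0].
Proof.
elim: e r => [|e IH] r re.
  exists (fun _ => 1); split.
  - by move=> _; rewrite -(rmorph1 (@cst K)); exact: xonly_cst.
  - by exists ord0; apply/eqP; exact: oner_neq0.
  - by rewrite big1 // => i _; rewrite mul1r; apply: cps_ext => p q; rewrite c0E re.
have [C CP] := choice (fun i => ydeg_top (re i)).
have [R RP] := choice CP.
have [allC|] := pselect (forall i, C i = 0).
  have [|c [cx [i ci] cr]] := IH (fun i => r (lift ord_max i)).
    by move=> i; have [_ Ri ->] := RP (lift ord_max i); rewrite allC mul0r add0r.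
  exists (fun j => if unlift ord_max j is Some i then c i else 0); split.
  - by move=> j; case: unliftP => // _; exact: ydeg_lt0.
  - by exists (lift ord_max i); rewrite liftK.
  - rewrite (bigD1_ord ord_max) //= unlift_none mul0r add0r -[RHS]cr.
    by apply: eq_bigr => k _; rewrite liftK.
move=> /existsNP[p Cp].
have [|c [cx [i ci] cr]] := IH (fun i => C p * r (lift p i) - C (lift p i) * r p).
  move=> i; have [Cpx Rp rp] := RP p; have [Cix Ri ri] := RP (lift p i).
  rewrite rp ri (_ : _ - _ = C p * R (lift p i) - C (lift p i) * R p); last by ring.
  by apply: ydeg_ltB; exact: ydeg_ltMx.
(* Expanding the relation between the C p r_i - C_i r_p; the index p receives all the correction
   terms. *)
exists (fun j => if unlift p j is Some i then c i * C p
                 else - \sum_i c i * C (lift p i)); split.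
- move=> j; case: unliftP => [k _|_]; first by apply: ydeg_ltMx; [exact: cx|case: (RP p)].
  rewrite -[- _]add0r; apply: ydeg_ltB; first exact: ydeg_lt0.
  by apply: ydeg_lt_sum => k _; apply: ydeg_ltMx; [exact: cx|case: (RP (lift p k))].
- by exists (lift p i); rewrite liftK; exact: cmul_neq0.
- rewrite (bigD1_ord p) //= unlift_none mulNr mulr_suml -sumrN -big_split -[RHS]cr /=.
  by apply: eq_bigr => k _; rewrite liftK; ring.
Qed.

Lemma xonly_relation_mod d a (g : 'I_d.+1 -> O) : yreg d a ->
  exists c : 'I_d.+1 -> O, [/\ forall i, xonly (c i), exists i, c i <> 0 &
    dvd a (\sum_i c i * g i)].
Proof.
move=> ad; have [q qP] := choice (fun i => weierstrass_division (g i) ad).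
have [r rP] := choice qP.
have [|c [cx c0 cr]] := @xonly_relation d r; first by move=> i; case: (rP i).
exists c; split=> //; exists (\sum_i c i * q i); rewrite mulr_suml.
have -> : \sum_i c i * g i = \sum_i c i * q i * a + \sum_i c i * r i.
  by rewrite -big_split /=; apply: eq_bigr => i _; have [{1}-> _] := rP i; ring.
by rewrite cr addr0.
Qed.

Lemma vx_part f : f <> 0 -> exists M g, f = x ^+ M * g /\ exists d, yreg d g.
Proof.
move=> f0; pose P i := `[< exists j, f i j <> 0 >].
have exP : exists i, P i.
  apply: contrapT => nP; apply: f0; apply: cps_ext => i j; rewrite c0E; apply: contrapT => fij.
  by apply: nP; exists i; apply/asboolP; exists j.
case: (ex_minnP exP) => M /asboolP[j fMj] minM.
have [|g fg] := @vxX_factor _ M f.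
  move=> i k iM; apply: contrapT => fik; have : (M <= i)%N; last by lia.
  by apply: minM; apply/asboolP; exists k.
exists M, g; split=> //; apply: (@yreg_ex _ _ j).
by move: fMj; rewrite fg vxXM leqnn subnn.
Qed.

(** In C{x}, a nonzero series is a power of x times a unit. *)
Lemma xonly_vxX c : xonly c -> c <> 0 -> exists M v, x ^+ M = v * c.
Proof.
move=> cx c0; have [M [g [cE [d [gd gd0]]]]] := vx_part c0.
have g00 : g 0%N 0%N <> 0.
  case: d gd gd0 => // d _ []; have := cx M d.+1; rewrite cE vxXM leqnn subnn.
  exact.
by have [v vg] := unit_inv g00; exists M, v; rewrite cE mulrCA vg mulr1.
Qed.

Lemma yreg_dvd_cancel d a n f : yreg d a -> dvd a (x ^+ n * f) -> dvd a f.
Proof.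
move=> ad; elim: n => [|n IH]; first by rewrite expr0 mul1r.
rewrite exprS -mulrA => -[q e]; apply: IH.
have [|h qh] := yreg_row ad (g := q); first by move=> j; rewrite mulrC -e vxM.
by exists h; apply: (cmulI (@vx_neq0 K)); rewrite e qh mulrA.
Qed.

Definition x_in a b := exists M u v, x ^+ M = u * a + v * b.
Definition y_in a b := exists M u v, y ^+ M = u * a + v * b.
Definition common a b := exists q, [/\ q 0%N 0%N = 0, dvd q a & dvd q b].
(* For non-units, this says that (a, b) has finite colength. *)
Definition coprime_germs a b := x_in a b /\ y_in a b.

(** The powers of b satisfy a relation over C{x} modulo a. If its constant term is nonzero, a power
    of x lies in (a, b). Otherwise it factors as S b, and either S is the required zero divisor or a
    divides S, a shorter relation. *)
Lemma x_in_or_zerodivisor d a b : yreg d a ->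
  x_in a b \/ exists s, ~ dvd a s /\ dvd a (s * b).
Proof.
move=> ad; have [c [cx c0]] := xonly_relation_mod (fun i : 'I_d.+1 => b ^+ i) ad.
move: d.+1 c cx c0 {ad}; elim=> [|n IH] c cx [i ci]; first by case: i ci.
rewrite big_ord_recl expr0 mulr1 /=.
pose S := \sum_(j < n) c (lift ord0 j) * b ^+ j.
have -> : \sum_(j < n) c (lift ord0 j) * b ^+ bump 0 j = S * b.
  by rewrite mulr_suml; apply: eq_bigr => j _; rewrite /bump add1n exprSr mulrA.
have [c0|c0] := pselect (c ord0 = 0); last first.
  move=> [q e]; left; have [M [v vE]] := xonly_vxX (cx ord0) c0.
  exists M, (v * q), (- v * S); rewrite vE -[v * q * a]mulrA -e; ring.
rewrite c0 add0r => aSb; have [aS|naS] := pselect (dvd a S); last by right; exists S.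
apply: (IH (fun j => c (lift ord0 j))) => //.
by case: (unliftP ord0 i) ci => [j ->|->] // cj; exists j.
Qed.

(** Among the nonzero s with a | s b take one of least y-degree, and let u be s without its power of
    x. The remainder of a by u again has the property, with smaller degree, so it is 0 and a = q u.
    Cancelling u in u b = w a gives b = w q, and q is not a unit because u has smaller y-order than
    a. *)
Lemma yreg_x_in_or_common d a b : yreg d a -> x_in a b \/ common a b.
Proof.
move=> ad; have [|[s [nas asb]]] := x_in_or_zerodivisor b ad; first by left.
right; pose P e := `[< exists s, [/\ s <> 0, ydeg_lt e s & dvd a (s * b)] >].
have [q0 [r0 [sE r0d]]] := weierstrass_division s ad.
have Pd : P d.
  apply/asboolP; exists r0; split=> //.
    by move=> r00; apply: nas; exists q0; rewrite sE r00 addr0.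
  have -> : r0 * b = s * b - a * (q0 * b) by rewrite sE; ring.
  by apply: dvdB => //; apply: dvdMr; exact: dvdd.
have exP : exists e, P e by exists d.
case: (ex_minnP exP) => e /asboolP[t [t0 te atb]] mine.
have [M [u [tE [e' ue']]]] := vx_part t0.
have aub : dvd a (u * b) by apply: (yreg_dvd_cancel (n := M) ad); rewrite mulrA -tE.
have e'e : (e' < e)%N.
  rewrite ltnNge; apply/negP => le; case: ue' => _; apply.
  by have := te M e' le; rewrite tE vxXM leqnn subnn.
have [q [r [aE re']]] := weierstrass_division a ue'.
have r0' : r = 0.
  apply: contrapT => rn0; have : (e <= e')%N; last by lia.
  apply: mine; apply/asboolP; exists r; split=> //.
  have -> : r * b = a * b - q * (u * b) by rewrite aE; ring.
  by apply: dvdB; [apply: dvdMr; exact: dvdd|exact: dvdMl].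
rewrite r0' addr0 in aE; case: aub => w ubE; exists q; split.
- apply: contrapT => q00; have q0reg : yreg 0 q by split.
  have := yreg_uniq ad (_ : yreg (0 + e') a); rewrite {1}aE => /(_ (yregM q0reg ue')).
  by have := mine _ Pd; lia.
- by exists u; rewrite aE mulrC.
- exists w; apply: (@cmulI _ u); first by move=> u0; apply: t0; rewrite tE u0 mulr0.
  by rewrite ubE aE; ring.
Qed.

Lemma x_in_sym a b : x_in a b -> x_in b a.
Proof. by move=> [M [u [v e]]]; exists M, v, u; rewrite addrC. Qed.
Lemma common_sym a b : common a b -> common b a.
Proof. by move=> [q [q0 qa qb]]; exists q. Qed.

Lemma x_in_or_common a b : x_in a b \/ common a b.
Proof.
have [[a' aE]|[d ad]] := yregP a; last exact: yreg_x_in_or_common ad.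
have [[b' bE]|[d bd]] := yregP b; last first.
  by case: (yreg_x_in_or_common a bd) => [/x_in_sym|/common_sym]; [left|right].
right; exists x; rewrite aE bE; split=> //; apply: dvdMr; exact: dvdd.
Qed.

Lemma common_swap a b : common (swap a) (swap b) -> common a b.
Proof.
by move=> [q [q0 qa qb]]; exists (swap q); split=> //; apply: dvd_swap; rewrite swapK.
Qed.

Lemma y_in_swap a b : x_in (swap a) (swap b) -> y_in a b.
Proof.
move=> [M [u [v e]]]; exists M, (swap u), (swap v); rewrite -[LHS]swapK rmorphXn /= swap_vy e.
by rewrite rmorphD !rmorphM /= !swapK.
Qed.

Lemma coprime_or_common a b : coprime_germs a b \/ common a b.
Proof.
have [ab|?] := x_in_or_common a b; last by right.
have [/y_in_swap ab'|/common_swap ?] := x_in_or_common (swap a) (swap b); last by right.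
by left.
Qed.

Lemma coprime_germs_sym a b : coprime_germs a b -> coprime_germs b a.
Proof.
move=> [ab [M [u [v e]]]]; split; first exact: x_in_sym.
by exists M, v, u; rewrite addrC.
Qed.

(* x^M c = a p1 and y^N c = a p2 give x^M p2 = y^N p1, hence y^N divides p2. *)
Lemma euclid a b c : a <> 0 -> coprime_germs a b -> dvd a (b * c) -> dvd a c.
Proof.
move=> a0 [[M [u [v e]]] [N [u' [v' e']]]] [q bcE].
pose p1 := u * c + v * q; pose p2 := u' * c + v' * q.
have E1 : x ^+ M * c = a * p1.
  by rewrite e /p1 mulrDl -[v * b * c]mulrA bcE; ring.
have E2 : y ^+ N * c = a * p2.
  by rewrite e' /p2 mulrDl -[v' * b * c]mulrA bcE; ring.
have E3 : x ^+ M * p2 = y ^+ N * p1.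
  by apply: (cmulI a0); rewrite mulrCA -E2 mulrCA E1; ring.
have [|p3 p2E] := @vyX_factor _ N p2.
  move=> i j jN; have := congr1 (fun f : O => f (i + M)%N j) E3.
  by rewrite vxXM vyXM leq_addl addnK leqNgt jN.
exists p3; apply: (cmulI (@cexp_neq0 _ y N (@vy_neq0 K))).
by rewrite E2 p2E; ring.
Qed.

Definition irred f := [/\ f <> 0, f 0%N 0%N = 0 &
  forall g h, f = g * h -> g 0%N 0%N <> 0 \/ h 0%N 0%N <> 0].

Lemma irred_dichotomy f w : irred f -> coprime_germs f w \/ dvd f w.
Proof.
move=> [f0 f00 fi]; have [?|[q [q0 [g fE] qw]]] := coprime_or_common f w; first by left.
right; apply: dvd_trans qw; have [g0|//] := fi _ _ fE.
by apply: (@dvd_unit g) => //; exists 1; rewrite fE mul1r.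
Qed.

Lemma irred_prime f a b : irred f -> dvd f (a * b) -> dvd f a \/ dvd f b.
Proof.
move=> fi fab; have [fa|] := irred_dichotomy a fi; last by left.
by right; case: fi => f0 _ _; exact: euclid fab.
Qed.

Lemma irred_primeX f a n : irred f -> dvd f (a ^+ n) -> dvd f a.
Proof.
move=> fi; elim: n => [|n IH]; last by rewrite exprS => /(irred_prime fi)[|/IH].
case: fi => _ f00 _; rewrite expr0 => /dvd00 /(_ f00); rewrite c1E => /eqP.
by rewrite oner_eq0.
Qed.

(** Removing a non-unit factor lowers the order: the measure for the inductions that follow. *)
Lemma ordge_nonunit_fact n f g : f 0%N 0%N = 0 -> ~ ordge n.+1 (f * g) -> ~ ordge n g.
Proof. by move=> /ordge1 f1 nfg gn; apply: nfg; rewrite -add1n; exact: ordgeM. Qed.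

Lemma ord_ex f : f <> 0 -> exists n, ~ ordge n f.
Proof. by move=> f0; apply: contrapT => nex; apply: f0; apply: ordge0 => n; apply: contrapT => nf; apply: nex; exists n. Qed.

Lemma gcd_ex a b : a <> 0 -> exists g u v, [/\ a = g * u, b = g * v & coprime_germs u v].
Proof.
move=> a0; have [n] := ord_ex a0; elim: n a b a0 => [|n IH] a b a0 na; first by exfalso; apply: na.
have [?|[q [q0 [a' aE] [b' bE]]]] := coprime_or_common a b; first by exists 1, a, b; rewrite !mul1r.
have [||g [u [v [a'E b'E uv]]]] := IH a' b'.
- by move=> a'0; apply: a0; rewrite aE a'0 mul0r.
- by apply: (ordge_nonunit_fact q0); rewrite mulrC -aE.
by exists (g * q), u, v; split=> //; rewrite (aE, bE) (a'E, b'E); ring.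
Qed.

Lemma irred_factor u : u <> 0 -> u 0%N 0%N = 0 -> exists f, irred f /\ dvd f u.
Proof.
move=> u0 u00; have [n] := ord_ex u0; elim: n u u0 u00 => [|n IH] u u0 u00 nu; first by exfalso; apply: nu.
have [ui|nui] := pselect (irred u); first by exists u; split=> //; exact: dvdd.
have [g [h [uE g0 h0]]] : exists g h, [/\ u = g * h, g 0%N 0%N = 0 & h 0%N 0%N = 0].
  apply: contrapT => nex; apply: nui; split=> // g h uE; apply: contrapT => /not_orP[/contrapT g0 /contrapT h0].
  by apply: nex; exists g, h.
have [|//||f [fi fh]] := IH h; last by exists f; split=> //; rewrite uE; exact: dvdMl.
- by move=> h0'; apply: u0; rewrite uE h0' mulr0.
- by apply: (ordge_nonunit_fact g0); rewrite -uE.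
Qed.

Lemma multiplicity f u : f 0%N 0%N = 0 -> u <> 0 ->
  exists e w, u = f ^+ e * w /\ ~ dvd f w.
Proof.
move=> f0 u0; have [n] := ord_ex u0; elim: n u u0 => [|n IH] u u0 nu; first by exfalso; apply: nu.
have [[u' uE]|nfu] := pselect (dvd f u); last by exists 0%N, u; rewrite expr0 mul1r.
have [||e [w [u'E nfw]]] := IH u'.
- by move=> u'0; apply: u0; rewrite uE u'0 mul0r.
- by apply: (ordge_nonunit_fact f0); rewrite mulrC -uE.
by exists e.+1, w; split=> //; rewrite uE u'E exprS; ring.
Qed.

(** Each f_i that divides h is taken out of it, which lowers the order; an f_j with j <> i that
    divides h must divide the quotient, being prime. *)
Lemma finitely_many_factors (f : nat -> O) h : (forall j, irred (f j)) ->
  (forall i j, i <> j -> ~ dvd (f i) (f j)) -> h <> 0 ->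
  exists J, forall j, (J <= j)%N -> ~ dvd (f j) h.
Proof.
move=> fi fij h0; have [n] := ord_ex h0; elim: n h h0 => [|n IH] h h0 nh; first by exfalso; apply: nh.
have [[i [q hE]]|nex] := pselect (exists i, dvd (f i) h); last first.
  by exists 0%N => j _ fjh; apply: nex; exists j.
have [||J JP] := IH q.
- by move=> q0; apply: h0; rewrite hE q0 mul0r.
- by case: (fi i) => _ fi0 _; apply: (ordge_nonunit_fact fi0); rewrite mulrC -hE.
exists (maxn J i.+1) => j; rewrite geq_max => /andP[Jj ij]; rewrite hE.
by move=> /(irred_prime (fi j))[/(JP _ Jj)|/fij]; last by apply; lia.
Qed.
End Divisibility.

(** * Invariant curves *)

Section VectorFields.
Variable K : numFieldType.
Notation O := (cps K).
Implicit Types (f g h u v w : O) (X Y Z : O * O).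

Definition der X f : O := X.1 * dX f + X.2 * dY f.

Lemma der_is_additive X : {morph der X : a b / a - b}.
Proof. by move=> a b; rewrite /der !raddfB /=; ring. Qed.
HB.instance Definition _ X := GRing.isZmodMorphism.Build O O (der X) (der_is_additive X).
Lemma derM X f g : der X (f * g) = der X f * g + f * der X g.
Proof. by rewrite /der dXM dYM; ring. Qed.
Lemma der_cst X k : der X (cst k) = 0.
Proof. by rewrite /der dX_cst dY_cst !mulr0 addr0. Qed.
Lemma der_cstM X k f : der X (cst k * f) = cst k * der X f.
Proof. by rewrite derM der_cst mul0r add0r. Qed.
Lemma der1 X : der X 1 = 0. Proof. by rewrite -(rmorph1 (@cst K)); exact: der_cst. Qed.
Lemma derXn X f n : der X (f ^+ n) = n%:R * f ^+ n.-1 * der X f.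
Proof.
elim: n => [|n IH]; first by rewrite expr0 der1; ring.
rewrite exprS derM IH /=; case: n {IH} => [|n]; first by rewrite expr0; ring.
by rewrite /= exprS -natr1; ring.
Qed.
Lemma der_xonly X c : xonly c -> der X c = X.1 * dX c.
Proof. by move=> cx; rewrite /der xonly_dY // mulr0 addr0. Qed.
Lemma dvd_der X f u : dvd f (der X f) -> dvd f u -> dvd f (der X u).
Proof.
move=> Xf [q ->]; rewrite derM; apply: dvdD; last exact: dvdMl.
by apply: dvdMl; exact: dvdd.
Qed.

Definition swap_field X : O * O := (swap X.2, swap X.1).
Lemma der_swap X f : der (swap_field X) (swap f) = swap (der X f).
Proof.
by rewrite /der /swap_field rmorphD !rmorphM /= addrC /dY !swapK.
Qed.

Lemma yreg_or_swap f : irred f -> exists d, yreg d f \/ yreg d (swap f).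
Proof.
move=> [_ _ fi]; have [[g fE]|[d fd]] := yregP f; last by exists d; left.
exists 1%N; right; rewrite fE rmorphM /= swap_vx -[1%N]addn0; apply: yregM.
  by rewrite -[vy K]expr1; exact: yreg_vyX.
by split=> //; have [|] := fi _ _ fE.
Qed.

Lemma irred_swap f : irred f -> irred (swap f).
Proof.
move=> [f0 f00 fi]; split=> [/swap_eq0|//|g h e] //.
by have := fi (swap g) (swap h); apply; rewrite -rmorphM /= -e swapK.
Qed.

(** The y-order d is positive, so c is its own remainder and uniqueness of the division applies. *)
Lemma yreg_xonly_dvd d f c : f 0%N 0%N = 0 -> yreg d f -> xonly c -> dvd f c -> c = 0.
Proof.
move=> f00 fd cx [q cE]; rewrite cE (@weierstrass_uniq _ d f q) ?mul0r //.
move=> i j dj; rewrite -cE cx //; apply: leq_trans dj.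
by rewrite lt0n; apply/eqP => d0; case: fd => _; rewrite d0.
Qed.

(** The y-order of dY f is d - 1, so f cannot divide it. Thus X vanishes along {f = 0} as soon as
    its first component does. *)
Lemma yreg_dvd_field d f X : irred f -> yreg d f -> dvd f (der X f) -> dvd f X.1 -> dvd f X.2.
Proof.
move=> fi fd Xf X1; have : dvd f (X.2 * dY f).
  by apply: (dvd_addl (c := X.1 * dX f)); [exact: dvdMr|rewrite addrC].
move=> /(irred_prime fi)[//|[q dfE]]; exfalso.
have [_ f00 _] := fi; case: d fd => [[_]//|d [fd fd1]].
have dYd : yreg d (dY f).
  split=> [k kd|]; rewrite dYE; first by rewrite fd ?mulr0.
  by apply/eqP; rewrite mulf_neq0 ?pnatr_eq0 //; exact/eqP.
move: dYd; rewrite dfE => /yreg_fact[d1 [d2 [_ fd2 dE]]].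
have := yreg_uniq fd2 (conj fd fd1); lia.
Qed.
End VectorFields.

(** * First integrals along an invariant curve *)

Section RankOne.
Variable K : numClosedFieldType.
Notation O := (cps K).
Implicit Types (f g h u v w : O) (X Y Z : O * O).

(** The binary form of degree N attached to p; over a closed field it splits into linear forms in u
    and v. *)
Definition homog (u v : O) (p : {poly K}) N : O :=
  \sum_(i < N.+1) cst p`_i * (u ^+ i * v ^+ (N - i)).

Lemma homog_roots u v (rs : seq K) :
  homog u v (\prod_(z <- rs) ('X - z%:P)) (size rs) = \prod_(z <- rs) (u - cst z * v).
Proof.
elim: rs => [|z rs IH]; first by rewrite !big_nil /homog big_ord1 coef1 rmorph1 !expr0 !mulr1.
rewrite !big_cons -IH; set p := \prod_(_ <- rs) _; set N := size rs.
have pN1 : p`_N.+1 = 0.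
  by rewrite nth_default // size_prod_XsubC.
rewrite /homog [RHS]mulrBl !mulr_sumr.
transitivity (\sum_(i < N.+2) cst ('X * p)`_i * (u ^+ i * v ^+ (N.+1 - i)) -
              \sum_(i < N.+2) cst (z * p`_i) * (u ^+ i * v ^+ (N.+1 - i))).
  rewrite -sumrB; apply: eq_bigr => i _.
  by rewrite mulrBl coefB mul_polyC coefZ rmorphB mulrBl.
congr (_ - _).
  rewrite big_ord_recl coefXM /= rmorph0 mul0r add0r; apply: eq_bigr => i _.
  by rewrite coefXM /bump /= add1n subSS exprS; ring.
rewrite big_ord_recr /= pN1 mulr0 rmorph0 mul0r addr0; apply: eq_bigr => -[i iN] _ /=.
by rewrite subSn // exprS rmorphM /=; ring.
Qed.

(* The functions u^i v^(n-i) restricted to {f = 0} satisfy a relation over C{x};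
   differentiating one of minimal degree n along X shows that its coefficients
   are proportional to constants, so that it splits into linear factors. *)
Lemma rank_one_yreg d f X u v : irred f -> yreg d f -> dvd f (der X f) -> ~ dvd f X.1 ->
  dvd f (der X u * v - u * der X v) -> dvd f v \/ exists k, dvd f (u - cst k * v).
Proof.
move=> fi fd Xf X1 W; have [|nfv] := pselect (dvd f v); [by left|right].
have [f0 f00 _] := fi.
pose P n := `[< exists c : 'I_n.+1 -> O, [/\ forall i, xonly (c i), exists i, c i <> 0 &
  dvd f (\sum_i c i * (u ^+ i * v ^+ (n - i)))] >].
have exP : exists n, P n.
  by exists d; apply/asboolP; exact: xonly_relation_mod (fun i : 'I_d.+1 => u ^+ i * v ^+ (d - i)) fd.
case: (ex_minnP exP) => n /asboolP[c [cx [i0 ci0] fS]] minn.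
(* Without its top term the relation is divisible by v, which leaves one of degree n - 1; minimality
   forces it to be trivial. *)
have lower (e : 'I_n.+1 -> O) : (forall i, xonly (e i)) -> e ord_max = 0 ->
    dvd f (\sum_i e i * (u ^+ i * v ^+ (n - i))) -> forall i, e i = 0.
  move=> ex en fe i; apply: contrapT => ei.
  have ilt : (i < n)%N.
    have := ltn_ord i; rewrite ltnS leq_eqVlt => /orP[/eqP in_|//].
    by exfalso; apply: ei; rewrite -en; congr e; exact/val_inj.
  case: n c cx i0 ci0 fS minn e ex en fe i ei ilt => // n c cx i0 ci0 fS minn e ex en fe i ei ilt.
  suff : (n.+1 <= n)%N by rewrite ltnn.
  apply: minn; apply/asboolP; exists (fun j => e (widen_ord (leqnSn _) j)); split=> //.
    by exists (Ordinal ilt); move: ei; congr (e _ <> _); exact/val_inj.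
  have : dvd f (v * \sum_(j < n.+1) e (widen_ord (leqnSn _) j) * (u ^+ j * v ^+ (n - j))).
    move: fe; rewrite big_ord_recr /= en mul0r addr0 mulr_sumr.
    congr (dvd f _); apply: eq_bigr => -[j jn] _ /=.
    by rewrite subSn // exprS; ring.
  by move=> /(irred_prime fi)[].
have cn0 : c ord_max <> 0.
  by move=> cn; apply: ci0; exact: lower.
pose S' := \sum_i dX (c i) * (u ^+ i * v ^+ (n - i)).
(* Modulo the Wronskian of u and v, all monomials of degree n are multiplied by the same n X(v) / v
   under X. *)
have monoE i : (i <= n)%N -> exists g, v * der X (u ^+ i * v ^+ (n - i)) =
    g * (der X u * v - u * der X v) + n%:R * der X v * (u ^+ i * v ^+ (n - i)).
  move=> le_in; exists (i%:R * u ^+ i.-1 * v ^+ (n - i)).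
  rewrite derM !derXn.
  have -> : n%:R = i%:R + (n - i)%:R :> O by rewrite -natrD subnKC.
  have uE : i%:R * u ^+ i.-1 * u = i%:R * u ^+ i.
    by case: i {le_in} => [|i]; rewrite ?mul0r // exprS /=; ring.
  have vE : (n - i)%:R * v ^+ (n - i).-1 * v = (n - i)%:R * v ^+ (n - i).
    by case: (n - i)%N => [|m]; rewrite ?mul0r // exprS /=; ring.
  rewrite [RHS](_ : _ = (i%:R * u ^+ i.-1) * v ^+ (n - i) * der X u * v -
    (i%:R * u ^+ i.-1 * u) * v ^+ (n - i) * der X v + i%:R * u ^+ i * der X v * v ^+ (n - i)
    + ((n - i)%:R * v ^+ (n - i)) * u ^+ i * der X v); last by ring.
  by rewrite uE -vE; ring.
have fS' : dvd f S'.
  have [g gE] := choice (fun i : 'I_n.+1 => monoE i (ltn_ord i)).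
  have E : v * der X (\sum_i c i * (u ^+ i * v ^+ (n - i))) = v * (X.1 * S') +
     (\sum_i c i * g i) * (der X u * v - u * der X v) +
     n%:R * der X v * \sum_i c i * (u ^+ i * v ^+ (n - i)).
    rewrite raddf_sum /S' !mulr_sumr mulr_suml -!big_split /=; apply: eq_bigr => i _.
    rewrite derM (der_xonly X (cx i)) mulrDr [v * (c i * _)]mulrCA gE; ring.
  have : dvd f (v * (X.1 * S')).
    have -> : v * (X.1 * S') = v * der X (\sum_i c i * (u ^+ i * v ^+ (n - i))) -
     (\sum_i c i * g i) * (der X u * v - u * der X v) -
     n%:R * der X v * \sum_i c i * (u ^+ i * v ^+ (n - i)) by rewrite E; ring.
    apply: dvdB; last exact: dvdMl.
    by apply: dvdB; [apply: dvdMl; exact: dvd_der|exact: dvdMl].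
  by move=> /(irred_prime fi)[//|/(irred_prime fi)[]].
(* The top terms of the relation and of its derivative cancel in this combination, so [lower]
   applies. *)
have cdc i : c ord_max * dX (c i) - dX (c ord_max) * c i = 0.
  move: i; apply: lower => [i||].
  - apply: ydeg_ltB; first by apply: ydeg_ltMx; [exact: cx|exact: xonly_dX].
    by apply: ydeg_ltMx; [exact: xonly_dX|exact: cx].
  - by rewrite mulrC subrr.
  - have -> : \sum_i (c ord_max * dX (c i) - dX (c ord_max) * c i) * (u ^+ i * v ^+ (n - i)) =
      c ord_max * S' - dX (c ord_max) * \sum_i c i * (u ^+ i * v ^+ (n - i)).
      by rewrite !mulr_sumr -sumrB; apply: eq_bigr => i _; ring.
    by apply: dvdB; exact: dvdMl.
have /choice[k kE] : forall i, exists k, c i = cst k * c ord_max.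
  move=> i; apply: wronskian_proportional => //; last by rewrite !xonly_dY // mulr0 mul0r.
  by apply/eqP; rewrite -subr_eq0 -(cdc i); apply/eqP; ring.
pose p := \poly_(i < n.+1) k (inord i).
have pE (i : 'I_n.+1) : p`_i = k i by rewrite coef_poly ltn_ord inord_val.
have kn : k ord_max = 1.
  apply: contrapT => kn; apply: cn0; have /eqP := kE ord_max.
  rewrite -subr_eq0 -{1}[c _]mul1r -mulrBl => /eqP /cmul_eq0[|//] e.
  exfalso; apply: kn; have := congr1 (fun f : O => f 0 0)%N e.
  by rewrite c0E cBE c1E cst00 => /eqP; rewrite subr_eq0 => /eqP.
have fh : dvd f (homog u v p n).
  have : dvd f (c ord_max * homog u v p n).
    move: fS; congr (dvd f _); rewrite /homog mulr_sumr; apply: eq_bigr => i _.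
    by rewrite kE pE; ring.
  move=> /(irred_prime fi)[/(yreg_xonly_dvd f00 fd (cx _))|//].
  by move=> cmax0; exfalso.
have sp : size p = n.+1.
  by rewrite size_poly_eq // -[n in inord n]/(val (@ord_max n)) inord_val kn oner_eq0.
have lp : lead_coef p = 1 by rewrite lead_coefE sp /= -[n]/(val (@ord_max n)) pE.
have [rs prs] := closed_field_poly_normal p.
have rsn : size rs = n.
  by apply: succn_inj; rewrite -sp prs lp scale1r size_prod_XsubC.
move: fh; rewrite prs lp scale1r -rsn homog_roots.
elim: {prs rsn} rs => [|z rs IH].
  by rewrite big_nil => /dvd00 /(_ f00); rewrite c1E => /eqP; rewrite oner_eq0.
by rewrite big_cons => /(irred_prime fi)[|//]; exists z.
Qed.

(** On {f = 0}, where X is not identically zero, u/v is a first integral of X; a curve has dimension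
    one, so u/v is constant or infinite. *)
Lemma rank_one f X u v : irred f -> dvd f (der X f) -> ~ (dvd f X.1 /\ dvd f X.2) ->
  dvd f (der X u * v - u * der X v) -> dvd f v \/ exists k, dvd f (u - cst k * v).
Proof.
move=> fi Xf nX W; have [d [fd|fd]] := yreg_or_swap fi.
  apply: (rank_one_yreg fi fd Xf _ W) => X1; apply: nX; split=> //.
  exact: yreg_dvd_field fi fd Xf X1.
have fsw := irred_swap fi; have sw a : dvd f a -> dvd (swap f) (swap a).
  by move=> fa; apply: dvd_swap; rewrite !swapK.
have Xsw : dvd (swap f) (der (swap_field X) (swap f)) by rewrite der_swap; exact: sw.
have [||fv|[k fk]] := rank_one_yreg (u := swap u) (v := swap v) fsw fd Xsw.
- move=> X2; have X1 := yreg_dvd_field fsw fd Xsw X2.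
  by apply: nX; split; exact: dvd_swap.
- by rewrite !der_swap -!rmorphM -rmorphB; exact: sw.
- by left; exact: dvd_swap.
- by right; exists k; apply: dvd_swap; rewrite rmorphB rmorphM /= swap_cst.
Qed.
End RankOne.

Lemma linear_dependence (K : fieldType) m n (v : 'I_m -> 'rV[K]_n) : (n < m)%N ->
  exists c : 'I_m -> K, (exists i, c i <> 0) /\ \sum_i c i *: v i = 0.
Proof.
move=> nm; pose A := \matrix_i v i.
have : kermx A != 0.
  rewrite -mxrank_eq0 mxrank_ker subn_eq0 -ltnNge; apply: leq_ltn_trans nm.
  exact: rank_leq_col.
move=> /rowV0Pn[w /sub_kermxP wA w0]; exists (fun i => w 0 i); split.
  apply: contrapT => nex; move/eqP: w0; apply; apply/rowP => i; rewrite mxE.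
  by apply: contrapT => wi; apply: nex; exists i.
by rewrite -[RHS]wA mulmx_sum_row; apply: eq_bigr => i _; rewrite rowK.
Qed.

(** * Fields commuting with X *)

Section CommutingFields.
Variable K : numFieldType.
Notation O := (cps K).
Implicit Types (f g h u v w : O) (X Y Z : O * O).

Definition commute X Y := der X Y.1 = der Y X.1 /\ der X Y.2 = der Y X.2.
Definition wedge X Y : O := X.1 * Y.2 - X.2 * Y.1.
Definition divg X : O := dX X.1 + dY X.2.
Definition brk X Y : O * O := (der X Y.1 - der Y X.1, der X Y.2 - der Y X.2).

Lemma der_brk X Y g : der (brk X Y) g = der X (der Y g) - der Y (der X g).
Proof.
rewrite /brk /der /= !raddfD /= !dXM !dYM !(dX_dY g).
move: (dX X.1) (dX X.2) (dX Y.1) (dX Y.2) (dY X.1) (dY X.2) (dY Y.1) (dY Y.2).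
move: (dX (dX g)) (dY (dY g)) (dY (dX g)) (dX g) (dY g) => *; ring.
Qed.

Lemma commuteP X Y : commute X Y <-> brk X Y = (0, 0).
Proof.
split=> [[e1 e2]|[/eqP e1 /eqP e2]]; first by rewrite /brk e1 e2 !subrr.
by split; apply/eqP; rewrite -subr_eq0.
Qed.

Lemma der_comm X Y g : commute X Y -> der X (der Y g) = der Y (der X g).
Proof.
move=> /commuteP e; apply/eqP; rewrite -subr_eq0 -der_brk e /der /=.
by rewrite !mul0r addr0.
Qed.

Lemma commute_brk X Y Y' : commute X Y -> commute X Y' -> commute X (brk Y Y').
Proof.
move=> XY XY'; split; rewrite der_brk /brk raddfB /=;
  
  rewrite (der_comm _ XY) (der_comm _ XY'); move: XY XY' => [e1 e2] [e1' e2'];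
  by rewrite ?e1 ?e2 ?e1' ?e2'.
Qed.

Lemma commute_comb X Y Z (k : K) : commute X Y -> commute X Z ->
  commute X (Y.1 - cst k * Z.1, Y.2 - cst k * Z.2).
Proof.
move=> [Y1 Y2] [Z1 Z2]; split; rewrite /= raddfB /= der_cstM ?Y1 ?Y2 ?Z1 ?Z2 /der /=; ring.
Qed.

(** The Lie derivative along Z of X ^ Y, a determinant and not a bivector: hence the divergence
    term. The summand [Z, X] ^ Y vanishes. *)
Lemma der_wedge X Y Z : commute Z X ->
  der Z (wedge X Y) = wedge X (brk Z Y) + divg Z * wedge X Y.
Proof.
move=> [e1 e2]; have E1 : der Z X.1 - der X Z.1 = 0 by rewrite e1 subrr.
have E2 : der Z X.2 - der X Z.2 = 0 by rewrite e2 subrr.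
have -> : der Z (wedge X Y) = (der Z X.1 - der X Z.1) * Y.2 - (der Z X.2 - der X Z.2) * Y.1
   + wedge X (brk Z Y) + divg Z * wedge X Y.
  rewrite /wedge /brk raddfB /= !derM /der /divg /=; ring.
by rewrite E1 E2; ring.
Qed.

Lemma der_wedgeX X Y : commute X Y -> der X (wedge X Y) = divg X * wedge X Y.
Proof.
move=> XY; rewrite der_wedge //; have /commuteP -> := XY.
by rewrite /wedge /=; ring.
Qed.

Lemma der_wedgeY X Y : commute X Y -> der Y (wedge X Y) = divg Y * wedge X Y.
Proof.
move=> [e1 e2]; rewrite der_wedge; last by split.
by rewrite /wedge /brk /= !subrr; ring.
Qed.
End CommutingFields.

(** * From two independent wedges to two invariant coordinate curves *)

Section Core.
Variable K : numClosedFieldType.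
Notation O := (cps K).
Implicit Types (f g h u v w : O) (Y Z : O * O).

Lemma irred_not_dvd_xy f : f 0%N 0%N = 0 -> dvd f (vx K) -> dvd f (vy K) -> False.
Proof.
move=> f0 [q xE] [q' yE].
have c10 g : (g * f : O) 1%N 0%N = g 0%N 0%N * f 1%N 0%N.
  by rewrite cME big_ord_recl /= big_ord1 /= !big_ord1 /bump /= !subnn f0 mulr0 addr0.
have c01 g : (g * f : O) 0%N 1%N = g 0%N 0%N * f 0%N 1%N.
  by rewrite cME big_ord1 big_ord_recl /= big_ord1 /bump /= !subnn f0 mulr0 addr0.
have x10 : vx K 1%N 0%N = 1 by rewrite cmonoE.
have y10 : vy K 1%N 0%N = 0 by rewrite cmonoE.
have y01 : vy K 0%N 1%N = 1 by rewrite cmonoE.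
move: x10 y10 y01; rewrite {1}xE {1}yE c10 => x10.
rewrite c10 {1}yE c01 => /eqP; rewrite mulf_eq0 => /orP[/eqP q'0|/eqP f10].
  by move=> /eqP; rewrite q'0 mul0r eq_sym oner_eq0.
by move: x10 => /eqP; rewrite f10 mulr0 eq_sym oner_eq0.
Qed.

Lemma irred_not_common f a b : irred f -> coprime_germs a b -> dvd f a -> dvd f b -> False.
Proof.
move=> fi [[M [u [v e]]] [M' [u' [v' e']]]] fa fb; have [_ f00 _] := fi.
apply: (irred_not_dvd_xy f00); [apply: (irred_primeX (n := M) fi)|apply: (irred_primeX (n := M') fi)].
  by rewrite e; apply: dvdD; exact: dvdMl.
by rewrite e'; apply: dvdD; exact: dvdMl.
Qed.

Lemma coprime_neq0 (a b : O) : coprime_germs a b -> b 0%N 0%N = 0 -> a <> 0.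
Proof.
move=> ab b00 a0; have [b0|b0] := pselect (b = 0).
  have [[M [u [v e]]] _] := ab; apply: (cexp_neq0 (n := M) (@vx_neq0 K)).
  by rewrite e a0 b0; ring.
have [f [fi fb]] := irred_factor b0 b00.
by apply: (irred_not_common fi ab) => //; rewrite a0; exact: dvd0.
Qed.

Lemma irred_natr n : (0 < n)%N -> (n%:R : O) 0%N 0%N <> 0.
Proof.
move=> n0; rewrite -(rmorph_nat (@cst K)) cst00; apply/eqP.
by rewrite pnatr_eq0 -lt0n.
Qed.

(** Derivatives lower the order of a nonzero non-unit, while multiples of f do not have smaller
    order than f. *)
Lemma dvd_dXY f : f 0%N 0%N = 0 -> dvd f (dX f) -> dvd f (dY f) -> f = 0.
Proof.
move=> f00 [q fx] [q' fy]; apply: ordge0; elim=> [|n IH]; first exact: ordge_0.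
move=> [|i] [|j] // ij.
- have : dY f 0%N j = 0 by rewrite fy; apply: (ordgeMl q' IH); lia.
  by rewrite dYE => /eqP; rewrite mulf_eq0 pnatr_eq0 => /eqP.
- have : dX f i 0%N = 0 by rewrite fx; apply: (ordgeMl q IH); lia.
  by rewrite dXE => /eqP; rewrite mulf_eq0 pnatr_eq0 => /eqP.
- have : dX f i j.+1 = 0 by rewrite fx; apply: (ordgeMl q IH); lia.
  by rewrite dXE => /eqP; rewrite mulf_eq0 pnatr_eq0 => /eqP.
Qed.

(** Modulo f, after removal of f^(e-1), only e Z(f) w remains, and e is invertible in characteristic
    0. *)
Lemma invariant_factor f e w Z : irred f -> (0 < e)%N -> ~ dvd f w ->
  dvd (f ^+ e * w) (der Z (f ^+ e * w)) -> dvd f (der Z f).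
Proof.
move=> fi; case: e => // e _ nfw [q E]; have [f0 _ _] := fi.
have : dvd f (e.+1%:R * (der Z f * w)).
  apply: (dvd_addl (c := f * der Z w)); first by apply: dvdMr; exact: dvdd.
  exists (q * w); apply: (cmulI (cexp_neq0 (n := e) f0)).
  have -> : f ^+ e * (q * w * f) = q * (f ^+ e.+1 * w) by rewrite exprS; ring.
  by rewrite -E derM derXn exprS /=; ring.
move=> /(dvd_unit (@irred_natr e.+1 isT)) /(irred_prime fi)[//|//].
Qed.

(* X and Y are both tangent to {f = 0}, so their restrictions to this curve
   are collinear, and the ratio is a first integral of X there. *)
Lemma tangent_fields X Y f : coprime_germs X.1 X.2 -> commute X Y -> irred f ->
  dvd f (der X f) -> dvd f (der Y f) ->
  exists k (T : O * O), Y.1 = cst k * X.1 + f * T.1 /\ Y.2 = cst k * X.2 + f * T.2.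
Proof.
move=> Xc [XY1 XY2] fi fX fY; have [f0 f00 _] := fi.
have nX : ~ (dvd f X.1 /\ dvd f X.2) by move=> [? ?]; exact: (irred_not_common fi Xc).
have fW : dvd f (wedge X Y).
  have Wx : dvd f (wedge X Y * dX f).
    have -> : wedge X Y * dX f = der X f * Y.2 - der Y f * X.2 by rewrite /wedge /der; ring.
    by apply: dvdB; exact: dvdMr.
  have Wy : dvd f (wedge X Y * dY f).
    have -> : wedge X Y * dY f = der Y f * X.1 - der X f * Y.1 by rewrite /wedge /der; ring.
    by apply: dvdB; exact: dvdMr.
  have [//|fx] := irred_prime fi Wx; have [//|fy] := irred_prime fi Wy.
  by exfalso; apply: f0; exact: dvd_dXY.
have [X1|X1] := pselect (dvd f X.1).
  have X2 : ~ dvd f X.2 by move=> X2; apply: nX.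
  have [|//|[k kP]] := @rank_one _ f X Y.2 X.2 fi fX nX.
    have -> : der X Y.2 * X.2 - Y.2 * der X X.2 = - (dX X.2 * wedge X Y).
      by rewrite XY2 /der /wedge; ring.
    by apply: dvdN; exact: dvdMl.
  have [T2 E2] := kP.
  have : dvd f (X.2 * (Y.1 - cst k * X.1)).
    have -> : X.2 * (Y.1 - cst k * X.1) = X.1 * (Y.2 - cst k * X.2) - wedge X Y by rewrite /wedge; ring.
    by apply: dvdB => //; exact: dvdMl.
  move=> /(irred_prime fi)[//|[T1 E1]]; exists k, (T1, T2) => /=.
  by split; apply/eqP; rewrite addrC -subr_eq (E1, E2) mulrC.
have [|//|[k kP]] := @rank_one _ f X Y.1 X.1 fi fX nX.
  have -> : der X Y.1 * X.1 - Y.1 * der X X.1 = dY X.1 * wedge X Y.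
    by rewrite XY1 /der /wedge; ring.
  exact: dvdMl.
have [T1 E1] := kP.
have : dvd f (X.1 * (Y.2 - cst k * X.2)).
  have -> : X.1 * (Y.2 - cst k * X.2) = X.2 * (Y.1 - cst k * X.1) + wedge X Y by rewrite /wedge; ring.
  by apply: dvdD => //; exact: dvdMl.
move=> /(irred_prime fi)[//|[T2 E2]]; exists k, (T1, T2) => /=.
by split; apply/eqP; rewrite addrC -subr_eq (E1, E2) mulrC.
Qed.

Variable X : O * O.
Hypotheses (X_coprime : coprime_germs X.1 X.2)
  (X1_0 : X.1 0%N 0%N = 0) (X2_0 : X.2 0%N 0%N = 0).

Variable F : nat -> O.
Hypotheses (F_irred : forall j, irred (F j)) (F_inv : forall j, dvd (F j) (der X (F j)))
  (F_distinct : forall i j, i <> j -> ~ dvd (F i) (F j)).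

Let F_field j : ~ (dvd (F j) X.1 /\ dvd (F j) X.2).
Proof. by move=> [? ?]; exact: (irred_not_common (F_irred j) X_coprime). Qed.

Let F_not1 j : ~ dvd (F j) 1.
Proof.
by case: (F_irred j) => _ f00 _ /dvd00 /(_ f00); rewrite c1E => /eqP; rewrite oner_eq0.
Qed.

Lemma curve_integral j g : dvd (F j) (der X g) -> dvd (F j) (g - cst (g 0%N 0%N)).
Proof.
move=> gX; have [|/F_not1//|[k kP]] := @rank_one _ (F j) X g 1 (F_irred j) (F_inv j) (@F_field j).
  by rewrite der1 mulr0 subr0 mulr1.
rewrite mulr1 in kP; have [_ f00 _] := F_irred j.
by have /eqP := dvd00 kP f00; rewrite cBE cst00 subr_eq0 => /eqP ->.
Qed.

Lemma first_integral_cst g : der X g = 0 -> g = cst (g 0%N 0%N).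
Proof.
move=> gX; apply/eqP; rewrite -subr_eq0; apply/eqP; apply: contrapT => nz.
have [J JP] := finitely_many_factors F_irred F_distinct nz.
by apply: (JP J (leqnn _)); apply: curve_integral; rewrite gX; exact: dvd0.
Qed.

Let X1_neq0 : X.1 <> 0. Proof. exact: coprime_neq0 X_coprime X2_0. Qed.
Let X2_neq0 : X.2 <> 0. Proof. exact: coprime_neq0 (coprime_germs_sym X_coprime) X1_0. Qed.

(** Coprimality of the components of X makes Y = g X with g holomorphic, and commutation makes g a
    first integral. *)
Lemma wedge0_proportional Y : commute X Y -> wedge X Y = 0 ->
  exists k, Y = (cst k * X.1, cst k * X.2).
Proof.
move=> [XY1 _] /eqP; rewrite subr_eq0 => /eqP W.
have [|g Y1E] := @euclid _ X.1 X.2 Y.1 X1_neq0 X_coprime.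
  by exists Y.2; rewrite -W mulrC.
have Y2E : Y.2 = g * X.2 by apply: (cmulI X1_neq0); rewrite W Y1E; ring.
have gX : der X g = 0.
  have e : der X (g * X.1) = g * der X X.1.
    by rewrite -Y1E XY1 {1}/der Y1E Y2E /der; ring.
  apply: (cmulI X1_neq0); rewrite mulr0; apply/eqP; rewrite -(subrr (der X (g * X.1))).
  by rewrite {2}e derM; apply/eqP; ring.
exists (g 0%N 0%N); rewrite -(first_integral_cst gX) -Y1E -Y2E.
by case: Y {XY1 W Y1E Y2E}.
Qed.

Definition inV h := exists Y, commute X Y /\ h = wedge X Y.

Lemma inV_der h : inV h -> der X h = divg X * h.
Proof. by move=> [Y [XY ->]]; exact: der_wedgeX. Qed.

Lemma inV_comb h h' (k : K) : inV h -> inV h' -> inV (h - cst k * h').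
Proof.
move=> [Y [XY ->]] [Y' [XY' ->]]; exists (Y.1 - cst k * Y'.1, Y.2 - cst k * Y'.2).
by split; [exact: commute_comb|rewrite /wedge /=; ring].
Qed.

Lemma inV_D Y h : commute X Y -> inV h -> inV (der Y h - divg Y * h).
Proof.
move=> XY [Y' [XY' ->]]; exists (brk Y Y'); split; first exact: commute_brk.
rewrite der_wedge; first by rewrite addrK.
by case: XY.
Qed.

Definition independent h1 h2 := forall a b : K, cst a * h1 + cst b * h2 = 0 -> a = 0 /\ b = 0.

Lemma independent_sym h1 h2 : independent h1 h2 -> independent h2 h1.
Proof. by move=> ind a b; rewrite addrC => /ind[]. Qed.
Lemma independentN h1 h2 k : independent h1 h2 -> h1 = cst k * h2 -> False.
Proof.
move=> ind e; have [|] := ind 1 (- k); first by rewrite e rmorph1 rmorphN; ring.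
by move=> /eqP; rewrite oner_eq0.
Qed.
Lemma independent_neq0 h1 h2 : independent h1 h2 -> h1 <> 0.
Proof. by move=> /independentN ind e; apply: (ind 0); rewrite rmorph0 mul0r. Qed.

(** The ratio h1/h2 is a meromorphic first integral. In lowest terms u1/u2 it must be indeterminate
    at 0: were u1 or u2 a unit, it or its inverse would be a holomorphic first integral, hence
    constant. *)
Lemma pencil h1 h2 : der X h1 = divg X * h1 -> der X h2 = divg X * h2 -> independent h1 h2 ->
  exists g u1 u2 l, [/\ h1 = g * u1, h2 = g * u2, coprime_germs u1 u2,
    u1 0%N 0%N = 0 /\ u2 0%N 0%N = 0 & der X u1 = l * u1 /\ der X u2 = l * u2].
Proof.
move=> X1 X2 ind; have h10 := independent_neq0 ind.
have [g [u1 [u2 [h1E h2E c12]]]] := gcd_ex h2 h10.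
have g0 : g <> 0 by move=> g0; apply: h10; rewrite h1E g0 mul0r.
have u10 : u1 <> 0 by move=> u10; apply: h10; rewrite h1E u10 mulr0.
have W : u2 * der X u1 = u1 * der X u2.
  apply: (cmulI (cmul_neq0 g0 g0)); apply/eqP; rewrite -subr_eq0; apply/eqP.
  have -> : g * g * (u2 * der X u1) - g * g * (u1 * der X u2) =
    der X (g * u1) * (g * u2) - (g * u1) * der X (g * u2) by rewrite !derM; ring.
  by rewrite -h1E -h2E X1 X2; ring.
have [|l lE] := @euclid _ u1 u2 (der X u1) u10 c12; first by exists (der X u2); rewrite W mulrC.
have l2 : der X u2 = l * u2 by apply: (cmulI u10); rewrite -W lE; ring.
have nonunit v1 v2 : der X v1 = l * v1 -> der X v2 = l * v2 -> v2 0%N 0%N <> 0 ->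
    exists k, v1 = cst k * v2.
  move=> e1 e2 v2u; have [v2' v2'E] := unit_inv v2u; exists ((v1 * v2') 0%N 0%N).
  have vE : v1 = v1 * v2' * v2 by rewrite -mulrA v2'E mulr1.
  rewrite -first_integral_cst //; apply: (cmulI (_ : v2 <> 0)).
    by move=> v20; apply: v2u; rewrite v20 c0E.
  have e : der X v1 = der X (v1 * v2') * v2 + v1 * v2' * der X v2 by rewrite {1}vE derM.
  have -> : v2 * der X (v1 * v2') = der X v1 - v1 * v2' * der X v2 by rewrite e; ring.
  by rewrite e1 e2 [in l * v1]vE; ring.
exists g, u1, u2, l; split=> //; split; apply: contrapT => nz.
  have [k kE] := nonunit _ _ l2 lE nz; apply: (independentN (independent_sym ind) (k := k)).
  by rewrite h2E kE h1E; ring.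
have [k kE] := nonunit _ _ lE l2 nz; apply: (independentN ind (k := k)).
by rewrite h1E kE h2E; ring.
Qed.

(** A monomial of degree at least p + q is divisible by x^p or by y^q; division by x^p, done after
    [swap], separates the two kinds. *)
Lemma ordge_split p q h : ordge (p + q) h -> exists a b, h = vx K ^+ p * a + vy K ^+ q * b.
Proof.
move=> hpq; have [c [r [hE rp]]] := weierstrass_division (swap h) (@yreg_vyX K p).
have hE' : h = vx K ^+ p * swap c + swap r.
  by rewrite -(swapK h) hE rmorphD rmorphM rmorphXn /= swap_vy mulrC.
have [|b bE] := @vyX_factor _ q (swap r); last by exists (swap c), b; rewrite -bE.
move=> i j jq; have [pi|ip] := leqP p i; first by rewrite swapE rp.
have : h i j = 0 by apply: hpq; lia.
by rewrite hE' cDE vxXM leqNgt ip add0r.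
Qed.

(* Modulo all but finitely many of the
   separatrices, h2 divides a multiple of u2 ^ 2, where the ideal (u2, F j)
   contains (u1, u2); hence h in m^N is a multiple theta * h2 modulo F j, where
   theta is a first integral vanishing at the origin. *)
Lemma V_jet_bound h1 h2 : inV h1 -> inV h2 -> independent h1 h2 ->
  exists N, forall h, inV h -> ordge N h -> h = 0.
Proof.
move=> V1 V2 ind; have [Y [XY h2Y]] := V2.
have [g [u1 [u2 [l [h1E h2E c12 [u10 u20] [l1 l2]]]]]] := pencil (inV_der V1) (inV_der V2) ind.
have h20 := independent_neq0 (independent_sym ind).
have u2n0 : u2 <> 0 by move=> e; apply: h20; rewrite h2E e mulr0.
pose A := u2 * dX u1 - u1 * dX u2; pose B := u2 * dY u1 - u1 * dY u2.
have AB : A * X.1 + B * X.2 = 0.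
  have -> : A * X.1 + B * X.2 = u2 * der X u1 - u1 * der X u2 by rewrite /A /B /der; ring.
  by rewrite l1 l2; ring.
(* The form u2 du1 - u1 du2 annihilates X, hence equals k (X.2 dx - X.1 dy). *)
have [|k kA] := @euclid _ X.2 X.1 A X2_neq0 (coprime_germs_sym X_coprime).
  by exists (- B); apply/eqP; rewrite -subr_eq0 -AB; apply/eqP; ring.
have kB : B = - k * X.1.
  apply: (cmulI X2_neq0); have -> : X.2 * B = (A * X.1 + B * X.2) - A * X.1 by ring.
  by rewrite AB kA; ring.
(* The same form evaluated on Y is - k h2. Both w and u2 ^ 2 have the eigenvalue 2 l, so their ratio
   is constant along a separatrix; this puts u2 ^ 2 in (h2, F j). *)
pose w := u2 * der Y u1 - u1 * der Y u2.
have wE : w = - k * h2.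
  have -> : w = A * Y.1 + B * Y.2 by rewrite /w /A /B /der; ring.
  by rewrite kA kB h2Y /wedge; ring.
have w0 : w <> 0.
  rewrite wE mulNr => /eqP; rewrite oppr_eq0 => /eqP /cmul_eq0[k0|//].
  have A0 : A = 0 by rewrite kA k0 mul0r.
  have B0 : B = 0 by rewrite kB k0 oppr0 mul0r.
  have [||c cE] := @wronskian_proportional _ u1 u2 u2n0.
  - by apply/eqP; rewrite -subr_eq0 -A0 /A; apply/eqP; ring.
  - by apply/eqP; rewrite -subr_eq0 -B0 /B; apply/eqP; ring.
  by apply: (independentN ind (k := c)); rewrite h1E h2E cE; ring.
have Xw : der X w = 2%:R * l * w.
  rewrite /w raddfB /= !derM !(der_comm _ XY) l1 l2 !derM; ring.
have [[M [a [b xM]]] [M' [a' [b' yM]]]] := c12.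
(* Modulo F j, u1 is a constant times u2, so x^M and y^M' are multiples of u2, and their squares are
   multiples of u2 ^ 2, hence of h2. The extra factors x and y make theta vanish at 0. *)
exists ((M + M).+1 + (M' + M').+1)%N => h Vh /ordge_split[p [q hE]].
apply: contrapT => h0.
have [J1 J1P] := finitely_many_factors F_irred F_distinct h0.
have [J2 J2P] := finitely_many_factors F_irred F_distinct w0.
have [J3 J3P] := finitely_many_factors F_irred F_distinct u2n0.
pose j := maxn J1 (maxn J2 J3).
have nh : ~ dvd (F j) h by apply: J1P; rewrite /j; lia.
have nw : ~ dvd (F j) w by apply: J2P; rewrite /j; lia.
have nu : ~ dvd (F j) u2 by apply: J3P; rewrite /j; lia.
have nh2 : ~ dvd (F j) h2 by move=> fh2; apply: nw; rewrite wE; exact: dvdMl.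
have [|//|[c [t tE]]] := @rank_one _ (F j) X u1 u2 (F_irred j) (F_inv j) (@F_field j).
  by rewrite l1 l2 (_ : _ - _ = 0); [exact: dvd0|ring].
have [|/(irred_primeX (F_irred j))//|[c' [t' t'E]]] :=
    @rank_one _ (F j) X w (u2 ^+ 2) (F_irred j) (F_inv j) (@F_field j).
  by rewrite Xw derXn l2 (_ : _ - _ = 0); [exact: dvd0|ring].
have c'0 : c' <> 0.
  by move=> e; apply: nw; exists t'; rewrite -t'E e rmorph0 mul0r subr0.
have u2sq : exists s s', u2 ^+ 2 = s * h2 + s' * F j.
  exists (- (cst c'^-1 * k)), (- (cst c'^-1 * t')).
  have : cst c'^-1 * cst c' = 1 :> O by rewrite -rmorphM mulVf ?rmorph1 //; exact/eqP.
  move=> e; rewrite -[LHS]mul1r -e -[cst c'^-1 * _ * _]mulrA.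
  have -> : cst c' * u2 ^+ 2 = w - t' * F j by rewrite -t'E; ring.
  by rewrite wE; ring.
have u1E : u1 = cst c * u2 + t * F j by rewrite -tE; ring.
have [s [s' sE]] := u2sq.
have pow z m r r' : z ^+ m = r * u1 + r' * u2 -> exists e e', z ^+ (m + m) = e * h2 + e' * F j.
  move=> zE; exists ((r * cst c + r') ^+ 2 * s).
  exists ((r * cst c + r') ^+ 2 * s' + r ^+ 2 * t ^+ 2 * F j + 2 * (r * cst c + r') * u2 * r * t).
  rewrite exprD zE u1E.
  have -> : (r * cst c + r') ^+ 2 * s * h2 + ((r * cst c + r') ^+ 2 * s' +
      r ^+ 2 * t ^+ 2 * F j + 2 * (r * cst c + r') * u2 * r * t) * F j =
      (r * cst c + r') ^+ 2 * (s * h2 + s' * F j) +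
      (r ^+ 2 * t ^+ 2 * F j + 2 * (r * cst c + r') * u2 * r * t) * F j by ring.
  by rewrite -sE; ring.
have [ex [ex' exE]] := pow _ _ _ _ xM; have [ey [ey' eyE]] := pow _ _ _ _ yM.
pose theta := vx K * ex * p + vy K * ey * q.
pose beta := vx K * ex' * p + vy K * ey' * q.
have hE' : h = theta * h2 + beta * F j by rewrite hE !exprS exE eyE /theta /beta; ring.
have theta0 : theta 0%N 0%N = 0.
  by rewrite /theta cDE -!mulrA vxM vyM addr0.
clearbody theta beta; apply: nh; rewrite hE'; apply: dvdD; last by apply: dvdMl; exact: dvdd.
apply: dvdMr; have : dvd (F j) (theta - cst (theta 0%N 0%N)).
  apply: curve_integral; suff : dvd (F j) (der X theta * h2) by move=> /(irred_prime (F_irred j))[].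
  have -> : der X theta * h2 = der X h - theta * der X h2 - der X (beta * F j).
    by rewrite hE' raddfD /= (derM _ theta); move: (der X (beta * F j)) => z; ring.
  rewrite (inV_der Vh) (inV_der V2).
  have -> : divg X * h - theta * (divg X * h2) - der X (beta * F j) =
      divg X * beta * F j - der X (beta * F j) by rewrite hE'; ring.
  apply: dvdB; first by apply: dvdMl; exact: dvdd.
  by rewrite derM; apply: dvdD; [apply: dvdMl; exact: dvdd|apply: dvdMl; exact: F_inv].
by rewrite theta0 rmorph0 subr0.
Qed.

Section PolynomialAction.
Variable D : O -> O.
Hypothesis D_linear : forall f g (k : K), D (f - cst k * g) = D f - cst k * D g.

Definition pol_act (p : {poly K}) n h : O := \sum_(i < n) cst p`_i * iter i D h.

Lemma iter_linear n f g (k : K) : iter n D (f - cst k * g) = iter n D f - cst k * iter n D g.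
Proof. by elim: n => //= n ->. Qed.

Lemma pol_actM (z : K) (p : {poly K}) n h : (size p <= n)%N ->
  pol_act (('X - z%:P) * p) n.+1 h = pol_act p n (D h - cst z * h).
Proof.
move=> pn; rewrite /pol_act.
transitivity (\sum_(i < n.+1) cst ('X * p)`_i * iter i D h -
              \sum_(i < n.+1) cst (z * p`_i) * iter i D h).
  by rewrite -sumrB; apply: eq_bigr => i _; rewrite mulrBl coefB mul_polyC coefZ rmorphB mulrBl.
rewrite big_ord_recl coefXM /= rmorph0 mul0r add0r.
rewrite [X in _ - X]big_ord_recr /= nth_default // mulr0 rmorph0 mul0r addr0 -sumrB.
by apply: eq_bigr => i _; rewrite coefXM iter_linear -iterSr rmorphM /bump /=; ring.
Qed.
End PolynomialAction.

(** By [V_jet_bound] the N-jets separate the wedges, so some polynomial in D = Y1 - div(Y1)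
    annihilates h2. The difficulty is to get c <> 0 even when D is nilpotent. *)
Lemma eigen_field h1 h2 : inV h1 -> inV h2 -> independent h1 h2 ->
  exists Y h (c : K), [/\ commute X Y /\ wedge X Y <> 0, inV h, h <> 0, c <> 0 &
    der Y h = (divg Y + cst c) * h].
Proof.
move=> V1 V2 ind; have [N NP] := V_jet_bound V1 V2 ind.
have h10 := independent_neq0 ind; have [Y1 [XY1 h1Y]] := V1.
pose D h := der Y1 h - divg Y1 * h.
have D_lin f g (k : K) : D (f - cst k * g) = D f - cst k * D g.
  by rewrite /D raddfB /= der_cstM; ring.
have DV h : inV h -> inV (D h) by exact: inV_D.
have Dh1 : D h1 = 0 by rewrite /D h1Y der_wedgeY // subrr.
(* X and Y1 both kill the ratio h/h1 and are independent where h1 = X ^ Y1 is nonzero, so this ratio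
   is constant. *)
have ker h : inV h -> D h = 0 -> exists k, h = cst k * h1.
  move=> Vh /eqP; rewrite subr_eq0 => /eqP Yh.
  pose A := dX h * h1 - h * dX h1; pose B := dY h * h1 - h * dY h1.
  have XAB : X.1 * A + X.2 * B = 0.
    have -> : X.1 * A + X.2 * B = der X h * h1 - h * der X h1 by rewrite /A /B /der; ring.
    by rewrite (inV_der Vh) (inV_der V1); ring.
  have YAB : Y1.1 * A + Y1.2 * B = 0.
    have -> : Y1.1 * A + Y1.2 * B = der Y1 h * h1 - h * der Y1 h1 by rewrite /A /B /der; ring.
    have /eqP := Dh1; rewrite subr_eq0 => /eqP ->; rewrite Yh; ring.
  apply: wronskian_proportional => //; apply/eqP; rewrite -subr_eq0; apply/eqP; apply: (cmulI h10).
    rewrite -/A mulr0 h1Y /wedge.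
    have -> : (X.1 * Y1.2 - X.2 * Y1.1) * A = Y1.2 * (X.1 * A + X.2 * B) - X.2 * (Y1.1 * A + Y1.2 * B) by ring.
    by rewrite XAB YAB; ring.
  rewrite -/B mulr0 h1Y /wedge.
  have -> : (X.1 * Y1.2 - X.2 * Y1.1) * B = X.1 * (Y1.1 * A + Y1.2 * B) - Y1.1 * (X.1 * A + X.2 * B) by ring.
  by rewrite XAB YAB; ring.
have Vn n : inV (iter n D h2) by elim: n => //= n IH; exact: DV.
pose jet h : 'rV[K]_(N * N) := \row_i (h (i %/ N)%N (i %% N)%N).
have [c [[i0 ci0] cs]] := linear_dependence (fun i : 'I_(N * N).+1 => jet (iter i D h2)) (leqnn _).
pose p := \poly_(i < (N * N).+1) c (inord i).
have pE (i : 'I_(N * N).+1) : p`_i = c i by rewrite coef_poly ltn_ord inord_val.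
have p0 : p != 0 by apply/eqP => e; apply: ci0; rewrite -pE e coef0.
have V0 : inV 0.
  by rewrite -(subrr h1) -[X in inV (_ - X)]mul1r -(rmorph1 (@cst K)); exact: inV_comb.
have VD f g : inV f -> inV g -> inV (f + g).
  by move=> Vf Vg; have := inV_comb (-1) Vf Vg; rewrite rmorphN rmorph1 mulN1r opprK.
have pact0 : pol_act D p (size p) h2 = 0.
  have -> : pol_act D p (size p) h2 = pol_act D p (N * N).+1 h2.
    rewrite /pol_act (big_ord_widen (N * N).+1 (fun i => cst p`_i * iter i D h2)) ?size_poly //.
    rewrite big_mkcond; apply: eq_bigr => i _; case: ltnP => // sp.
    by rewrite nth_default // rmorph0 mul0r.
  apply: NP.
    rewrite /pol_act; elim/big_rec: _ => [//|i z _ Vz]; apply: VD => //.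
    have := inV_comb (- p`_i) V0 (Vn i); by rewrite rmorphN mulNr sub0r opprK.
  move=> i j ij; have iN : (i < N)%N by lia. have jN : (j < N)%N by lia.
  have ijN : (i * N + j < N * N)%N by nia.
  have := congr1 (fun v : 'rV[K]_(N * N) => v 0 (Ordinal ijN)) cs.
  rewrite summxE mxE => e; rewrite -[RHS]e /pol_act c_sumE; apply: eq_bigr => m _.
  rewrite cstM pE !mxE /= divnMDl ?divn_small ?addn0 ?modnMDl ?modn_small //; lia.
(* The linear factors of the polynomial are applied to h2 one after the other; the last vector
   outside C h1 is an eigenvector of D modulo h1. *)
have step : exists h r, [/\ inV h, (forall k : K, h <> cst k * h1) &
    exists k : K, D h = cst r * h + cst k * h1].
  have [rs prs] := closed_field_poly_normal p.
  have : pol_act D (\prod_(z <- rs) ('X - z%:P)) (size rs).+1 h2 = 0.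
    have lp0 : lead_coef p <> 0 by apply/eqP; rewrite lead_coef_eq0.
    apply: (cmulI (_ : cst (lead_coef p) <> 0)).
      by move=> /(congr1 (fun f : O => f 0 0)%N); rewrite cst00 c0E.
    rewrite mulr0 -[RHS]pact0 /pol_act mulr_sumr.
    have -> : size p = (size rs).+1 by rewrite prs size_scale ?size_prod_XsubC //; exact/eqP.
    by apply: eq_bigr => i _; rewrite [in RHS]prs coefZ rmorphM /=; ring.
  have : forall k : K, h2 <> cst k * h1.
    by move=> k; exact: independentN (independent_sym ind).
  clear p pE p0 pact0 prs ind Vn c cs i0 ci0; move: h2 V2; elim: rs => [|z rs IH] h Vh nh.
    rewrite big_nil /pol_act big_ord1 coef1 rmorph1 mul1r => h0.
    by exfalso; apply: (nh 0); rewrite rmorph0 mul0r.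
  rewrite big_cons /= pol_actM ?size_prod_XsubC // => act0.
  have [[k kE]|nk] := pselect (exists k : K, D h - cst z * h = cst k * h1).
    by exists h, z; split=> //; exists k; rewrite -kE; ring.
  apply: IH act0; first by apply: inV_comb => //; exact: DV.
  by move=> k e; apply: nk; exists k.
have [h [r [Vh nh [k kE]]]] := step.
have cE (a : K) : a <> 0 -> cst a * cst a^-1 = 1 :> O.
  by move=> a0; rewrite -rmorphM mulfV ?rmorph1 //; exact/eqP.
(* If r <> 0, adding (k / r) h1 gives a true eigenvector, with Y = Y1 and c = r. If r = 0, then k <>
   0 by [ker]; since [Y2, Y1] = - [Y1, Y2], the relation D h = k h1 becomes an eigenvalue equation
   for h1 under Y2, with c = - k. *)
have [r0|r0] := pselect (r = 0); last first.
  exists Y1, (h + cst (k / r) * h1), r; split=> //.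
  - by split=> //; rewrite -h1Y.
  - by have := inV_comb (- (k / r)) Vh V1; rewrite rmorphN mulNr opprK.
  - move=> /eqP; rewrite addr_eq0 => /eqP e; apply: (nh (- (k / r))).
    by rewrite e rmorphN mulNr.
  - have e1 : der Y1 h = divg Y1 * h + cst r * h + cst k * h1.
      by rewrite -addrA -kE /D; ring.
    have e2 : der Y1 h1 = divg Y1 * h1 by apply/eqP; rewrite -subr_eq0; exact/eqP.
    have e3 : cst r * cst (k / r) = cst k :> O by rewrite -rmorphM mulrC divfK //; exact/eqP.
    rewrite raddfD /= der_cstM e1 e2 -e3; ring.
have [Y2 [XY2 hY2]] := Vh.
exists Y2, h1, (- k); split=> //.
- split=> //; rewrite -hY2 => h0; apply: (nh 0); by rewrite rmorph0 mul0r.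
- move=> /eqP; rewrite oppr_eq0 => /eqP k0; rewrite r0 k0 !rmorph0 !mul0r addr0 in kE.
  by have [k' k'E] := ker h Vh kE; apply: (nh k').
- have e2 : der Y2 h1 = wedge X (brk Y2 Y1) + divg Y2 * h1.
    by rewrite {1}h1Y der_wedge -?h1Y //; case: XY2.
  have e3 : D h = wedge X (brk Y1 Y2).
    by rewrite /D hY2 der_wedge ?addrK //; case: XY1.
  rewrite r0 rmorph0 mul0r add0r in kE.
  have e4 : wedge X (brk Y2 Y1) = - (cst k * h1) by rewrite -kE e3 /wedge /brk /=; ring.
  by rewrite e2 e4 rmorphN; ring.
Qed.

(* Along a branch {f = 0} of {u = 0}, the fields X and Y are proportional, so
   that Y - k X = f T; T is transverse to {f = 0} and tangent to {v = 0}. *)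
Lemma transverse_field Y u v l al c : commute X Y -> coprime_germs u v -> u <> 0 -> v <> 0 ->
  u 0%N 0%N = 0 ->
  der X u = l * u -> der X v = l * v -> der Y u = (al + cst c) * u -> der Y v = al * v ->
  exists f e k (T : O * O), [/\ irred f /\ dvd f u, (0 < e)%N,
    Y.1 = cst k * X.1 + f * T.1 /\ Y.2 = cst k * X.2 + f * T.2,
    e%:R * der T f 0%N 0%N = c &
    forall f', irred f' -> dvd f' v -> dvd f' (der T f')].
Proof.
move=> XY uv u0 v0 u00 Xu Xv Yu Yv; have [f [fi fu]] := irred_factor u0 u00.
have [f0 f00 _] := fi.
have inv_branch f' (w : O) Z m : irred f' -> w <> 0 -> dvd f' w -> der Z w = m * w -> dvd f' (der Z f').
  move=> f'i w0 f'w Zw; have [_ f'00 _] := f'i.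
  have [e [t [wE nt]]] := multiplicity f'00 w0.
  case: e wE => [|e] wE; first by exfalso; apply: nt; move: f'w; rewrite wE expr0 mul1r.
  apply: (@invariant_factor f' e.+1 t Z) => //; rewrite -wE Zw; apply: dvdMl; exact: dvdd.
have nfv : ~ dvd f v by move=> fv; exact: (irred_not_common fi uv).
have [k [T [Y1E Y2E]]] := tangent_fields X_coprime XY fi
  (inv_branch _ _ _ _ fi u0 fu Xu) (inv_branch _ _ _ _ fi u0 fu Yu).
have derT g : f * der T g = der Y g - cst k * der X g.
  by rewrite /der Y1E Y2E; ring.
have [e [w [uE nfw]]] := multiplicity f00 u0.
have e0 : (0 < e)%N.
  by case: e uE => // uE; exfalso; apply: nfw; move: fu; rewrite uE expr0 mul1r.
have fA : dvd f (al - cst k * l).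
  have : dvd f ((al - cst k * l) * v).
    have -> : (al - cst k * l) * v = f * der T v by rewrite derT Yv Xv; ring.
    by apply: dvdMr; exact: dvdd.
  by move=> /(irred_prime fi)[].
exists f, e, k, T; split=> //.
- have E : e%:R * der T f * w + f * der T w = (al - cst k * l + cst c) * w.
    apply: (cmulI (cexp_neq0 (n := e) f0)).
    have -> : f ^+ e * ((al - cst k * l + cst c) * w) = f * der T u.
      by rewrite derT Yu Xu uE; ring.
    rewrite uE derM derXn; case: e {uE} e0 => // e _; rewrite exprS /=; ring.
  have : dvd f ((e%:R * der T f - (al - cst k * l + cst c)) * w).
    have -> : (e%:R * der T f - (al - cst k * l + cst c)) * w = - (f * der T w).
      by rewrite mulrBl -E; ring.
    by apply: dvdN; apply: dvdMr; exact: dvdd.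
  move=> /(irred_prime fi)[/dvd00 /(_ f00)|//].
  rewrite cBE cDE cst00 (dvd00 fA f00) add0r cM00 -(rmorph_nat (@cst K)) cst00.
  by move=> /eqP; rewrite subr_eq0 => /eqP.
- move=> f' f'i f'v; have : dvd f' (f * der T f').
    rewrite derT; apply: dvdB; last apply: dvdMl.
      exact: inv_branch f'i v0 f'v Yv.
    exact: inv_branch f'i v0 f'v Xv.
  move=> /(irred_prime f'i)[f'f|//]; exfalso.
  exact: (irred_not_common f'i uv (dvd_trans f'f fu) f'v).
Qed.

Lemma normal_crossing h1 h2 : inV h1 -> inV h2 -> independent h1 h2 ->
  exists f f' a b (s : K) (e e' : nat), [/\ f 0%N 0%N = 0 /\ f' 0%N 0%N = 0,
    f 1%N 0%N * f' 0%N 1%N - f 0%N 1%N * f' 1%N 0%N <> 0,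
    der X f = a * f /\ der X f' = b * f',
    [/\ s <> 0, (0 < e)%N & (0 < e')%N] &
    a 0%N 0%N = s * e'%:R /\ b 0%N 0%N = s * e%:R].
Proof.
move=> V1 V2 ind; have [Y [h [c [[XY W0] Vh h0 c0 Yh]]]] := eigen_field V1 V2 ind.
have VY : inV (wedge X Y) by exists Y.
have YW := der_wedgeY XY.
have ind' : independent h (wedge X Y).
  move=> p q e; have p0 : p = 0.
    have : cst (p * c) * h = 0.
      have -> : cst (p * c) * h = der Y (cst p * h + cst q * wedge X Y) -
          divg Y * (cst p * h + cst q * wedge X Y).
        by rewrite raddfD /= !der_cstM Yh YW rmorphM /=; ring.
      by rewrite e raddf0 mulr0 subr0.
    move=> /cmul_eq0[|//] /(congr1 (fun f : O => f 0 0)%N); rewrite cst00 c0E => /eqP.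
    by rewrite mulf_eq0 => /orP[/eqP//|/eqP].
  split=> //; move: e; rewrite p0 rmorph0 mul0r add0r => /cmul_eq0[|//].
  by move=> /(congr1 (fun f : O => f 0 0)%N); rewrite cst00 c0E.
have [g [u [v [l [hE WE uv [u00 v00] [Xu Xv]]]]]] := pencil (inV_der Vh) (inV_der VY) ind'.
have u0 : u <> 0 by move=> u0; apply: h0; rewrite hE u0 mulr0.
have v0 : v <> 0 by move=> v0; apply: W0; rewrite WE v0 mulr0.
have g0 : g <> 0 by move=> g0; apply: h0; rewrite hE g0 mul0r.
have E : v * der Y u - u * der Y v = cst c * u * v.
  apply: (cmulI (cmul_neq0 g0 g0)).
  have -> : g * g * (v * der Y u - u * der Y v) =
      der Y (g * u) * (g * v) - (g * u) * der Y (g * v) by rewrite !derM; ring.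
  by rewrite -hE -WE Yh YW hE WE; ring.
have [|al alE] := @euclid _ v u (der Y v) v0 (coprime_germs_sym uv).
  by exists (der Y u - cst c * u); rewrite mulrBl [der Y u * v]mulrC -E; ring.
have Yu : der Y u = (al + cst c) * u.
  apply: (cmulI v0); have -> : v * der Y u = cst c * u * v + u * der Y v by rewrite -E; ring.
  by rewrite alE; ring.
have [f [e [k [T [[fi fu] e0 [Y1 Y2] ec TP]]]]] := transverse_field XY uv u0 v0 u00 Xu Xv Yu alE.
(* Exchanging u and v replaces c by - c. *)
have Yv' : der Y v = ((al + cst c) + cst (- c)) * v by rewrite alE rmorphN; ring.
have [f' [e' [k' [T' [[f'i f'v] e'0 [Y1' Y2'] e'c TP']]]]] :=
  transverse_field XY (coprime_germs_sym uv) v0 u0 v00 Xv Xu Yv' Yu.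
have [f0 f00 _] := fi; have [f'0 f'00 _] := f'i.
have [t tE] := TP _ f'i f'v; have [t' t'E] := TP' _ fi fu.
have nz n (z : K) (d : K) : n%:R * z = d -> d <> 0 -> z <> 0.
  by move=> <- d0 z0; apply: d0; rewrite z0 mulr0.
(* If k = k', then f T = f' T', so f' divides both components of T and T(f) vanishes at 0, contrary
   to e T(f)(0) = c. *)
have kk : k' - k <> 0.
  move=> /eqP; rewrite subr_eq0 => /eqP kk; apply: (nz _ _ _ ec c0).
  have same Tj Tj' Xj (Yj : O) : Yj = cst k * Xj + f * Tj -> Yj = cst k' * Xj + f' * Tj' ->
      Tj 0%N 0%N = 0.
    move=> -> ee; have : dvd f' (f * Tj).
      exists Tj'; apply: (addrI (cst k * Xj)); rewrite ee kk [Tj' * f']mulrC //.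
    move=> /(irred_prime f'i)[f'f|/dvd00]; last exact.
    by exfalso; exact: (irred_not_common f'i uv (dvd_trans f'f fu) f'v).
  by rewrite /der cDE !cM00 (same _ _ _ _ Y1 Y1') (same _ _ _ _ Y2 Y2') !mul0r addr0.
pose m := (k' - k)^-1.
have XE z : der X z = cst m * (f * der T z - f' * der T' z).
  have : cst (k' - k) * der X z = f * der T z - f' * der T' z.
    have -> : f * der T z = der Y z - cst k * der X z by rewrite /der Y1 Y2; ring.
    have -> : f' * der T' z = der Y z - cst k' * der X z by rewrite /der Y1' Y2'; ring.
    by rewrite rmorphB /=; ring.
  move=> <-; rewrite mulrA -rmorphM mulVf ?rmorph1 ?mul1r //; exact/eqP.
exists f, f', (cst m * (der T f - f' * t')), (cst m * (f * t - der T' f')).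
(* At 0 the eigenvalues are m c / e and m c / e'; this common factor leaves the integers e' and
   e. *)
exists (c * m / (e%:R * e'%:R)), e, e'.
have eR : e%:R != 0 :> K by rewrite pnatr_eq0 -lt0n.
have e'R : e'%:R != 0 :> K by rewrite pnatr_eq0 -lt0n.
have m0 : m != 0 by rewrite invr_eq0; exact/eqP.
have Tf : der T f 0%N 0%N = c / e%:R by apply: (mulfI eR); rewrite ec mulrC divfK.
have T'f' : der T' f' 0%N 0%N = - c / e'%:R by apply: (mulfI e'R); rewrite e'c mulrC divfK.
split=> //.
- have Tf'0 : der T f' 0%N 0%N = 0 by rewrite tE cM00 f'00 mulr0.
  have T'f0 : der T' f 0%N 0%N = 0 by rewrite t'E cM00 f00 mulr0.
  move: Tf T'f' Tf'0 T'f0; rewrite /der !cDE !cM00 !dX00 !dY00.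
  set v1 := T.1 _ _; set v2 := T.2 _ _; set v1' := T'.1 _ _; set v2' := T'.2 _ _.
  move=> Tf T'f' Tf'0 T'f0 det.
  (* The matrix of T and T' acting on f and f' is diagonal at 0, and its determinant is det(T, T')
     times the Jacobian of (f, f'). *)
  have : (c / e%:R) * (- c / e'%:R) = 0.
    rewrite -Tf -T'f'.
    have -> : (v1 * f 1%N 0%N + v2 * f 0%N 1%N) * (v1' * f' 1%N 0%N + v2' * f' 0%N 1%N) =
      (v1 * f' 1%N 0%N + v2 * f' 0%N 1%N) * (v1' * f 1%N 0%N + v2' * f 0%N 1%N) +
      (v1 * v2' - v2 * v1') * (f 1%N 0%N * f' 0%N 1%N - f 0%N 1%N * f' 1%N 0%N) by ring.
    by rewrite Tf'0 det; ring.
  by move=> /eqP; rewrite !mulf_eq0 oppr_eq0 !invr_eq0 (negbTE eR) (negbTE e'R) !orbF orbb => /eqP.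
- by split; rewrite XE ?t'E ?tE; ring.
- by split=> //; apply/eqP; rewrite !mulf_neq0 ?invr_eq0 ?mulf_neq0 //; exact/eqP.
- split; rewrite cstM cBE cM00.
    by rewrite f'00 mul0r subr0 Tf; move: eR e'R; move: (e%:R) (e'%:R) => x y x0 y0; field; rewrite ?x0 ?y0.
  by rewrite f00 mul0r sub0r T'f'; move: eR e'R; move: (e%:R) (e'%:R) => x y x0 y0; field; rewrite ?x0 ?y0.
Qed.
End Core.

Arguments cc : simpl never.
Lemma psum2_single (K : numFieldType) (F : nat -> nat -> K) p q N : (p < N)%N -> (q < N)%N ->
  (forall i j, ~~ ((i == p) && (j == q)) -> F i j = 0) -> psum2 F N = F p q.
Proof.
move=> pN qN F0; rewrite /psum2 (bigD1 (Ordinal pN)) //= [X in X + _](bigD1 (Ordinal qN)) //=.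
rewrite big1 ?addr0 => [|j ne]; last first.
  by apply: F0; apply/negP => /andP[_ /eqP e]; move/eqP: ne; apply; exact/val_inj.
rewrite big1 ?addr0 // => i ne; rewrite big1 // => j _.
by apply: F0; apply/negP => /andP[/eqP e _]; move/eqP: ne; apply; exact/val_inj.
Qed.

(** * Composition and inverse function theorem *)

Section Composition.
Variable K : numFieldType.
Notation O := (cps K).
Implicit Types (f g h G H : O) (k : K).

Definition trunc N G : O := \sum_(p < N) \sum_(q < N) cst (G p q) * (vx K ^+ p * vy K ^+ q).

Lemma truncE N G i j : trunc N G i j = if (i < N)%N && (j < N)%N then G i j else 0.
Proof.
have mE p q : (cst (G p q) * (vx K ^+ p * vy K ^+ q) : O) i j =
    if (i == p) && (j == q) then G p q else 0.
  by rewrite -cmonoX -cmono_cst cmonoE.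
rewrite /trunc c_sumE; under eq_bigr do rewrite c_sumE.
case: ltnP => [iN|Ni] /=; last first.
  rewrite big1 // => p _; rewrite big1 // => q _; rewrite mE ifF //.
  by have := ltn_ord p; lia.
rewrite (bigD1 (Ordinal iN)) //= [X in _ + X]big1 ?addr0; last first.
  move=> p /eqP ne; rewrite big1 // => q _; rewrite mE ifF //; apply/negP => /andP[/eqP e _].
  by apply: ne; exact/val_inj.
case: ltnP => [jN|Nj]; last first.
  by rewrite big1 // => q _; rewrite mE ifF //; have := ltn_ord q; lia.
rewrite (bigD1 (Ordinal jN)) //= big1 ?addr0; first by rewrite mE !eqxx.
move=> q /eqP ne; rewrite mE ifF //; apply/negP => /andP[_ /eqP e].
by apply: ne; exact/val_inj.
Qed.

Lemma ordge_trunc N G : ordge N (G - trunc N G).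
Proof.
move=> i j ij; rewrite cBE truncE ifT ?subrr //; apply/andP; split; lia.
Qed.

Definition continuous_linear (L : O -> O) :=
  [/\ {morph L : f g / f - g}, forall k f, L (cst k * f) = cst k * L f &
      forall n f, ordge n f -> ordge n (L f)].

(** The maps agree on truncations and the rest has arbitrarily high order. The algebraic laws of
    substitution thus reduce to monomials. *)
Lemma continuous_linear_eq L1 L2 : continuous_linear L1 -> continuous_linear L2 ->
  (forall p q, L1 (vx K ^+ p * vy K ^+ q) = L2 (vx K ^+ p * vy K ^+ q)) ->
  forall f, L1 f = L2 f.
Proof.
move=> [B1 Z1 o1] [B2 Z2 o2] mono f.
have L0 (L : O -> O) : {morph L : f g / f - g} -> L 0 = 0 by move=> LB; rewrite -{1}(subrr (0 : O)) LB subrr.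
have LD (L : O -> O) : {morph L : f g / f - g} -> {morph L : f g / f + g}.
  by move=> LB u v; rewrite -{1}(opprK v) LB -sub0r LB L0 // sub0r opprK.
have tr N : L1 (trunc N f) = L2 (trunc N f).
  rewrite /trunc !(big_morph L1 (LD _ B1) (L0 _ B1)) !(big_morph L2 (LD _ B2) (L0 _ B2)).
  apply: eq_bigr => p _; rewrite !(big_morph L1 (LD _ B1) (L0 _ B1)).
  rewrite !(big_morph L2 (LD _ B2) (L0 _ B2)).
  by apply: eq_bigr => q _; rewrite Z1 Z2 mono.
apply/eqP; rewrite -subr_eq0; apply/eqP; apply: ordge0 => N.
have -> : L1 f - L2 f = L1 (f - trunc N f) - L2 (f - trunc N f).
  by rewrite B1 B2 tr; ring.
by apply: ordgeB; [apply: o1|apply: o2]; exact: ordge_trunc.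
Qed.

Lemma norm_le_cst1 (r : K) : 0 <= r -> norm_le r r (1 : O) 1.
Proof.
move=> r0; have := norm_le_mono 1 0 0 r0 r0.
by rewrite normr1 !expr0 !mulr1 ps_mono1.
Qed.

Lemma norm_leX (r M : K) f n : 0 <= r -> norm_le r r f M -> norm_le r r (f ^+ n : O) (M ^+ n).
Proof.
move=> r0 fM; elim: n => [|n IH]; first by rewrite !expr0; exact: norm_le_cst1.
by rewrite !exprS; exact: (norm_leM r0 r0 fM IH).
Qed.

Lemma small_norm n f : ordge n f -> exists rho C : K, [/\ 0 < rho, 0 <= C &
  forall r, 0 <= r <= rho -> norm_le r r f (C * r ^+ n)].
Proof.
move=> fn; have [rho [M [rho0 fM]]] := cpsP f; have rho0' := ltW rho0.
exists rho, (M / rho ^+ n); split=> //.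
  by rewrite divr_ge0 ?exprn_ge0 // (norm_le_ge0 fM).
move=> r /andP[r0 rrho]; rewrite mulrAC -mulrA mulrC.
have rr : 0 <= r <= rho by rewrite r0.
apply: (norm_le_small rr rr _ _ fM); first by rewrite divr_ge0 ?exprn_ge0.
move=> i j /eqP fij; have nij : (n <= i + j)%N.
  by rewrite leqNgt; apply/negP => /fn.
rewrite -!exprD -(subnKC nij) !exprD mulrA divfK ?expf_neq0 ?lt0r_neq0 //.
by rewrite ler_wpM2l ?exprn_ge0 // lerXn2r.
Qed.

Lemma small_norm_eps f (eps : K) : f 0%N 0%N = 0 -> 0 < eps -> exists rho : K, 0 < rho /\
  forall r, 0 <= r <= rho -> norm_le r r f eps.
Proof.
move=> /ordge1 f1 eps0; have [rho [C [rho0 C0 small]]] := small_norm f1.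
have D0 : 0 < C + 1 by rewrite ltr_wpDl.
have x0 : 0 < eps / (C + 1) by rewrite divr_gt0.
have [t [t0 [t1 t2]]] : exists t : K, 0 < t /\ t <= rho /\ t <= eps / (C + 1).
  have /orP[le|le] := real_leVge (gtr0_real rho0) (gtr0_real x0).
    by exists rho.
  by exists (eps / (C + 1)).
exists t; split=> // r /andP[r0 rt]; apply: norm_leW (small r _); last first.
  by rewrite r0 (le_trans rt).
rewrite expr1; apply: (@le_trans _ _ ((C + 1) * r)); first by rewrite ler_wpM2r // lerDl.
by rewrite mulrC -ler_pdivlMr // (le_trans rt).
Qed.

Section Substitution.
Variables u v : O.
Hypotheses (u0 : u 0%N 0%N = 0) (v0 : v 0%N 0%N = 0).

Lemma ordge_mono p q : ordge (p + q) (u ^+ p * v ^+ q).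
Proof.
have up := @ordgeX _ _ _ p (iffLR (ordge1 u) u0); have vq := @ordgeX _ _ _ q (iffLR (ordge1 v) v0).
by rewrite !mul1n in up vq; exact: ordgeM.
Qed.

(** A finite sum suffices in each degree, because u^p v^q has order at least p + q. *)
Definition comp_fun G : fps (fps K) := fun i j =>
  psum2 (fun p q => G p q * (u ^+ p * v ^+ q : O) i j) (i + j).+1.

Lemma comp_funE G i j N : (i + j < N)%N ->
  comp_fun G i j = psum2 (fun p q => G p q * (u ^+ p * v ^+ q : O) i j) N.
Proof.
move=> ijN; rewrite /comp_fun /psum2.
rewrite (big_ord_widen N (fun p => \sum_(q < (i + j).+1) G p q * (u ^+ p * v ^+ q : O) i j)) //.
rewrite big_mkcond /=; apply: eq_bigr => p _; case: ltnP => pij; last first.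
  by rewrite big1 // => q _; rewrite ordge_mono ?mulr0 //; lia.
rewrite (big_ord_widen N (fun q => G p q * (u ^+ p * v ^+ q : O) i j)) //.
rewrite big_mkcond /=; apply: eq_bigr => q _; case: ltnP => // qij.
by rewrite ordge_mono ?mulr0 //; lia.
Qed.

Lemma norm_le_comp (r rho M : K) (G : O) : 0 <= r -> 0 <= rho ->
  norm_le r r u rho -> norm_le r r v rho -> norm_le rho rho G M ->
  norm_le r r (comp_fun G) M.
Proof.
move=> r0 rho0 ur vr GM N; have w0 i j : 0 <= r ^+ i * r ^+ j by rewrite mulr_ge0 ?exprn_ge0.
apply: le_trans (GM (N + N)%N).
apply: (@le_trans _ _ (psum2 (fun i j => psum2 (fun p q =>
   `|G p q| * (`|(u ^+ p * v ^+ q : O) i j| * (r ^+ i * r ^+ j))) (N + N)) N)).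
  apply: ler_psum2 => i j iN jN; rewrite (@comp_funE G i j (N + N)); last by lia.
  apply: le_trans (ler_wpM2r (w0 _ _) (psum2_norm _ _)) _.
  by rewrite -psum2Zr; apply: ler_psum2 => p q _ _; rewrite normrM -[leLHS]mulrA.
rewrite psum2_exchange; apply: ler_psum2 => p q _ _; rewrite psum2Zl ler_wpM2l //.
exact: (norm_leM r0 r0 (norm_leX p r0 ur) (norm_leX q r0 vr)).
Qed.

Lemma conv_comp G : conv (comp_fun G).
Proof.
have [rho [M [rho0 GM]]] := cpsP G.
have [r1 [r10 r1u]] := small_norm_eps u0 rho0.
have [r2 [r20 r2v]] := small_norm_eps v0 rho0.
have [r [r0 [rr1 rr2]]] : exists r : K, 0 < r /\ r <= r1 /\ r <= r2.
  have /orP[le|le] := real_leVge (gtr0_real r10) (gtr0_real r20).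
    by exists r1.
  by exists r2.
exists r, M; split=> //; apply: norm_le_comp GM; rewrite ?ltW //.
  by apply: r1u; rewrite ltW.
by apply: r2v; rewrite ltW.
Qed.
End Substitution.

(* G(u, v), for non-units u and v (junk value 0 otherwise). *)
Definition comp G (u v : O) : O :=
  if pselect (u 0%N 0%N = 0 /\ v 0%N 0%N = 0) is left uv
  then mk_cps (conv_comp uv.1 uv.2 G) else 0.

Section SubstitutionTheory.
Variables u v : O.
Hypotheses (u0 : u 0%N 0%N = 0) (v0 : v 0%N 0%N = 0).

Lemma compE G i j N : (i + j < N)%N ->
  comp G u v i j = psum2 (fun p q => G p q * (u ^+ p * v ^+ q : O) i j) N.
Proof.
move=> ijN; rewrite /comp; case: pselect => [uv|nuv]; last by exfalso; apply: nuv.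
exact: comp_funE.
Qed.

Lemma comp_norm (r rho M : K) G : 0 <= r -> 0 <= rho ->
  norm_le r r u rho -> norm_le r r v rho -> norm_le rho rho G M ->
  norm_le r r (comp G u v) M.
Proof.
move=> r0 rho0 ur vr GM; rewrite /comp; case: pselect => [uv|nuv]; last by exfalso; apply: nuv.
exact: norm_le_comp GM.
Qed.

Lemma comp_continuous : continuous_linear (fun G => comp G u v).
Proof.
split=> [f g|k f|n f fn]; first 2 last.
- move=> i j ij; rewrite (@compE _ _ _ (i + j).+1) // /psum2 big1 // => p _; rewrite big1 // => q _.
  have [pq|pq] := ltnP (p + q) n; first by rewrite fn ?mul0r.
  by rewrite (ordge_mono u0 v0) ?mulr0 //; lia.
- apply: cps_ext => i j; rewrite cBE !(@compE _ i j (i + j).+1) // -psum2B.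
  by apply: eq_psum2 => p q _ _; rewrite cBE mulrBl.
- apply: cps_ext => i j; rewrite cstM !(@compE _ i j (i + j).+1) // -psum2Zl.
  by apply: eq_psum2 => p q _ _; rewrite cstM mulrA.
Qed.

Lemma comp_mono p q : comp (vx K ^+ p * vy K ^+ q) u v = u ^+ p * v ^+ q.
Proof.
apply: cps_ext => i j; pose N := (i + j + p + q).+1.
rewrite (@compE _ i j N); last by rewrite /N; lia.
have pN : (p < N)%N by rewrite /N; lia.
have qN : (q < N)%N by rewrite /N; lia.
rewrite (psum2_single pN qN) -cmonoX => [|i' j' /negbTE ne].
  by rewrite cmonoE !eqxx mul1r.
by rewrite cmonoE ne mul0r.
Qed.

Lemma compB f g : comp (f - g) u v = comp f u v - comp g u v.
Proof. by case: comp_continuous. Qed.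
Lemma comp_cstM k f : comp (cst k * f) u v = cst k * comp f u v.
Proof. by case: comp_continuous. Qed.
Lemma comp_vx : comp (vx K) u v = u.
Proof. by have := comp_mono 1 0; rewrite !expr1 !expr0 !mulr1. Qed.
Lemma comp_vy : comp (vy K) u v = v.
Proof. by have := comp_mono 0 1; rewrite !expr1 !expr0 !mul1r. Qed.
Lemma comp1 : comp 1 u v = 1.
Proof. by have := comp_mono 0 0; rewrite !expr0 !mulr1. Qed.
Lemma comp0 : comp 0 u v = 0.
Proof. by rewrite -{1}(subrr (0 : O)) compB subrr. Qed.
Lemma compD f g : comp (f + g) u v = comp f u v + comp g u v.
Proof. by rewrite -{1}[g]opprK compB -[- g]sub0r compB comp0 sub0r opprK. Qed.
Lemma comp00 f : comp f u v 0%N 0%N = f 0%N 0%N.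
Proof.
by rewrite (@compE _ _ _ 1) // /psum2 !big_ord1 !expr0 mulr1 c1E mulr1.
Qed.

Lemma continuous_linearM g L : continuous_linear L -> continuous_linear (fun f => g * L f).
Proof.
move=> [LB LZ Lo]; split=> [f h|k f|n f fn]; first by rewrite LB mulrBr.
  by rewrite LZ; ring.
by apply: ordgeMl; exact: Lo.
Qed.

Lemma continuous_linear_mul g : continuous_linear (fun f => g * f).
Proof.
by apply: (@continuous_linearM g id); split.
Qed.

Lemma continuous_linear_comp L1 L2 : continuous_linear L1 -> continuous_linear L2 ->
  continuous_linear (fun f => L1 (L2 f)).
Proof.
move=> [B1 Z1 o1] [B2 Z2 o2]; split=> [f h|k f|n f fn]; first by rewrite B2 B1.
  by rewrite Z2 Z1.
by apply: o1; exact: o2.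
Qed.

Lemma compM f g : comp (f * g) u v = comp f u v * comp g u v.
Proof.
have cl := comp_continuous.
rewrite mulrC [RHS]mulrC; move: f; apply: continuous_linear_eq.
- exact: continuous_linear_comp cl (continuous_linear_mul g).
- exact: continuous_linearM.
move=> p q; rewrite [LHS](_ : _ = comp (vx K ^+ p * vy K ^+ q * g) u v); last by rewrite mulrC.
rewrite comp_mono [RHS]mulrC; move: g; apply: continuous_linear_eq.
- exact: continuous_linear_comp cl (continuous_linear_mul _).
- exact: continuous_linearM.
move=> p' q'; rewrite comp_mono.
have -> : vx K ^+ p * vy K ^+ q * (vx K ^+ p' * vy K ^+ q') = vx K ^+ (p + p') * vy K ^+ (q + q').
  by rewrite !exprD; ring.
by rewrite comp_mono !exprD; ring.
Qed.
Lemma compX f n : comp (f ^+ n) u v = comp f u v ^+ n.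
Proof. by elim: n => [|n IH]; rewrite ?expr0 ?comp1 // !exprS compM IH. Qed.
End SubstitutionTheory.

Lemma comp_assoc G (u v u' v' : O) : u 0%N 0%N = 0 -> v 0%N 0%N = 0 -> u' 0%N 0%N = 0 -> v' 0%N 0%N = 0 ->
  comp (comp G u v) u' v' = comp G (comp u u' v') (comp v u' v').
Proof.
move=> u0 v0 u'0 v'0; have cu : comp u u' v' 0%N 0%N = 0 by rewrite comp00.
have cv : comp v u' v' 0%N 0%N = 0 by rewrite comp00.
move: G; apply: continuous_linear_eq.
- exact: continuous_linear_comp (comp_continuous u'0 v'0) (comp_continuous u0 v0).
- exact: comp_continuous.
by move=> p q; rewrite !comp_mono // compM // !compX.
Qed.

Lemma comp_id G : comp G (vx K) (vy K) = G.
Proof.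
have x0 : vx K 0%N 0%N = 0 by rewrite cmonoE.
have y0 : vy K 0%N 0%N = 0 by rewrite cmonoE.
move: G; apply: continuous_linear_eq; first exact: comp_continuous.
  by split.
by move=> p q; rewrite comp_mono.
Qed.

(** The chain rule, the factors u and v of X(u) and X(v) being absorbed into x d/dx and y d/dy.
    Since X vanishes at 0, [der X] respects the filtration by order and monomials suffice. *)
Lemma der_comp (X : O * O) (u v a b : O) G : u 0%N 0%N = 0 -> v 0%N 0%N = 0 ->
  X.1 0%N 0%N = 0 -> X.2 0%N 0%N = 0 -> der X u = a * u -> der X v = b * v ->
  der X (comp G u v) = a * comp (vx K * dX G) u v + b * comp (vy K * dY G) u v.
Proof.
move=> u0 v0 X10 X20 Xu Xv.
have clX n f : ordge n f -> ordge n (der X f).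
  move=> fn; have d1 (w df : O) : w 0%N 0%N = 0 -> ordge n.-1 df -> ordge n (w * df).
    move=> /ordge1 w1 dn; case: n {fn} dn => [|n] dn; first exact: ordge_0.
    by rewrite -add1n; exact: ordgeM.
  apply: ordgeD; apply: d1 => // i j ij; rewrite ?dXE ?dYE fn ?mulr0 //; lia.
have clD (w : O) (D : O -> O) : {morph D : f g / f - g} -> (forall k f, D (cst k * f) = cst k * D f) ->
    (forall n f, ordge n f -> ordge n (w * D f)) -> continuous_linear (fun f => w * D f).
  by move=> DB DZ Do; split=> [f g|k f|//]; rewrite ?DB ?DZ; ring.
have clx : continuous_linear (fun f => vx K * dX f).
  apply: clD; [exact: raddfB|by move=> k f; rewrite dXM dX_cst mul0r add0r|].
  move=> n f fn [|i] j ij; rewrite vxM // dXE fn ?mulr0 //.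
have cly : continuous_linear (fun f => vy K * dY f).
  apply: clD; [exact: raddfB|by move=> k f; rewrite dYM dY_cst mul0r add0r|].
  move=> n f fn i [|j] ij; rewrite vyM // dYE fn ?mulr0 //; lia.
have cl := comp_continuous u0 v0.
move: G; apply: continuous_linear_eq.
- apply: continuous_linear_comp => //; split=> // [|k f]; first exact: raddfB.
  exact: der_cstM.
- have [B1 Z1 o1] := continuous_linearM a (continuous_linear_comp cl clx).
  have [B2 Z2 o2] := continuous_linearM b (continuous_linear_comp cl cly).
  split=> [f g|k f|n f fn]; first by rewrite B1 B2; ring.
    by rewrite Z1 Z2; ring.
  by apply: ordgeD; [exact: o1|exact: o2].
move=> p q; rewrite comp_mono // derM !derXn Xu Xv.
have -> : vx K * dX (vx K ^+ p * vy K ^+ q) = cst p%:R * (vx K ^+ p * vy K ^+ q).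
  apply: cps_ext => i j; rewrite -cmonoX cstM vxM cmonoE; case: i => [|i].
    by case: p => [|p] //=; rewrite ?mul0r ?mulr0.
  by rewrite dXE cmonoE; case: ifP => [/andP[/eqP -> _]|_]; rewrite ?mulr0.
have -> : vy K * dY (vx K ^+ p * vy K ^+ q) = cst q%:R * (vx K ^+ p * vy K ^+ q).
  apply: cps_ext => i j; rewrite -cmonoX cstM vyM cmonoE; case: j => [|j].
    by case: q => [|q] //=; rewrite ?andbF ?mul0r ?mulr0.
  by rewrite dYE cmonoE; case: ifP => [/andP[_ /eqP ->]|_]; rewrite ?mulr0.
rewrite !comp_cstM // comp_mono // !rmorph_nat.
have uE : p%:R * u ^+ p.-1 * (a * u) = p%:R * a * u ^+ p.
  by case: p => [|p]; rewrite ?mul0r // exprS /=; ring.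
have vE : q%:R * v ^+ q.-1 * (b * v) = q%:R * b * v ^+ q.
  by case: q => [|q]; rewrite ?mul0r // exprS /=; ring.
by rewrite uE vE; ring.
Qed.
End Composition.

(** * The inverse function theorem for convergent series *)

Section InverseFunction.
Variable K : numFieldType.
Notation O := (cps K).
Notation x := (vx K).
Notation y := (vy K).

Definition jac (f g : O) : K := f 1%N 0%N * g 0%N 1%N - f 0%N 1%N * g 1%N 0%N.

Lemma ordge_powB k (a b : O) n : ordge k (a - b) -> ordge 1 a -> ordge 1 b -> (0 < k)%N ->
  (0 < n)%N -> ordge (k + n.-1) (a ^+ n - b ^+ n).
Proof.
move=> ab a1 b1 k0; case: n => // n _ /=; elim: n => [|n IH]; first by rewrite addn0 !expr1.
rewrite exprS [b ^+ _]exprS.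
have -> : a * a ^+ n.+1 - b * b ^+ n.+1 = (a - b) * a ^+ n.+1 + b * (a ^+ n.+1 - b ^+ n.+1) by ring.
apply: ordgeD; first by have := @ordgeX _ _ _ n.+1 a1; rewrite mul1n; exact: ordgeM.
by rewrite addnS -add1n; exact: ordgeM.
Qed.

(** Every monomial of H has degree at least 2, so a difference of arguments is always multiplied by
    a further non-unit: substitution into H is an m-adic contraction. *)
Lemma comp_congr k (H u v u' v' : O) : ordge 2 H -> ordge 1 u -> ordge 1 v -> ordge 1 u' -> ordge 1 v' ->
  (0 < k)%N -> ordge k (u - u') -> ordge k (v - v') -> ordge k.+1 (comp H u v - comp H u' v').
Proof.
move=> H2 u1 v1 u1' v1' k0 uu vv i j ij; have z (w : O) := iffRL (ordge1 w).
rewrite cBE !(@compE _ _ _ _ _ _ _ _ (i + j).+1) //; try exact: z.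
rewrite -psum2B /psum2 big1 // => p _; rewrite big1 // => q _; rewrite -mulrBr -cBE.
have [pq|pq] := ltnP (p + q) 2; first by rewrite H2 ?mul0r.
have pow (w : O) n : ordge 1 w -> ordge n (w ^+ n).
  by move=> w1; have := @ordgeX _ _ _ n w1; rewrite mul1n.
suff od : ordge k.+1 (u ^+ p * v ^+ q - u' ^+ p * v' ^+ q) by rewrite od ?mulr0.
have -> : u ^+ p * v ^+ q - u' ^+ p * v' ^+ q =
  (u ^+ p - u' ^+ p) * v ^+ q + u' ^+ p * (v ^+ q - v' ^+ q) by ring.
apply: ordgeD.
  case: (posnP p) => [->|p0]; first by rewrite subrr mul0r; exact: ordge_zero.
  have h := ordgeM (ordge_powB uu u1 u1' k0 p0) (pow _ q v1).
  by apply: ordgeW h; lia.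
case: (posnP q) => [->|q0]; first by rewrite subrr mulr0; exact: ordge_zero.
have h := ordgeM (pow _ p u1') (ordge_powB vv v1 v1' k0 q0).
by apply: ordgeW h; lia.
Qed.

Section FixedPoint.
Variables (H1 H2 : O) (A00 A01 A10 A11 : K).
Hypotheses (H1o : ordge 2 H1) (H2o : ordge 2 H2).

(** For A the inverse of the linear part and H the terms of higher order, the right inverses are the
    fixed points of w |-> A (id - H(w)). *)
Let step (w : O * O) : O * O :=
  let h1 := x - comp H1 w.1 w.2 in let h2 := y - comp H2 w.1 w.2 in
  (cst (A00) * h1 + cst (A01) * h2, cst (A10) * h1 + cst (A11) * h2).

Let psi n := iter n step (0, 0).

Lemma vx_ordge1 : ordge 1 x. Proof. by apply/ordge1; rewrite cmonoE. Qed.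
Lemma vy_ordge1 : ordge 1 y. Proof. by apply/ordge1; rewrite cmonoE. Qed.

Let comp_ordge1 (H u v : O) : ordge 2 H -> ordge 1 u -> ordge 1 v -> ordge 1 (comp H u v).
Proof. by move=> Ho /ordge1 u1 /ordge1 v1; apply/ordge1; rewrite comp00 // Ho. Qed.

Let step_ordge1 w : ordge 1 w.1 -> ordge 1 w.2 -> ordge 1 (step w).1 /\ ordge 1 (step w).2.
Proof.
move=> w1 w2; have h1 : ordge 1 (x - comp H1 w.1 w.2).
  by apply: ordgeB; [exact: vx_ordge1|exact: comp_ordge1].
have h2 : ordge 1 (y - comp H2 w.1 w.2).
  by apply: ordgeB; [exact: vy_ordge1|exact: comp_ordge1].
by split; apply: ordgeD; exact: ordgeMl.
Qed.

Let psi_ordge1 n : ordge 1 (psi n).1 /\ ordge 1 (psi n).2.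
Proof.
elim: n => [|n [IH1 IH2]]; first by split; exact: ordge_zero.
exact: step_ordge1.
Qed.

Let step_congr k w w' : (0 < k)%N -> ordge 1 w.1 -> ordge 1 w.2 -> ordge 1 w'.1 -> ordge 1 w'.2 ->
  ordge k (w.1 - w'.1) -> ordge k (w.2 - w'.2) ->
  ordge k.+1 ((step w).1 - (step w').1) /\ ordge k.+1 ((step w).2 - (step w').2).
Proof.
move=> k0 w1 w2 w1' w2' e1 e2.
have c1 := comp_congr H1o w1 w2 w1' w2' k0 e1 e2.
have c2 := comp_congr H2o w1 w2 w1' w2' k0 e1 e2.
have E a b : cst a * (x - comp H1 w.1 w.2) + cst b * (y - comp H2 w.1 w.2) -
    (cst a * (x - comp H1 w'.1 w'.2) + cst b * (y - comp H2 w'.1 w'.2)) =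
    - (cst a * (comp H1 w.1 w.2 - comp H1 w'.1 w'.2) + cst b * (comp H2 w.1 w.2 - comp H2 w'.1 w'.2)).
  by ring.
by split; rewrite /step /= E; apply: ordgeN; apply: ordgeD; exact: ordgeMl.
Qed.

Let psi_stable n m : (n <= m)%N -> ordge n.+1 ((psi m).1 - (psi n).1) /\ ordge n.+1 ((psi m).2 - (psi n).2).
Proof.
elim: n m => [|n IH] [|m] // nm; first by rewrite !subrr; split; exact: ordge_zero.
  rewrite !subr0; exact: psi_ordge1.
have [e1 e2] := IH m nm; have [? ?] := psi_ordge1 m; have [? ?] := psi_ordge1 n.
exact: step_congr.
Qed.

Let psi_bound : exists r B : K, [/\ 0 < r, 0 <= B &
  forall n, norm_le r r (psi n).1 B /\ norm_le r r (psi n).2 B].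
Proof.
have [rho1 [C1 [rho10 C10 s1]]] := small_norm H1o.
have [rho2 [C2 [rho20 C20 s2]]] := small_norm H2o.
(* If the iterate has norm at most B r at radius r, then H of it has norm at most C (B r)^2 <= r,
   and a step returns at most 2 c (r + r) = B r. The sum S serves as a maximum; it also gives B r <=
   rho1 and B r <= rho2. *)
pose c := `|A00| + `|A01| + `|A10| + `|A11| + 1.
have c0 : 0 < c by rewrite ltr_wpDl // !addr_ge0.
pose B := 4 * c; have B0 : 0 < B by rewrite mulr_gt0.
pose C := C1 + C2 + 1; have C0 : 0 < C by rewrite ltr_wpDl // addr_ge0.
pose D := C * B ^+ 2; have D0 : 0 < D by rewrite mulr_gt0 // exprn_gt0.
pose S := D + B / rho1 + B / rho2; pose r := S^-1.
have S0 : 0 < S by rewrite !addr_gt0 ?divr_gt0.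
have r0 : 0 < r by rewrite invr_gt0.
have rD : r * D <= 1.
  by rewrite mulrC ler_pdivrMr // mul1r /S -addrA lerDl addr_ge0 ?divr_ge0 ?(ltW B0) ?ltW.
have rB1 : B * r <= rho1.
  rewrite ler_pdivrMr // -ler_pdivrMl // mulrC /S addrAC lerDr.
  by rewrite addr_ge0 ?divr_ge0 ?(ltW B0) ?ltW.
have rB2 : B * r <= rho2.
  rewrite ler_pdivrMr // -ler_pdivrMl // mulrC /S lerDr.
  by rewrite addr_ge0 ?divr_ge0 ?(ltW B0) ?ltW.
have rB0 : 0 <= B * r by rewrite mulr_ge0 ?ltW.
exists r, (B * r); split=> // n; elim: n => [|n [IH1 IH2]].
  by split=> N; rewrite [psum2 _ _](_ : _ = 0) // /psum2 big1 // => i _; rewrite big1 // => j _;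
    rewrite [X in `|X|](_ : _ = 0) ?normr0 ?mul0r //; exact: c0E.
have [/ordge1 p1 /ordge1 p2] := psi_ordge1 n.
have r0' := ltW r0.
have nx : norm_le r r x r.
  by have := norm_le_mono 1 1 0 r0' r0'; rewrite normr1 expr1 expr0 mulr1 mul1r.
have ny : norm_le r r y r.
  by have := norm_le_mono 1 0 1 r0' r0'; rewrite normr1 expr1 expr0 !mul1r.
have nH (H : O) Ci : norm_le (B * r) (B * r) H (Ci * (B * r) ^+ 2) -> 0 <= Ci -> Ci <= C ->
    norm_le r r (comp H (psi n).1 (psi n).2) r.
  move=> HC Ci0 CiC; apply: norm_leW (comp_norm p1 p2 r0' rB0 IH1 IH2 HC).
  rewrite exprMn mulrA; apply: (@le_trans _ _ (D * r ^+ 2)).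
    by rewrite ler_wpM2r ?exprn_ge0 // ler_wpM2r // exprn_ge0 // ltW.
  by rewrite expr2 mulrA [D * r]mulrC ler_piMl.
have n1 : norm_le r r (x - comp H1 (psi n).1 (psi n).2 : O) (r + r).
  apply: (norm_leD r0' r0' nx (norm_leN _)); apply: (nH _ C1) => //; first by apply: s1; rewrite rB0.
  by rewrite /C -addrA lerDl addr_ge0.
have n2 : norm_le r r (y - comp H2 (psi n).1 (psi n).2 : O) (r + r).
  apply: (norm_leD r0' r0' ny (norm_leN _)); apply: (nH _ C2) => //; first by apply: s2; rewrite rB0.
  by rewrite /C addrAC lerDr addr_ge0.
have final (a b : K) (h1 h2 : O) : `|a| <= c -> `|b| <= c -> norm_le r r h1 (r + r) -> norm_le r r h2 (r + r) ->
    norm_le r r (cst a * h1 + cst b * h2 : O) (B * r).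
  have nc (d : K) : norm_le r r (cst d : O) `|d|.
    by have := norm_le_mono d 0 0 r0' r0'; rewrite !expr0 !mulr1.
  move=> ac bc h1r h2r; apply: norm_leW (norm_leD r0' r0' (norm_leM r0' r0' (nc a) h1r) (norm_leM r0' r0' (nc b) h2r)).
  rewrite -mulrDl (_ : B * r = (c + c) * (r + r)); last by rewrite /B; ring.
  by rewrite ler_wpM2r ?addr_ge0 // lerD.
have [c00 c01 c10 c11] : [/\ `|A00| <= c, `|A01| <= c, `|A10| <= c & `|A11| <= c].
  rewrite /c; split.
  - by rewrite -!addrA lerDl !addr_ge0.
  - by rewrite [`|A00| + _]addrC -!addrA lerDl !addr_ge0.
  - by rewrite [_ + `|A10|]addrC -!addrA lerDl !addr_ge0.
  - by rewrite [_ + `|A11|]addrC -!addrA lerDl !addr_ge0.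
by split; rewrite /psi iterS /step /=; exact: final.
Qed.

(** Each coefficient of the iterates becomes stationary, and the uniform bound makes the formal
    limit convergent. *)
Lemma fixed_point : exists u v : O, [/\ ordge 1 u, ordge 1 v,
  u = cst A00 * (x - comp H1 u v) + cst A01 * (y - comp H2 u v) &
  v = cst A10 * (x - comp H1 u v) + cst A11 * (y - comp H2 u v)].
Proof.
have [r [B [r0 B0 bound]]] := psi_bound.
have stable i j n : (i + j <= n)%N ->
    (psi n).1 i j = (psi (i + j)).1 i j /\ (psi n).2 i j = (psi (i + j)).2 i j.
  by move=> /psi_stable[/(_ i j (leqnn _)) + /(_ i j (leqnn _))]; rewrite !cBE =>
    /eqP + /eqP; rewrite !subr_eq0 => /eqP -> /eqP ->.
have cu : conv (fun i j => (psi (i + j)).1 i j).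
  exists r, B; split=> // N; have [b1 _] := bound (N + N)%N; apply: le_trans (b1 N).
  by apply: ler_psum2 => i j iN jN; have [|-> _] // := stable i j (N + N)%N; lia.
have cv : conv (fun i j => (psi (i + j)).2 i j).
  exists r, B; split=> // N; have [_ b2] := bound (N + N)%N; apply: le_trans (b2 N).
  by apply: ler_psum2 => i j iN jN; have [|_ ->] // := stable i j (N + N)%N; lia.
pose w : O * O := (mk_cps cu, mk_cps cv).
have wpsi n : ordge n.+1 (w.1 - (psi n).1) /\ ordge n.+1 (w.2 - (psi n).2).
  by split=> i j ij; rewrite cBE; have [|e1 e2] := stable i j n; rewrite ?e1 ?e2 ?subrr //.
have w1 : ordge 1 w.1 /\ ordge 1 w.2.
  by have [e1 e2] := wpsi 0%N; rewrite !subr0 in e1 e2.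
have [w1o w2o] := w1.
have fix_eq : w.1 = (step w).1 /\ w.2 = (step w).2.
  have key (a b : O) : (forall n, ordge n.+2 (a - b)) -> a = b.
    move=> ab; apply/eqP; rewrite -subr_eq0; apply/eqP; apply: ordge0 => n.
    by apply: ordgeW (ab n); lia.
  have all n : ordge n.+2 (w.1 - (step w).1) /\ ordge n.+2 (w.2 - (step w).2).
    have [e1 e2] := wpsi n; have [p1 p2] := psi_ordge1 n.
    have [s1 s2] := step_congr (ltn0Sn n) w1o w2o p1 p2 e1 e2.
    have [t1 t2] := wpsi n.+1.
    have -> : w.1 - (step w).1 = (w.1 - (psi n.+1).1) - ((step w).1 - (step (psi n)).1).
      by rewrite /psi iterS; ring.
    have -> : w.2 - (step w).2 = (w.2 - (psi n.+1).2) - ((step w).2 - (step (psi n)).2).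
      by rewrite /psi iterS; ring.
    by split; apply: ordgeB.
  by split; apply: key => n; case: (all n).
by exists w.1, w.2; split=> //; case: fix_eq.
Qed.
End FixedPoint.

Lemma right_inverse (f g : O) : f 0%N 0%N = 0 -> g 0%N 0%N = 0 -> jac f g <> 0 ->
  exists u v : O, [/\ u 0%N 0%N = 0 /\ v 0%N 0%N = 0, jac u v <> 0,
    comp f u v = x & comp g u v = y].
Proof.
move=> f00 g00 J0.
pose lin (h : O) := cst (h 1%N 0%N) * x + cst (h 0%N 1%N) * y.
have linE (h : O) i j : lin h i j = if (i == 1%N) && (j == 0%N) then h 1%N 0%N else
    if (i == 0%N) && (j == 1%N) then h 0%N 1%N else 0.
  rewrite /lin cDE !cstM !cmonoE; case: i j => [|[|i]] [|[|j]] //=;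
    by rewrite ?mulr0 ?mulr1 ?addr0 ?add0r.
have ho (h : O) : h 0%N 0%N = 0 -> ordge 2 (h - lin h).
  move=> h00 i j; rewrite cBE linE; case: i j => [|[|i]] [|[|j]] //= _;
    by rewrite ?subrr ?subr0.
pose D := jac f g; have D0 : D != 0 by exact/eqP.
have [u [v [u1 v1 uE vE]]] := fixed_point (g 0%N 1%N / D) (- f 0%N 1%N / D)
  (- g 1%N 0%N / D) (f 1%N 0%N / D) (ho f f00) (ho g g00).
have [/ordge1 u0 /ordge1 v0] := (u1, v1).
have cE (h : O) : comp h u v = cst (h 1%N 0%N) * u + cst (h 0%N 1%N) * v + comp (h - lin h) u v.
  rewrite compB // /lin compD // !comp_cstM // comp_vx // comp_vy //; ring.
have cD (a b c d : K) : a * b + c * d = 1 -> cst a * cst b + cst c * cst d = 1 :> O.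
  by move=> e; rewrite -!rmorphM -rmorphD e rmorph1.
have cD0 (a b c d : K) : a * b + c * d = 0 -> cst a * cst b + cst c * cst d = 0 :> O.
  by move=> e; rewrite -!rmorphM -rmorphD e rmorph0.
have DE : D = f 1%N 0%N * g 0%N 1%N - f 0%N 1%N * g 1%N 0%N by [].
exists u, v; split=> //.
- have co (h : O) : h 0%N 0%N = 0 -> ordge 2 (comp (h - lin h) u v).
    by move=> h00; case: (comp_continuous u0 v0) => _ _; apply; exact: ho.
  have [c1 c2] := (co f f00, co g g00).
  have e (a b : K) i j : (i + j < 2)%N -> (cst a * (x - comp (f - lin f) u v) +
      cst b * (y - comp (g - lin g) u v) : O) i j = a * x i j + b * y i j.
    by move=> ij; rewrite cDE !cstM !cBE c1 // c2 // !subr0.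
  have u10 : u 1%N 0%N = g 0%N 1%N / D by rewrite {1}uE e // !cmonoE /= mulr0 mulr1 addr0.
  have u01 : u 0%N 1%N = - f 0%N 1%N / D by rewrite {1}uE e // !cmonoE /= mulr0 mulr1 add0r.
  have v10 : v 1%N 0%N = - g 1%N 0%N / D by rewrite {1}vE e // !cmonoE /= mulr0 mulr1 addr0.
  have v01 : v 0%N 1%N = f 1%N 0%N / D by rewrite {1}vE e // !cmonoE /= mulr0 mulr1 add0r.
  rewrite /jac u10 u01 v10 v01.
  rewrite (_ : _ - _ = D^-1); first by apply/eqP; rewrite invr_eq0.
  transitivity ((f 1%N 0%N * g 0%N 1%N - f 0%N 1%N * g 1%N 0%N) * (D^-1 * D^-1)); first by ring.
  by rewrite -DE mulrA mulfV // mul1r.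
- rewrite cE; move: uE vE; set c1 := comp (f - _) u v; set c2 := comp (g - _) u v => -> ->.
  set h1 := x - c1; set h2 := y - c2.
  have -> : cst (f 1%N 0%N) * (cst (g 0%N 1%N / D) * h1 + cst (- f 0%N 1%N / D) * h2) +
    cst (f 0%N 1%N) * (cst (- g 1%N 0%N / D) * h1 + cst (f 1%N 0%N / D) * h2) =
    (cst (f 1%N 0%N) * cst (g 0%N 1%N / D) + cst (f 0%N 1%N) * cst (- g 1%N 0%N / D)) * h1 +
    (cst (f 1%N 0%N) * cst (- f 0%N 1%N / D) + cst (f 0%N 1%N) * cst (f 1%N 0%N / D)) * h2 by ring.
  rewrite cD; last by apply: (mulIf D0); rewrite mul1r mulrDl !mulrA !divfK // DE; ring.
  rewrite cD0; last by apply: (mulIf D0); rewrite mul0r mulrDl !mulrA !divfK //; ring.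
  by rewrite /h1; ring.
- rewrite cE; move: uE vE; set c1 := comp (f - _) u v; set c2 := comp (g - _) u v => -> ->.
  set h1 := x - c1; set h2 := y - c2.
  have -> : cst (g 1%N 0%N) * (cst (g 0%N 1%N / D) * h1 + cst (- f 0%N 1%N / D) * h2) +
    cst (g 0%N 1%N) * (cst (- g 1%N 0%N / D) * h1 + cst (f 1%N 0%N / D) * h2) =
    (cst (g 1%N 0%N) * cst (g 0%N 1%N / D) + cst (g 0%N 1%N) * cst (- g 1%N 0%N / D)) * h1 +
    (cst (g 1%N 0%N) * cst (- f 0%N 1%N / D) + cst (g 0%N 1%N) * cst (f 1%N 0%N / D)) * h2 by ring.
  rewrite cD0; last by apply: (mulIf D0); rewrite mul0r mulrDl !mulrA !divfK //; ring.
  rewrite cD; last by apply: (mulIf D0); rewrite mul1r mulrDl !mulrA !divfK // DE; ring.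
  by rewrite /h2; ring.
Qed.

(** The right inverse has a right inverse in turn, which is (f, g) by associativity; so it is
    two-sided. *)
Lemma inverse_function (f g : O) : f 0%N 0%N = 0 -> g 0%N 0%N = 0 -> jac f g <> 0 ->
  exists u v : O, [/\ u 0%N 0%N = 0 /\ v 0%N 0%N = 0,
    comp f u v = x /\ comp g u v = y & comp u f g = x /\ comp v f g = y].
Proof.
move=> f0 g0 J; have [u [v [[u0 v0] Juv fE gE]]] := right_inverse f0 g0 J.
have [f' [g' [[f'0 g'0] _ uE vE]]] := right_inverse u0 v0 Juv.
have ff' : f' = f.
  have := comp_assoc f u0 v0 f'0 g'0; rewrite fE uE vE comp_id comp_vx //.
have gg' : g' = g.
  have := comp_assoc g u0 v0 f'0 g'0; rewrite gE uE vE comp_id comp_vy //.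
by exists u, v; split=> //; rewrite -ff' -gg'.
Qed.
End InverseFunction.

(** * Solving the linearization equation *)

Section Linearization.
Variable K : numFieldType.
Notation O := (cps K).
Notation x := (vx K).
Notation y := (vy K).

Lemma norm_comb_le (P A B : K) (k l Q : nat) : (k <= Q)%N -> (l <= Q)%N -> (0 < Q)%N ->
  `|P - A * k%:R - B * l%:R| <= (`|P| + `|A| + `|B|) * Q%:R.
Proof.
move=> kQ lQ Q0; have bnd (C : K) (c : nat) : (c <= Q)%N -> `|C * c%:R| <= `|C| * Q%:R.
  by move=> cQ; rewrite normrM normr_nat ler_wpM2l // ler_nat.
apply: le_trans (ler_normB _ _) _; rewrite [leRHS]mulrDl lerD ?bnd //.
apply: le_trans (ler_normB _ _) _; rewrite [leRHS]mulrDl lerD ?bnd //.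
by rewrite ler_peMr // ler1n.
Qed.

(** With a' and b' the non-constant parts of a and b, the coefficient v_ij times s (m i + n j) is a
    sum of terms (p - k a' - l b') v_kl of lower degree. The divisor m i + n j dominates k and l, so
    it absorbs the factors created by the derivation. *)
Lemma diagonal_solve (a b p : O) (s : K) (m n : nat) : s <> 0 -> (0 < m)%N -> (0 < n)%N ->
  a 0%N 0%N = s * m%:R -> b 0%N 0%N = s * n%:R -> p 0%N 0%N = 0 ->
  exists v : O, v 0%N 0%N = 1 /\ a * (x * dX v) + b * (y * dY v) = p * v.
Proof.
move=> s0 m0 n0 aE bE p0.
have sub_cst (h : O) : exists h' : O, h' 0%N 0%N = 0 /\ h = h' + cst (h 0%N 0%N).
  by exists (h - cst (h 0%N 0%N)); rewrite cBE cst00 subrr subrK.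
have [a' [a'0 E1]] := sub_cst a; have [b' [b'0 E2]] := sub_cst b.
pose den i j : K := s * (m * i + n * j)%:R.
have mn_ge i j : (i + j <= m * i + n * j)%N by rewrite leq_add // leq_pmull.
have den0 i j : (0 < i + j)%N -> den i j != 0.
  move=> ij; rewrite mulf_neq0 ?pnatr_eq0; [by []|exact/eqP|].
  by rewrite -lt0n; apply: leq_trans ij (mn_ge i j).
pose T i j k l := if (k <= i)%N && (l <= j)%N then
   (p (i - k)%N (j - l)%N - a' (i - k)%N (j - l)%N * k%:R - b' (i - k)%N (j - l)%N * l%:R) / den i j
   else 0.
(* At (0, 0) the divisor [den] is 0, as is its inverse; the equation is void there because p, a', b'
   vanish at 0, and [g0] normalizes v(0) = 1. *)
pose g0 i j : K := if (i == 0)%N && (j == 0)%N then 1 else 0.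
have Ttri i j k l : T i j k l != 0 -> (l + 1 * k < j + 1 * i)%N.
  rewrite /T; case: ifP => [/andP[ki lj]|]; last by rewrite eqxx.
  have [eij|] := eqVneq (k + l)%N (i + j)%N; last by move=> ? _; lia.
  have -> : (i - k = 0)%N by lia. have -> : (j - l = 0)%N by lia.
  by rewrite p0 a'0 b'0 !mul0r !subr0 mul0r eqxx.
have [u uE] := linear_recursion (leqnn 1) g0 Ttri.
have abss : 0 < `|s| by rewrite normr_gt0; exact/eqP.
(* Three norms of at most |s| / 6, divided by |s|, give the contraction factor 1/2. *)
have eps0 : 0 < `|s| / 6 by rewrite divr_gt0.
have [r1 [r10 np]] := small_norm_eps p0 eps0.
have [r2 [r20 na]] := small_norm_eps a'0 eps0.
have [r3 [r30 nb]] := small_norm_eps b'0 eps0.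
have minp (t t' : K) : 0 < t -> 0 < t' -> exists t'', [/\ 0 < t'', t'' <= t & t'' <= t'].
  move=> t0 t'0; have /orP[le|le] := real_leVge (gtr0_real t0) (gtr0_real t'0).
    by exists t.
  by exists t'.
have [r4 [r40 r41 r42]] := minp _ _ r10 r20.
have [r [r0 rr4 rr3]] := minp _ _ r40 r30.
have r0' := ltW r0.
have {}np : norm_le r r p (`|s| / 6) by apply: np; rewrite r0' (le_trans rr4).
have {}na : norm_le r r a' (`|s| / 6) by apply: na; rewrite r0' (le_trans rr4).
have {}nb : norm_le r r b' (`|s| / 6) by apply: nb; rewrite r0'.
have w0 i j : 0 <= r ^+ i * r ^+ j by rewrite mulr_ge0 ?exprn_ge0.
have TM k l N : psum2 (fun i j => `|T i j k l| * (r ^+ i * r ^+ j)) N <= 2^-1 * (r ^+ k * r ^+ l).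
  pose h i j := (`|p i j| + `|a' i j| + `|b' i j|) * (r ^+ i * r ^+ j).
  have h0 i j : 0 <= h i j by rewrite mulr_ge0 // !addr_ge0.
  have hN N' : psum2 h N' <= `|s| / 2.
    have -> : `|s| / 2 = `|s| / 6 + `|s| / 6 + `|s| / 6 by field.
    apply: le_trans (lerD (lerD (np N') (na N')) (nb N')); rewrite -!psum2D.
    by apply: ler_psum2 => i j _ _; rewrite /h !mulrDl.
  apply: (@le_trans _ _ (psum2 (fun i j => if (k <= i)%N && (l <= j)%N
      then h (i - k)%N (j - l)%N else 0) N * (`|s|^-1 * (r ^+ k * r ^+ l)))); last first.
    apply: (@le_trans _ _ (`|s| / 2 * (`|s|^-1 * (r ^+ k * r ^+ l)))).
      apply: ler_wpM2r; first by apply: mulr_ge0; [rewrite invr_ge0|exact: w0].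
      by apply: le_trans (psum2_shift k l N h0) (hN N).
    rewrite le_eqVlt; apply/orP; left; apply/eqP; field; exact: lt0r_neq0.
  rewrite -psum2Zr; apply: ler_psum2 => i j _ _; rewrite /T.
  case: ifP => [/andP[ki lj]|_]; last by rewrite normr0 !mul0r.
  have es : r ^+ i = r ^+ k * r ^+ (i - k) by rewrite -exprD subnKC.
  have er : r ^+ j = r ^+ l * r ^+ (j - l) by rewrite -exprD subnKC.
  set P := p _ _; set A := a' _ _; set B := b' _ _.
  suff le : `|(P - A * k%:R - B * l%:R) / den i j| <= (`|P| + `|A| + `|B|) * `|s|^-1.
    apply: le_trans (ler_wpM2r (w0 i j) le) _.
    rewrite /h -/P -/A -/B es er le_eqVlt; apply/orP; left; apply/eqP; ring.
  clearbody P A B; have [e0|ij] := posnP (i + j).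
    move/eqP: e0; rewrite addn_eq0 => /andP[/eqP i0 /eqP j0].
    by rewrite /den i0 j0 !muln0 addn0 mulr0 invr0 mulr0 normr0 mulr_ge0 ?invr_ge0 // !addr_ge0.
  have -> : `|(P - A * k%:R - B * l%:R) / den i j| =
      `|P - A * k%:R - B * l%:R| / (m * i + n * j)%:R / `|s|.
    by rewrite normrM normfV /den normrM normr_nat invfM; ring.
  have mn0 := leq_trans ij (mn_ge i j).
  rewrite ler_wpM2r ?invr_ge0 // ler_pdivrMr ?ltr0n //.
  have ki' : (k <= m * i + n * j)%N by apply: leq_trans ki (leq_trans (leq_addr _ _) (mn_ge i j)).
  have lj' : (l <= m * i + n * j)%N by apply: leq_trans lj (leq_trans (leq_addl _ _) (mn_ge i j)).
  exact: norm_comb_le.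
have gM : norm_le r r g0 1.
  move=> N; apply: le_trans (norm_le_cst1 r0' N); apply: ler_psum2 => i j _ _.
  by rewrite ler_wpM2r // /g0 [X in _ <= `|X|]c1E; case: ifP.
have uM := linear_recursion_bound Ttri r0' r0' uE gM TM.
pose v : O := mk_cps (conv_aniso r0 r0 uM).
have v00 : v 0%N 0%N = 1.
  by rewrite [LHS](uE _ _ 0%N) // /psum2 big_ord0 addr0.
exists v; split=> //; apply: cps_ext => i j.
pose N := (i + j).+1.
have iN : (i < N)%N by rewrite ltnS leq_addr.
have jN : (j < N)%N by rewrite ltnS leq_addl.
have xd k l : (x * dX v : O) k l = k%:R * v k l.
  by rewrite vxM; case: k => [|k]; rewrite ?mul0r ?dXE.
have yd k l : (y * dY v : O) k l = l%:R * v k l.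
  by rewrite vyM; case: l => [|l]; rewrite ?mul0r ?dYE.
have box (f g : O) : (f * g : O) i j = psum2 (fun k l => if (k <= i)%N && (l <= j)%N then
    g k l * f (i - k)%N (j - l)%N else 0) N.
  by rewrite mulrC; exact: (@psME_box _ (cf g) (cf f)).
apply/eqP; rewrite -subr_eq0; apply/eqP.
rewrite E1 E2 !mulrDl !cDE !cstM xd yd aE bE !box.
have uij : u i j = g0 i j + psum2 (fun k l => T i j k l * u k l) N.
  by apply: uE; rewrite mul1n addnC; exact: leqnSn.
have Tsum : den i j * psum2 (fun k l => T i j k l * u k l) N =
  psum2 (fun k l => if (k <= i)%N && (l <= j)%N then v k l * p (i - k)%N (j - l)%N else 0) N
  - psum2 (fun k l => if (k <= i)%N && (l <= j)%N then
      (x * dX v : O) k l * a' (i - k)%N (j - l)%N else 0) N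
  - psum2 (fun k l => if (k <= i)%N && (l <= j)%N then
      (y * dY v : O) k l * b' (i - k)%N (j - l)%N else 0) N.
  rewrite -psum2Zl -!psum2B; apply: eq_psum2 => k l _ _; rewrite /T xd yd.
  case: ifP => [/andP[ki lj]|_]; last by rewrite !mul0r mulr0 !subr0.
  have [e0|ij] := posnP (i + j); last first.
    rewrite -[u k l]/(v k l); move: (den0 i j ij).
    by move: (den i j) (p _ _) (a' _ _) (b' _ _) (v k l) => d P A B V d0; field.
  move/eqP: e0; rewrite addn_eq0 => /andP[/eqP i0 /eqP j0].
  move: ki lj; rewrite i0 j0 !leqn0 => /eqP -> /eqP ->.
  rewrite !subnn p0 a'0 b'0 !mulr0 !subr0 /den !muln0 mulr0 mul0r //.
have key : den i j * u i j = den i j * psum2 (fun k l => T i j k l * u k l) N.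
  rewrite uij mulrDr /g0; case: ifP => [/andP[/eqP -> /eqP ->]|_]; last by rewrite mulr0 add0r.
  by rewrite /den !muln0 mulr0 mul0r add0r.
rewrite Tsum in key; rewrite -[v i j]/(u i j); move: key; rewrite /den natrD !natrM.
set S1 := psum2 _ N; set S2 := psum2 _ N; set S3 := psum2 _ N => key.
have -> : S1 = s * (m%:R * i%:R + n%:R * j%:R) * u i j + S2 + S3 by rewrite key; ring.
ring.
Qed.
End Linearization.

(** * Linearized fields and their centralizers *)

Section LinearizedField.
Variable K : numFieldType.
Notation O := (cps K).
Variable X : O * O.
Hypotheses (X1_0 : X.1 0%N 0%N = 0) (X2_0 : X.2 0%N 0%N = 0).

Lemma coef10M (f g : O) : f 0%N 0%N = 0 -> (f * g : O) 1%N 0%N = f 1%N 0%N * g 0%N 0%N.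
Proof. by move=> f0; rewrite -dX00 dXM cDE !cM00 f0 mul0r addr0 dX00. Qed.
Lemma coef01M (f g : O) : f 0%N 0%N = 0 -> (f * g : O) 0%N 1%N = f 0%N 1%N * g 0%N 0%N.
Proof. by move=> f0; rewrite -dY00 dYM cDE !cM00 f0 mul0r addr0 dY00. Qed.

(** A unit w with X(w) = (s m - a) w turns the eigenvalue a of f into the constant s m for f w. In
    the chart (f, g) this is the equation of [diagonal_solve]. *)
Lemma linearize (f g a b : O) (s : K) (m n : nat) : f 0%N 0%N = 0 -> g 0%N 0%N = 0 ->
  jac f g <> 0 -> der X f = a * f -> der X g = b * g ->
  s <> 0 -> (0 < m)%N -> (0 < n)%N -> a 0%N 0%N = s * m%:R -> b 0%N 0%N = s * n%:R ->
  exists u v : O, [/\ u 0%N 0%N = 0 /\ v 0%N 0%N = 0, jac u v <> 0,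
    der X u = cst (s * m%:R) * u & der X v = cst (s * n%:R) * v].
Proof.
move=> f0 g0 J Xf Xg s0 m0 n0 a0 b0.
have [p [q [[p0 q0] [fE gE] [pE qE]]]] := inverse_function f0 g0 J.
have back (h : O) : comp (comp h p q) f g = h by rewrite comp_assoc // pE qE comp_id.
have solve (c : O) : c 0%N 0%N = 0 -> exists w : O, w 0%N 0%N = 1 /\ der X w = c * w.
  move=> c0; have [|||w [w0 wE]] := @diagonal_solve _ (comp a p q) (comp b p q) (comp c p q) s m n s0 m0 n0.
  - by rewrite comp00.
  - by rewrite comp00.
  - by rewrite comp00.
  exists (comp w f g); split; first by rewrite comp00.
  rewrite (der_comp w f0 g0 X1_0 X2_0 Xf Xg) -{1}(back a) -{1}(back b) -!compM // -compD // wE.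
  by rewrite compM // back.
have [|w1 [w10 w1E]] := solve (cst (s * m%:R) - a); first by rewrite cBE cst00 a0 subrr.
have [|w2 [w20 w2E]] := solve (cst (s * n%:R) - b); first by rewrite cBE cst00 b0 subrr.
exists (f * w1), (g * w2); split.
- by rewrite !cM00 f0 g0 !mul0r.
- by rewrite /jac !coef10M // !coef01M // w10 w20 !mulr1.
- by rewrite derM Xf w1E; ring.
- by rewrite derM Xg w2E; ring.
Qed.

Variables (u v : O) (l1 l2 : K).
Hypotheses (u0 : u 0%N 0%N = 0) (v0 : v 0%N 0%N = 0) (J : jac u v <> 0)
  (Xu : der X u = cst l1 * u) (Xv : der X v = cst l2 * v).

Lemma chart_unit : (dX u * dY v - dY u * dX v) 0%N 0%N <> 0.
Proof. by rewrite cBE !cM00 !dX00 !dY00. Qed.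

Lemma chart_field_eq (Y Z : O * O) : der Y u = der Z u -> der Y v = der Z v -> Y = Z.
Proof.
move=> eu ev; have [d dE] := unit_inv chart_unit.
have key (a b : O) : a = d * (dX u * dY v - dY u * dX v) * a -> b = d * (dX u * dY v - dY u * dX v) * b ->
    True by [].
have E1 (W : O * O) : W.1 = d * (der W u * dY v - der W v * dY u).
  by rewrite -[LHS]mul1r -dE /der; ring.
have E2 (W : O * O) : W.2 = d * (der W v * dX u - der W u * dX v).
  by rewrite -[LHS]mul1r -dE /der; ring.
by rewrite [Y]surjective_pairing [Z]surjective_pairing (E1 Y) (E2 Y) (E1 Z) (E2 Z) eu ev.
Qed.

(** Cramer's rule gives a field with prescribed values on u and v, and [X, Y] kills u and v when
    these values are eigenfunctions for l1 and l2. *)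
Lemma chart_field (w1 w2 : O) : der X w1 = cst l1 * w1 -> der X w2 = cst l2 * w2 ->
  exists Y, [/\ commute X Y, der Y u = w1 & der Y v = w2].
Proof.
move=> Xw1 Xw2; have [d dE] := unit_inv chart_unit.
pose Y : O * O := (d * (dY v * w1 - dY u * w2), d * (dX u * w2 - dX v * w1)).
have Yu : der Y u = w1.
  by rewrite -[RHS]mul1r -dE /der /=; ring.
have Yv : der Y v = w2.
  by rewrite -[RHS]mul1r -dE /der /=; ring.
exists Y; split=> //; apply/commuteP; apply: chart_field_eq.
  rewrite der_brk Yu Xu der_cstM Yu Xw1 subrr /der /=; ring.
rewrite der_brk Yv Xv der_cstM Yv Xw2 subrr /der /=; ring.
Qed.

(** The coefficients of f as a series in u and v, where X is l1 u d/du + l2 v d/dv: an eigenfunction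
    has only resonant monomials. *)
Lemma eigenfunction_coef : exists coef : O -> nat -> nat -> K, [/\
  forall f g (k : K) i j, coef (f + cst k * g) i j = coef f i j + k * coef g i j,
  forall f, (forall i j, coef f i j = 0) -> f = 0 &
  forall f (l : K) i j, der X f = cst l * f -> coef f i j <> 0 -> l1 * i%:R + l2 * j%:R = l].
Proof.
have [p [q [[p0 q0] [uE vE] [pE qE]]]] := inverse_function u0 v0 J.
exists (fun f => comp f p q); split.
- by move=> f g k i j; rewrite compD // comp_cstM // cDE cstM.
- move=> f f0; have : comp f p q = 0 by apply: cps_ext => i j; rewrite f0 c0E.
  move=> /(congr1 (fun h => comp h u v)); rewrite comp_assoc // pE qE comp_id.
  by rewrite (comp0 u0 v0).
move=> f l i j Xf Wij; pose W := comp f p q.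
have fW : f = comp W u v by rewrite comp_assoc // pE qE comp_id.
have E : cst l1 * (vx K * dX W) + cst l2 * (vy K * dY W) = cst l * W.
  rewrite -[RHS](comp_id) -uE -vE -comp_assoc // comp_cstM // -fW -Xf {1}fW.
  rewrite (der_comp W u0 v0 X1_0 X2_0 Xu Xv) -!(comp_cstM u0 v0) -(compD u0 v0).
  by rewrite comp_assoc // uE vE comp_id.
have := congr1 (fun h : O => h i j) E; rewrite cDE !cstM vxM vyM => e.
apply: (mulIf (_ : W i j != 0)); first exact/eqP.
rewrite -e; case: i j {Wij e} => [|i] [|j]; rewrite ?dXE ?dYE; ring.
Qed.

Definition commuting_family m (Y : 'I_m -> O * O) :=
  (forall i, commute X (Y i)) /\
  forall c : 'I_m -> K, \sum_i cst (c i) * (Y i).1 = 0 -> \sum_i cst (c i) * (Y i).2 = 0 ->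
    forall i, c i = 0.

Lemma der_sum m (Y : 'I_m -> O * O) (c : 'I_m -> K) g :
  der (\sum_i cst (c i) * (Y i).1, \sum_i cst (c i) * (Y i).2) g = \sum_i cst (c i) * der (Y i) g.
Proof.
rewrite /der /= !mulr_suml -big_split /=; apply: eq_bigr => i _; ring.
Qed.

(** A commuting field is determined by the resonant coefficients of Y(u), indexed by [L1], and of
    Y(v), indexed by [L2]. *)
Lemma commuting_family_bound m (Y : 'I_m -> O * O) (L1 L2 : seq (nat * nat)) :
  (forall i j, l1 * i%:R + l2 * j%:R = l1 -> (i, j) \in L1) ->
  (forall i j, l1 * i%:R + l2 * j%:R = l2 -> (i, j) \in L2) ->
  commuting_family Y -> (m <= size L1 + size L2)%N.
Proof.
move=> R1 R2 [XY ind]; rewrite leqNgt; apply/negP => lt.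
have [coef [cL c0 cR]] := eigenfunction_coef.
pose jet (i : 'I_m) : 'rV[K]_(size L1 + size L2) := row_mx
  (\row_k coef (der (Y i) u) (nth (0, 0)%N L1 k).1 (nth (0, 0)%N L1 k).2)
  (\row_k coef (der (Y i) v) (nth (0, 0)%N L2 k).1 (nth (0, 0)%N L2 k).2).
have [c [[i0 ci0] cs]] := linear_dependence jet lt.
have coef0 i j : coef 0 i j = 0.
  have := cL 0 0 1 i j; rewrite rmorph1 mul1r addr0 mul1r => /eqP.
  by rewrite -subr_eq0 opprD addrA subrr sub0r oppr_eq0 => /eqP.
have csum g i j : coef (\sum_k cst (c k) * g k) i j = \sum_(k < m) c k * coef (g k) i j.
  elim/big_rec2: _ => [|k z w _ <-]; first exact: coef0.
  by rewrite addrC cL addrC.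
pose Z := (\sum_i cst (c i) * (Y i).1, \sum_i cst (c i) * (Y i).2).
have XZ g l : der X g = cst l * g -> der X (der Z g) = cst l * der Z g.
  move=> Xg; rewrite der_sum raddf_sum mulr_sumr; apply: eq_bigr => i _.
  by rewrite /= der_cstM der_comm // Xg der_cstM; ring.
have Zu : der Z u = 0.
  apply: c0 => i j; apply: contrapT => nz; apply: (nz).
  have := R1 _ _ (cR _ _ _ _ (XZ _ _ Xu) nz) => /(nthP (0, 0)%N)[k kL e].
  have := congr1 (fun w : 'rV[K]_(size L1 + size L2) => w 0 (lshift _ (Ordinal kL))) cs.
  rewrite summxE mxE der_sum csum => e'; rewrite -[RHS]e'; apply: eq_bigr => k' _.
  by rewrite mxE row_mxEl mxE /= e.
have Zv : der Z v = 0.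
  apply: c0 => i j; apply: contrapT => nz; apply: (nz).
  have := R2 _ _ (cR _ _ _ _ (XZ _ _ Xv) nz) => /(nthP (0, 0)%N)[k kL e].
  have := congr1 (fun w : 'rV[K]_(size L1 + size L2) => w 0 (rshift _ (Ordinal kL))) cs.
  rewrite summxE mxE der_sum csum => e'; rewrite -[RHS]e'; apply: eq_bigr => k' _.
  by rewrite mxE row_mxEr mxE /= e.
have Z0 : Z = (0, 0).
  by apply: chart_field_eq; rewrite ?Zu ?Zv /der /=; ring.
case: Z0 => Z1 Z2; apply: ci0; exact: ind.
Qed.

Lemma chart_independent (a b : K) : cst a * u + cst b * v = 0 -> a = 0 /\ b = 0.
Proof.
move=> e; have e1 := congr1 (fun f : O => f 1%N 0%N) e; have e2 := congr1 (fun f : O => f 0%N 1%N) e.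
rewrite cDE !cstM c0E in e1; rewrite cDE !cstM c0E in e2; move/eqP: J; rewrite /jac => J'.
split; apply: (mulIf J'); rewrite mul0r.
  rewrite [LHS](_ : _ = (a * u 1%N 0%N + b * v 1%N 0%N) * v 0%N 1%N -
    (a * u 0%N 1%N + b * v 0%N 1%N) * v 1%N 0%N); last by ring.
  by rewrite e1 e2 !mul0r subr0.
rewrite [LHS](_ : _ = (a * u 0%N 1%N + b * v 0%N 1%N) * u 1%N 0%N -
  (a * u 1%N 0%N + b * v 1%N 0%N) * u 0%N 1%N); last by ring.
by rewrite e1 e2 !mul0r subr0.
Qed.

(** The linear fields u d/du, v d/du, u d/dv and v d/dv. *)
Lemma commuting_family4 : l1 = l2 -> exists Y : 'I_4 -> O * O, commuting_family Y.
Proof.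
move=> l12; have X0 (l : K) : der X 0 = cst l * 0 by rewrite raddf0 mulr0.
have Xv' : der X v = cst l1 * v by rewrite l12.
have Xu' : der X u = cst l2 * u by rewrite -l12.
have [Y0 [c0 u_0 v_0]] := chart_field Xu (X0 l2).
have [Y1 [c1 u_1 v_1]] := chart_field Xv' (X0 l2).
have [Y2 [c2 u_2 v_2]] := chart_field (X0 l1) Xu'.
have [Y3 [c3 u_3 v_3]] := chart_field (X0 l1) Xv.
pose Y (i : 'I_4) := nth (0, 0) [:: Y0; Y1; Y2; Y3] i.
have big4 (F : 'I_4 -> O) : \sum_i F i = F (inord 0) + F (inord 1) + F (inord 2) + F (inord 3).
  rewrite !big_ord_recl big_ord0 addr0 !addrA.
  by congr (F _ + F _ + F _ + F _); apply: val_inj; rewrite /= inordK.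
exists Y; split.
  by case=> [[|[|[|[|i]]]] lti]; rewrite /Y.
move=> c e1 e2.
have Zg g : \sum_i cst (c i) * der (Y i) g = 0.
  by rewrite -der_sum e1 e2 /der /=; ring.
have Y4 i : (i < 4)%N -> Y (inord i) = nth (0, 0) [:: Y0; Y1; Y2; Y3] i by move=> i4; rewrite /Y inordK.
have := Zg u; rewrite big4 !Y4 //= u_0 u_1 u_2 u_3 !mulr0 !addr0 => /chart_independent[c0' c1'].
have := Zg v; rewrite big4 !Y4 //= v_0 v_1 v_2 v_3 !mulr0 !add0r => /chart_independent[c2' c3'].
have inordE (i : 'I_4) : c i = c (inord i) by rewrite inord_val.
by case=> [[|[|[|[|i]]]] lti] //; rewrite inordE.
Qed.
End LinearizedField.

(** p divides q j, hence j; a nonzero j would give q j >= 2 p. *)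
Lemma resonance_coprime p q i j : (1 < p)%N -> (1 < q)%N -> coprime p q ->
  (p * i + q * j = p)%N -> (i, j) \in [:: (1, 0)]%N.
Proof.
move=> p1 q1 pq e; have pj : (p %| j)%N.
  rewrite -(Gauss_dvdr j pq); have := dvdnn p; rewrite -{2}e dvdn_addr //; exact: dvdn_mulr.
case/dvdnP: pj => k jE; case: k jE => [|k] jE.
  rewrite mul0n in jE; move: e; rewrite jE muln0 addn0 -{2}[p]muln1 => /eqP.
  rewrite eqn_pmul2l ?(ltnW p1) // => /eqP ->; exact: mem_head.
have : (2 * p <= q * j)%N by rewrite jE leq_mul // mulSn leq_addr.
lia.
Qed.

Lemma resonance_1n n i j : (1 < n)%N -> (1 * i + n * j = 1)%N -> (i, j) \in [:: (1, 0)]%N.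
Proof.
move=> n1; case: j => [|j]; first by rewrite mul1n muln0 addn0 => ->.
by rewrite mulnS; lia.
Qed.

Lemma resonance_n1 n i j : (0 < n)%N -> (1 * i + n * j = n)%N -> (i, j) \in [:: (n, 0); (0, 1)]%N.
Proof.
move=> n0; rewrite mul1n; case: j => [|[|j]].
- by rewrite muln0 addn0 => ->; exact: mem_head.
- rewrite muln1 => e; have -> : i = 0%N by lia.
  by rewrite !inE eqxx orbT.
- by rewrite !mulnS; lia.
Qed.

Lemma resonance_nat (K : numFieldType) (s : K) p q i j r : s <> 0 ->
  s * p%:R * i%:R + s * q%:R * j%:R = s * r%:R -> (p * i + q * j = r)%N.
Proof.
move=> /eqP s0 e; apply/eqP; rewrite -(eqr_nat K) natrD !natrM.
by apply/eqP; apply: (mulfI s0); rewrite mulrDr !mulrA.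
Qed.

(** * Classification of the linearized fields by their centralizers *)

Section Classification.
Variable K : numClosedFieldType.
Notation O := (cps K).
Variable X : O * O.
Hypotheses (X_coprime : coprime_germs X.1 X.2)
  (X1_0 : X.1 0%N 0%N = 0) (X2_0 : X.2 0%N 0%N = 0).
Variable F : nat -> O.
Hypotheses (F_irred : forall j, irred (F j)) (F_inv : forall j, dvd (F j) (der X (F j)))
  (F_distinct : forall i j, i <> j -> ~ dvd (F i) (F j)).

(** The kernel of Y |-> X ^ Y is C.X, so three independent fields have an image of dimension at
    least 2. Otherwise each of the three pairs of fields would have a nontrivial combination in
    C.X. *)
Lemma family_independent_pair (Y : 'I_3 -> O * O) : commuting_family X Y ->
  exists h1 h2, [/\ inV X h1, inV X h2 & independent h1 h2].
Proof.
move=> [XY ind]; apply: contrapT => nex.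
have rel i j : exists a b k : K, (a, b) <> (0, 0) /\
    cst a * (Y i).1 + cst b * (Y j).1 = cst k * X.1 /\
    cst a * (Y i).2 + cst b * (Y j).2 = cst k * X.2.
  have [a [b [ab e]]] : exists a b : K, (a, b) <> (0, 0) /\
      cst a * wedge X (Y i) + cst b * wedge X (Y j) = 0.
    apply: contrapT => nab; apply: nex; exists (wedge X (Y i)), (wedge X (Y j)); split.
    - by exists (Y i).
    - by exists (Y j).
    - move=> a b e; have [[-> ->]//|ne] := pselect ((a, b) = (0, 0)).
      by exfalso; apply: nab; exists a, b.
  pose Z : O * O := (cst a * (Y i).1 - cst (- b) * (Y j).1, cst a * (Y i).2 - cst (- b) * (Y j).2).
  have XaY (c : K) l : commute X (cst c * (Y l).1, cst c * (Y l).2).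
    by case: (XY l) => e1 e2; split; rewrite /= der_cstM ?e1 ?e2 /der /=; ring.
  have XZ : commute X Z by exact: (commute_comb (- b) (XaY a i) (XY j)).
  have [|k ZE] := wedge0_proportional X_coprime X2_0 F_irred F_inv F_distinct XZ.
    by rewrite -[RHS]e /wedge /Z /= rmorphN; ring.
  have Z1 : Z.1 = cst k * X.1 by rewrite ZE.
  have Z2 : Z.2 = cst k * X.2 by rewrite ZE.
  by exists a, b, k; rewrite -Z1 -Z2 /Z rmorphN /=; split=> //; split; ring.
pose i0 : 'I_3 := inord 0; pose i1 : 'I_3 := inord 1; pose i2 : 'I_3 := inord 2.
have big3 (G : 'I_3 -> O) : \sum_i G i = G i0 + G i1 + G i2.
  rewrite !big_ord_recl big_ord0 addr0 !addrA.
  by congr (G _ + G _ + G _); apply: val_inj; rewrite /= inordK.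
have lin (c0 c1 c2 : K) : cst c0 * (Y i0).1 + cst c1 * (Y i1).1 + cst c2 * (Y i2).1 = 0 ->
    cst c0 * (Y i0).2 + cst c1 * (Y i1).2 + cst c2 * (Y i2).2 = 0 -> [/\ c0 = 0, c1 = 0 & c2 = 0].
  pose c (i : 'I_3) := nth 0 [:: c0; c1; c2] i.
  have [C0 C1 C2] : [/\ c i0 = c0, c i1 = c1 & c i2 = c2] by rewrite /c /i0 /i1 /i2 !inordK.
  move=> e1 e2; rewrite -C0 -C1 -C2.
  by split; apply: ind; rewrite big3 C0 C1 C2.
have [a0 [a1 [k [ane [A1 A2]]]]] := rel i0 i1.
have [b0 [b2 [l [bne [B1 B2]]]]] := rel i0 i2.
have [c1 [c2 [m [cne [C1 C2]]]]] := rel i1 i2.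
(* X is eliminated between two of these combinations; the relation obtained between the Y's is
   trivial. *)
have [||_ la1 _] := lin (l * a0 - k * b0) (l * a1) (- (k * b2)).
- rewrite rmorphB rmorphN !rmorphM /= (_ : _ + _ = cst l * (cst a0 * (Y i0).1 + cst a1 * (Y i1).1) -
    cst k * (cst b0 * (Y i0).1 + cst b2 * (Y i2).1)); last by ring.
  by rewrite A1 B1; ring.
- rewrite rmorphB rmorphN !rmorphM /= (_ : _ + _ = cst l * (cst a0 * (Y i0).2 + cst a1 * (Y i1).2) -
    cst k * (cst b0 * (Y i0).2 + cst b2 * (Y i2).2)); last by ring.
  by rewrite A2 B2; ring.
have [||ma0 _ _] := lin (m * a0) (m * a1 - k * c1) (- (k * c2)).
- rewrite rmorphB rmorphN !rmorphM /= (_ : _ + _ = cst m * (cst a0 * (Y i0).1 + cst a1 * (Y i1).1) -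
    cst k * (cst c1 * (Y i1).1 + cst c2 * (Y i2).1)); last by ring.
  by rewrite A1 C1; ring.
- rewrite rmorphB rmorphN !rmorphM /= (_ : _ + _ = cst m * (cst a0 * (Y i0).2 + cst a1 * (Y i1).2) -
    cst k * (cst c1 * (Y i1).2 + cst c2 * (Y i2).2)); last by ring.
  by rewrite A2 C2; ring.
have nz (a b z : K) i j : (a, b) <> (0, 0) -> cst a * (Y i).1 + cst b * (Y j).1 = cst z * X.1 ->
    cst a * (Y i).2 + cst b * (Y j).2 = cst z * X.2 ->
    (forall p q : K, cst p * (Y i).1 + cst q * (Y j).1 = 0 ->
       cst p * (Y i).2 + cst q * (Y j).2 = 0 -> p = 0 /\ q = 0) -> z <> 0.
  move=> ne e1 e2 pq z0; apply: ne; have [||-> ->//] := pq a b.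
    by rewrite e1 z0 rmorph0 mul0r.
  by rewrite e2 z0 rmorph0 mul0r.
have k0 : k <> 0.
  apply: (nz _ _ _ _ _ ane A1 A2) => p q e1 e2.
  by have [||-> -> _] := lin p q 0; rewrite ?rmorph0 ?mul0r ?addr0.
have l0 : l <> 0.
  apply: (nz _ _ _ _ _ bne B1 B2) => p q e1 e2.
  by have [||-> _ ->] := lin p 0 q; rewrite ?rmorph0 ?mul0r ?addr0.
have m0 : m <> 0.
  apply: (nz _ _ _ _ _ cne C1 C2) => p q e1 e2.
  by have [||_ -> ->] := lin 0 p q; rewrite ?rmorph0 ?mul0r ?add0r.
apply: ane; congr (_, _).
  by move/eqP: ma0; rewrite mulf_eq0 => /orP[/eqP//|/eqP].
by move/eqP: la1; rewrite mulf_eq0 => /orP[/eqP//|/eqP].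
Qed.

(** The weights are made coprime. If both exceed 1, only u is resonant in Y(u) and only v in Y(v),
    which leaves no room for three fields; so one weight is 1, and its coordinate is called u. *)
Lemma classification (Y : 'I_3 -> O * O) : commuting_family X Y ->
  exists (u v : O) (s : K) n, [/\ u 0%N 0%N = 0 /\ v 0%N 0%N = 0, jac u v <> 0,
    s <> 0 /\ (0 < n)%N, der X u = cst s * u & der X v = cst (s * n%:R) * v].
Proof.
move=> XY; have [h1 [h2 [V1 V2 ind]]] := family_independent_pair XY.
have [f [g [a [b [s [e [e' [[f0 g0] J [Xf Xg] [s0 e0 e'0] [a0 b0]]]]]]]]] :=
  normal_crossing X_coprime X1_0 F_irred F_inv F_distinct V1 V2 ind.
have [u [v [[u0 v0] Juv Xu Xv]]] := linearize X1_0 X2_0 f0 g0 J Xf Xg s0 e'0 e0 a0 b0.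
pose d := gcdn e' e; have d0 : (0 < d)%N by rewrite gcdn_gt0 e'0.
pose p := (e' %/ d)%N; pose q := (e %/ d)%N.
have e'E : e' = (d * p)%N by rewrite mulnC divnK ?dvdn_gcdl.
have eE : e = (d * q)%N by rewrite mulnC divnK ?dvdn_gcdr.
have p0 : (0 < p)%N by move: e'0; rewrite e'E muln_gt0 d0.
have q0 : (0 < q)%N by move: e0; rewrite eE muln_gt0 d0.
have pq : coprime p q.
  by rewrite /coprime -(eqn_pmul2l d0) muln_gcdr -e'E -eE muln1.
pose s' : K := s * d%:R; have s'0 : s' <> 0.
  by apply/eqP; rewrite mulf_neq0 ?pnatr_eq0 -?lt0n //; exact/eqP.
have {}Xu : der X u = cst (s' * p%:R) * u by rewrite Xu e'E natrM /s' mulrA.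
have {}Xv : der X v = cst (s' * q%:R) * v by rewrite Xv eE natrM /s' mulrA.
have [p1|p1] := eqVneq p 1%N; first by exists u, v, s', q; rewrite Xu p1 mulr1.
have [q1|q1] := eqVneq q 1%N.
  exists v, u, s', p; split=> //; last by rewrite Xv q1 mulr1.
  move=> J0; apply: Juv; apply: oppr_inj; rewrite oppr0 -J0 /jac; ring.
have p2 : (1 < p)%N by rewrite ltn_neqAle eq_sym p1.
have q2 : (1 < q)%N by rewrite ltn_neqAle eq_sym q1.
exfalso; suff : (3 <= size [:: (1, 0)] + size [:: (0, 1)])%N by [].
apply: (commuting_family_bound X1_0 X2_0 u0 v0 Juv Xu Xv _ _ XY) => i j /(resonance_nat s'0).
  exact: resonance_coprime.
rewrite addnC; move=> /resonance_coprime; rewrite coprime_sym => /(_ q2 p2 pq).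
by rewrite !inE => /eqP[-> ->].
Qed.

Variables (u v : O) (s : K) (n : nat).
Hypotheses (u0 : u 0%N 0%N = 0) (v0 : v 0%N 0%N = 0) (J : jac u v <> 0) (s0 : s <> 0)
  (n0 : (0 < n)%N) (Xu : der X u = cst s * u) (Xv : der X v = cst (s * n%:R) * v).

Let Xu' : der X u = cst (s * 1%:R) * u. Proof. by rewrite mulr1. Qed.

Lemma family_size_nonradial m (Y : 'I_m -> O * O) : (1 < n)%N -> commuting_family X Y -> (m <= 3)%N.
Proof.
move=> n1 XY; apply: (@commuting_family_bound _ X X1_0 X2_0 u v _ _ u0 v0 J Xu' Xv m Y
  [:: (1, 0)] [:: (n, 0); (0, 1)] _ _ XY)%N => i j /(resonance_nat s0).
  exact: resonance_1n.
exact: resonance_n1.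
Qed.

Lemma family_size_radial m (Y : 'I_m -> O * O) : n = 1%N -> commuting_family X Y -> (m <= 4)%N.
Proof.
move=> n1 XY; have Xv1 : der X v = cst (s * 1%:R) * v by rewrite Xv n1.
apply: (@commuting_family_bound _ X X1_0 X2_0 u v _ _ u0 v0 J Xu' Xv1 m Y
  [:: (1, 0); (0, 1)] [:: (1, 0); (0, 1)] _ _ XY)%N => i j /(resonance_nat s0) /resonance_n1; exact.
Qed.

Lemma family_radial : n = 1%N -> exists Y : 'I_4 -> O * O, commuting_family X Y.
Proof.
by move=> n1; apply: (commuting_family4 J Xu Xv); rewrite n1 mulr1.
Qed.
End Classification.

(** * Germs of functions *)

Section Coefficients.
Variable K : numFieldType.
Implicit Types a b : cps K.
Lemma cfB a b : cf (a - b) = cf a + - cf b. Proof. by []. Qed.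
Lemma cfD a b : cf (a + b) = cf a + cf b. Proof. by []. Qed.
Lemma cfM a b : cf (a * b) = cf a * cf b. Proof. by []. Qed.
End Coefficients.

(** * Evaluation of convergent series *)

Section Evaluation.
Variable K : numClosedFieldType.
Notation O := (cps K).
Notation x := (vx K).
Notation y := (vy K).
Implicit Types (z : C2 K) (a b : O).

Lemma near0P (P : C2 K -> Prop) : (\forall z \near (0 : C2 K), P z) <->
  exists e : K, 0 < e /\ forall z, `|z.1| < e -> `|z.2| < e -> P z.
Proof.
split=> [/nbhs_ballP[e /= e0 eP]|[e [e0 eP]]].
  exists e; split=> // z z1 z2; apply: eP; split; rewrite -ball_normE /= sub0r normrN //.
apply/nbhs_ballP; exists e => //= z [z1 z2]; apply: eP.
  by move: z1; rewrite -ball_normE /= sub0r normrN.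
by move: z2; rewrite -ball_normE /= sub0r normrN.
Qed.

Definition tends (w : nat -> K) l :=
  forall e, 0 < e -> exists N0, forall N, (N0 <= N)%N -> `|l - w N| < e.

Lemma tendsP (w : nat -> K) l : w @ \oo --> l <-> tends w l.
Proof.
split=> [/cvgrPdist_lt wl e e0|wl].
  by have [N0 _ NP] := wl e e0; exists N0 => N; exact: NP.
by apply/cvgrPdist_lt => e e0; have [N0 NP] := wl e e0; exists N0.
Qed.

Lemma tends_le (w : nat -> K) l M : tends w l -> (forall N, `|w N| <= M) -> `|l| <= M.
Proof.
move=> wl wM; have M0 := le_trans (normr_ge0 _) (wM 0%N).
rewrite real_leNgt ?ger0_real //; apply/negP => Ml.
have e0 : 0 < `|l| - M by rewrite subr_gt0.
have [N /(_ N (leqnn _)) h] := wl _ e0.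
have : `|l| < `|l|.
  rewrite -{1}(subrK (w N) l); apply: le_lt_trans (ler_normD _ _) _.
  by rewrite -[X in _ < X](subrK M); apply: ltr_leD.
by rewrite ltxx.
Qed.

Lemma tends_unique (w : nat -> K) l l' : tends w l -> tends w l' -> l = l'.
Proof.
move=> wl wl'; apply/eqP; rewrite -subr_eq0 -normr_eq0; apply/eqP; apply: contrapT => /eqP nz.
have e0 : 0 < `|l - l'| by rewrite lt_def nz normr_ge0.
have e2 : 0 < `|l - l'| / 2 by rewrite divr_gt0.
have [N NP] := wl _ e2; have [N' NP'] := wl' _ e2.
have h := ltrD (NP (maxn N N') (leq_maxl _ _)) (NP' (maxn N N') (leq_maxr _ _)).
have : `|l - l'| < `|l - l'|.
  apply: le_lt_trans (_ : `|l - w (maxn N N')| + `|l' - w (maxn N N')| < _).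
    by rewrite (distrC l'); apply: le_trans (ler_normD _ _); rewrite addrA subrK.
  by rewrite [X in _ < X]splitr.
by rewrite ltxx.
Qed.

Lemma tendsB (w w' : nat -> K) l l' : tends w l -> tends w' l' -> tends (fun N => w N - w' N) (l - l').
Proof.
move=> wl wl' e e0; have e2 : 0 < e / 2 by rewrite divr_gt0.
have [N NP] := wl _ e2; have [N' NP'] := wl' _ e2.
exists (maxn N N') => n; rewrite geq_max => /andP[Nn N'n].
rewrite (splitr e) (_ : l - l' - _ = (l - w n) - (l' - w' n)); last by ring.
by apply: le_lt_trans (ler_normB _ _) _; rewrite ltrD ?NP ?NP'.
Qed.

Lemma tends_cst (w : nat -> K) l N0 : (forall N, (N0 <= N)%N -> w N = l) -> tends w l.
Proof. by move=> wl e e0; exists N0 => N /wl ->; rewrite subrr normr0. Qed.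

(** These two hypotheses are what summation of series needs from the complex numbers;
    [complex_archimedean] and [complex_complete] provide them, and [K] stays abstract. *)
Hypothesis archimedean : forall t : K, exists n : nat, `|t| < n%:R.
Hypothesis complete : forall w : nat -> K, (exists M : K, forall N, \sum_(i < N) `|w i| <= M) ->
  exists l, tends (fun N => \sum_(i < N) w i) l.

Definition term a z (j k : nat) : K := a j k * z.1 ^+ j * z.2 ^+ k.
Definition in_ball (r : K) z := `|z.1| <= r /\ `|z.2| <= r.

Lemma psum2_term_norm r M a z N : 0 <= r -> norm_le r r a M -> in_ball r z ->
  psum2 (fun j k => `|term a z j k|) N <= M.
Proof.
move=> r0 aM [z1 z2]; apply: le_trans (aM N); apply: ler_psum2 => j k _ _.
rewrite /term !normrM !normrX -mulrA ler_wpM2l // ler_pM ?exprn_ge0 //;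
  by rewrite lerXn2r ?nnegrE.
Qed.

Lemma psum2_widen (F : nat -> nat -> K) N N' : (N <= N')%N ->
  psum2 F N = psum2 (fun i j => if (i < N)%N && (j < N)%N then F i j else 0) N'.
Proof.
move=> NN'; rewrite /psum2 (big_ord_widen N' (fun i => \sum_(j < N) F i j)) // big_mkcond /=.
apply: eq_bigr => i _; case: ifP => iN; last by rewrite big1.
by rewrite (big_ord_widen N' (fun j => F i j)) // big_mkcond.
Qed.

Lemma psum2_diff_norm (F : nat -> nat -> K) N N' : (N <= N')%N ->
  `|psum2 F N' - psum2 F N| <= psum2 (fun i j => `|F i j|) N' - psum2 (fun i j => `|F i j|) N.
Proof.
move=> NN'; rewrite (psum2_widen F NN') (psum2_widen (fun i j => `|F i j|) NN') -!psum2B.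
apply: le_trans (psum2_norm _ _) _; apply: ler_psum2 => i j _ _.
by case: ifP => _; rewrite ?subrr ?normr0 ?subr0.
Qed.

(** [complete] concerns simple series, so the double sum is telescoped into the layers between
    consecutive boxes. *)
Lemma ev_ex r M a z : 0 <= r -> norm_le r r a M -> in_ball r z ->
  exists l, tends (fun N => psum2 (term a z) N) l.
Proof.
move=> r0 aM zr; pose w n := psum2 (term a z) n.+1 - psum2 (term a z) n.
have wE N : \sum_(i < N) w i = psum2 (term a z) N.
  elim: N => [|N IH]; first by rewrite /psum2 !big_ord0.
  by rewrite big_ord_recr /= IH /w addrC subrK.
have [|l lP] := @complete w; last by exists l; move=> e /lP[N0 NP]; exists N0 => N /NP; rewrite wE.
exists M => N; apply: le_trans (psum2_term_norm N r0 aM zr).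
elim: N => [|N IH]; first by rewrite /psum2 !big_ord0.
rewrite big_ord_recr /=; apply: le_trans (lerD IH (psum2_diff_norm _ (leqnSn N))) _.
by rewrite addrC subrK.
Qed.

(* The sum of the series a at z, with an arbitrary value where it diverges. *)
Lemma ev_sig : {f : C2 K -> O -> K | forall z a l, tends (fun N => psum2 (term a z) N) l -> f z a = l}.
Proof.
exists (fun z a => if pselect (exists l, tends (fun N => psum2 (term a z) N) l) is left h
  then projT1 (cid h) else 0) => z a l al.
case: pselect => [h|[]]; last by exists l.
by case: cid => l' /= /tends_unique; apply.
Qed.

Definition ev : C2 K -> O -> K := sval ev_sig.

Lemma ev_tends z a l : tends (fun N => psum2 (term a z) N) l -> ev z a = l.
Proof. exact: (svalP ev_sig). Qed.

Lemma evP r M a z : 0 <= r -> norm_le r r a M -> in_ball r z ->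
  tends (fun N => psum2 (term a z) N) (ev z a).
Proof. by move=> r0 aM zr; have [l h] := ev_ex r0 aM zr; rewrite (ev_tends h). Qed.

Lemma ev_norm r M a z : 0 <= r -> norm_le r r a M -> in_ball r z -> `|ev z a| <= M.
Proof.
move=> r0 aM zr; apply: tends_le (evP r0 aM zr) _ => N.
by apply: le_trans (psum2_norm _ _) _; exact: psum2_term_norm aM zr.
Qed.

Definition adm r a := 0 <= r /\ exists M, norm_le r r a M.

Lemma admB r a b : adm r a -> adm r b -> adm r (a - b).
Proof.
move=> [r0 [M aM]] [_ [M' bM]]; split=> //; exists (M + M'); rewrite /cc cfB.
by apply: norm_leD => //; exact: norm_leN.
Qed.
Lemma admD r a b : adm r a -> adm r b -> adm r (a + b).
Proof.
move=> [r0 [M aM]] [_ [M' bM]]; split=> //; exists (M + M'); rewrite /cc cfD.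
exact: norm_leD.
Qed.
Lemma admM r a b : adm r a -> adm r b -> adm r (a * b).
Proof.
move=> [r0 [M aM]] [_ [M' bM]]; split=> //; exists (M * M'); rewrite /cc cfM.
exact: norm_leM.
Qed.
Lemma norm_mono (r k : K) p q : 0 <= r -> norm_le r r (cst k * (x ^+ p * y ^+ q) : O) (`|k| * (r ^+ p * r ^+ q)).
Proof. by move=> r0; rewrite -cmonoX -cmono_cst; exact: norm_le_mono. Qed.
Lemma adm_mono r k p q : 0 <= r -> adm r (cst k * (x ^+ p * y ^+ q)).
Proof. by move=> r0; split=> //; exists (`|k| * (r ^+ p * r ^+ q)); exact: norm_mono. Qed.

Lemma evB r a b z : adm r a -> adm r b -> in_ball r z -> ev z (a - b) = ev z a - ev z b.
Proof.
move=> [r0 [M aM]] [_ [M' bM]] zr; apply: ev_tends.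
have h := tendsB (evP r0 aM zr) (evP r0 bM zr).
move=> e /h[N0 NP]; exists N0 => N /NP; rewrite -psum2B.
by under eq_psum2 => i j _ _ do rewrite /term -!mulrBl -cBE.
Qed.

Lemma ev_mono k p q z : ev z (cst k * (x ^+ p * y ^+ q)) = k * z.1 ^+ p * z.2 ^+ q.
Proof.
apply: ev_tends; apply: (@tends_cst _ _ (maxn p q).+1) => N; rewrite gtn_max => /andP[pN qN].
rewrite -cmonoX -cmono_cst (psum2_single pN qN) => [|i j ne]; rewrite /term cmonoE.
  by rewrite !eqxx.
by rewrite (negbTE ne) !mul0r.
Qed.

(* Otherwise w would increase by e infinitely often. *)
Lemma monotone_cauchy (w : nat -> K) (M e : K) : (forall n m, (n <= m)%N -> w n <= w m) ->
  (forall n, 0 <= w n <= M) -> 0 < e -> exists N, forall n, (N <= n)%N -> w n - w N <= e.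
Proof.
move=> mono wM e0; apply: contrapT => nex.
have step N : exists n, (N <= n)%N /\ w N + e < w n.
  apply: contrapT => nstep; apply: nex; exists N => n Nn.
  have wr k : w k \is Num.real by rewrite ger0_real //; case/andP: (wM k).
  rewrite (real_leNgt (rpredB (wr _) (wr _)) (gtr0_real e0)); apply/negP => lt.
  by apply: nstep; exists n; split=> //; rewrite -ltrBrDl.
have big k : exists n, k%:R * e <= w n.
  elim: k => [|k IH]; first by exists 0%N; rewrite mul0r; case/andP: (wM 0%N).
  have [n nk] := IH; have [m [nm lt]] := step n; exists m; rewrite -natr1 mulrDl mul1r.
  by apply: le_trans (ltW lt); rewrite lerD2r.
have [k kP] := archimedean (M / e); have [n nP] := big k.
have M0 : 0 <= M by case/andP: (wM 0%N) => /le_trans h /h.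
have : `|M / e| < `|M / e|.
  apply: lt_le_trans kP _; rewrite (ger0_norm (divr_ge0 M0 (ltW e0))) ler_pdivlMr //.
  by apply: le_trans nP _; case/andP: (wM n).
by rewrite ltxx.
Qed.

(** Density of polynomials in the weighted norm, whose partial sums are increasing and bounded,
    hence Cauchy. *)
Lemma norm_tail r a e : adm r a -> 0 < e -> exists N, norm_le r r (a - trunc N a : O) e.
Proof.
move=> [r0 [M aM]] e0; pose F i j := `|a i j| * (r ^+ i * r ^+ j).
have F0 i j : 0 <= F i j by rewrite !mulr_ge0 ?exprn_ge0.
have [||N NP] := @monotone_cauchy (psum2 F) M e _ _ e0.
- by move=> n m nm; exact: psum2_mono.
- by move=> n; rewrite psum2_ge0 //=; exact: aM.
exists N => n; apply: (@le_trans _ _ (psum2 F (maxn N n) - psum2 F N)); last by apply: NP; exact: leq_maxl.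
rewrite (psum2_widen F (leq_maxl N n)) -psum2B.
apply: le_trans (psum2_mono _ (leq_maxr N n)) _.
  by move=> i j; rewrite !mulr_ge0 ?exprn_ge0.
apply: ler_psum2 => i j _ _; change (`|(a - trunc N a : O) i j| * (r ^+ i * r ^+ j) <=
  F i j - (if (i < N)%N && (j < N)%N then F i j else 0)).
rewrite cBE truncE /F; by case: ifP => _; rewrite ?subrr ?normr0 ?mul0r ?subr0.
Qed.

(* The constant C' only serves to make L continuous: the resulting bound does
   not depend on it. *)
Lemma functional_bound r (L : O -> K) (C C' : K) : 0 <= C -> 0 <= C' ->
  (forall a b, adm r a -> adm r b -> L (a - b) = L a - L b) ->
  (forall a M, norm_le r r a M -> `|L a| <= C' * M) ->
  (forall k p q, `|L (cst k * (x ^+ p * y ^+ q))| <= C * (`|k| * (r ^+ p * r ^+ q))) ->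
  forall a M, 0 <= r -> norm_le r r a M -> `|L a| <= C * M.
Proof.
move=> C0 C'0 LB LC' LC a M r0 aM; have adma : adm r a by split=> //; exists M.
have M0 := norm_le_ge0 aM.
have adm0 : adm r 0 by have := admB adma adma; rewrite subrr.
have L0 : L 0 = 0 by rewrite -(subrr (0 : O)) LB // subrr.
have LD u w : adm r u -> adm r w -> L (u + w) = L u + L w.
  move=> au aw; have aw' : adm r (- w) by rewrite -sub0r; exact: admB.
  by rewrite -{1}(opprK w) LB // -sub0r LB // L0 sub0r opprK.
have am N : adm r (trunc N a).
  rewrite /trunc; elim/big_rec: _ => // p u _ ?; apply: admD => //.
  by elim/big_rec: _ => // q w _ ?; apply: admD => //; exact: adm_mono.
have Ltr N : `|L (trunc N a)| <= C * M.
  apply: le_trans (ler_wpM2l C0 (aM N)); rewrite /trunc /psum2 mulr_sumr.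
  have Lsum (I : Type) (s : seq I) (G : I -> O) : (forall i, adm r (G i)) ->
      adm r (\sum_(i <- s) G i) /\ L (\sum_(i <- s) G i) = \sum_(i <- s) L (G i).
    move=> aG; elim: s => [|i s [IH1 IH2]]; first by rewrite !big_nil.
    by rewrite !big_cons LD // IH2; split=> //; exact: admD.
  have ain p : adm r (\sum_(q < N) cst (a p q) * (x ^+ p * y ^+ q)).
    by case: (Lsum _ (index_enum 'I_N) (fun q : 'I_N => cst (a p q) * (x ^+ p * y ^+ q))) => // q; exact: adm_mono.
  have [_ ->] := Lsum _ (index_enum 'I_N) _ (fun p : 'I_N => ain p).
  apply: le_trans (ler_norm_sum _ _ _) _; apply: ler_sum => p _; rewrite mulr_sumr.
  have [_ ->] := Lsum _ (index_enum 'I_N) (fun q : 'I_N => cst (a p q) * (x ^+ p * y ^+ q))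
    (fun q => adm_mono _ _ _ r0).
  by apply: le_trans (ler_norm_sum _ _ _) _; apply: ler_sum => q _; exact: LC.
have CM : C * M \is Num.real by rewrite ger0_real // mulr_ge0.
rewrite (real_leNgt (normr_real _) CM); apply/negP => lt.
have d0 : 0 < `|L a| - C * M by rewrite subr_gt0.
have C1 : 0 < C' + 1 by rewrite ltr_wpDl.
have e0 : 0 < (`|L a| - C * M) / (C' + 1) by rewrite divr_gt0.
have [N NP] := norm_tail adma e0.
have : `|L a| < `|L a|.
  have {1}-> : L a = L (a - trunc N a) + L (trunc N a) by rewrite LB // subrK.
  apply: le_lt_trans (ler_normD _ _) _; rewrite -(subrK (C * M) `|L a|); apply: ltr_leD => //.
  apply: le_lt_trans (LC' _ _ NP) _; rewrite mulrA ltr_pdivrMr // mulrC ltr_pM2l // ltrDl ltr01 //.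
by rewrite ltxx.
Qed.

Lemma functional_zero r (L : O -> K) (C' : K) : 0 <= C' ->
  (forall a b, adm r a -> adm r b -> L (a - b) = L a - L b) ->
  (forall a M, norm_le r r a M -> `|L a| <= C' * M) ->
  (forall k p q, L (cst k * (x ^+ p * y ^+ q)) = 0) ->
  forall a, adm r a -> L a = 0.
Proof.
move=> C'0 LB LC' L0 a [r0 [M aM]]; apply/eqP; rewrite -normr_le0.
have := functional_bound (lexx 0) C'0 LB LC' _ r0 aM; rewrite mul0r; apply.
by move=> k p q; rewrite L0 normr0 mul0r.
Qed.

(** The difference of the two sides is a bounded functional that vanishes on monomials;
    [functional_zero] is applied in b and then in a. *)
Lemma evM r a b z : adm r a -> adm r b -> in_ball r z -> ev z (a * b) = ev z a * ev z b.
Proof.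
move=> adma admb zr; have r0 := adma.1.
have ev_monoM k p q c : adm r c -> ev z (cst k * (x ^+ p * y ^+ q) * c) = k * z.1 ^+ p * z.2 ^+ q * ev z c.
  move=> admc; apply/eqP; rewrite -subr_eq0; apply/eqP; move: c admc.
  have C0 : 0 <= `|k| * (r ^+ p * r ^+ q) by rewrite !mulr_ge0 ?exprn_ge0.
  apply: (@functional_zero r _ (`|k| * (r ^+ p * r ^+ q) + `|k| * (r ^+ p * r ^+ q))).
  - exact: addr_ge0.
  - move=> c d ac ad; have am := adm_mono k p q r0.
    by rewrite mulrBr (evB (admM am ac) (admM am ad) zr) (evB ac ad zr); ring.
  - move=> c M cM; rewrite mulrDl; apply: le_trans (ler_normB _ _) _; apply: lerD.
      by apply: (ev_norm r0 _ zr); exact: (norm_leM r0 r0 (norm_mono k p q r0) cM).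
    rewrite normrM ler_pM // ?(ev_norm r0 cM zr) //.
    by have := ev_norm r0 (norm_mono k p q r0) zr; rewrite ev_mono.
  - move=> k' p' q'.
    have -> : cst k * (x ^+ p * y ^+ q) * (cst k' * (x ^+ p' * y ^+ q')) =
        cst (k * k') * (x ^+ (p + p') * y ^+ (q + q')).
      by rewrite rmorphM !exprD /=; ring.
    by rewrite !ev_mono !exprD; ring.
apply/eqP; rewrite -subr_eq0; apply/eqP; move: a adma.
have [_ [B bB]] := admb; have B0 := norm_le_ge0 bB.
apply: (@functional_zero r _ (B + B)); first exact: addr_ge0.
- move=> c d ac ad; rewrite (_ : (c - d) * b = c * b - d * b); last by rewrite mulrBl.
  rewrite (evB (admM ac admb) (admM ad admb) zr) (evB ac ad zr); ring.
- move=> c M cM; rewrite mulrDl ![B * M]mulrC; apply: le_trans (ler_normB _ _) _; apply: lerD.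
    by apply: (ev_norm r0 _ zr); exact: (norm_leM r0 r0 cM bB).
  by rewrite normrM ler_pM // (ev_norm r0 _ zr).
- by move=> k p q; rewrite ev_monoM // ev_mono subrr.
Qed.

Lemma adm_shrink r r' a : 0 <= r <= r' -> adm r' a -> adm r a.
Proof.
move=> /andP[r0 rr'] [_ [M aM]]; split=> //; exists M; apply: norm_le_shrink aM; exact/andP.
Qed.

Lemma ev_comp (r rho : K) a (u v : O) z : 0 <= r -> 0 <= rho -> u 0%N 0%N = 0 -> v 0%N 0%N = 0 ->
  norm_le r r (cf u) rho -> norm_le r r (cf v) rho -> adm rho a -> in_ball r z ->
  ev z (comp a u v) = ev (ev z u, ev z v) a.
Proof.
move=> r0 rho0 u0 v0 ur vr adma zr.
have wrho : in_ball rho (ev z u, ev z v) by split; exact: (ev_norm r0 _ zr).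
have admc c : adm rho c -> adm r (comp c u v).
  by move=> [_ [M cM]]; split=> //; exists M; exact: comp_norm cM.
have admu : adm r u by split=> //; exists rho.
have admv : adm r v by split=> //; exists rho.
apply/eqP; rewrite -subr_eq0; apply/eqP; move: a adma.
apply: (@functional_zero rho _ 2) => //.
- move=> c d ac ad; rewrite compB // (evB (admc _ ac) (admc _ ad) zr) (evB ac ad wrho); ring.
- move=> c M cM; rewrite mulr2n mulrDl mul1r; apply: le_trans (ler_normB _ _) _; apply: lerD.
    by apply: (ev_norm r0 _ zr); exact: comp_norm cM.
  exact: ev_norm cM wrho.
- move=> k p q; rewrite comp_cstM // comp_mono // ev_mono /=.
  have admX w n : adm r w -> adm r (w ^+ n) /\ ev z (w ^+ n) = ev z w ^+ n.
    move=> aw; elim: n => [|n [IH1 IH2]].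
      rewrite !expr0; have := adm_mono 1 0 0 r0; have := ev_mono 1 0 0 z.
      by rewrite rmorph1 !expr0 !mul1r.
    by rewrite !exprS (evM aw IH1 zr) IH2; split=> //; exact: admM.
  have [a1 e1] := admX _ p admu; have [a2 e2] := admX _ q admv.
  have ac : adm r (cst k) by have := adm_mono k 0 0 r0; rewrite !expr0 !mulr1.
  have ec : ev z (cst k) = k by have := ev_mono k 0 0 z; rewrite !expr0 !mulr1.
  by rewrite (evM ac (admM a1 a2) zr) (evM a1 a2 zr) e1 e2 ec; ring.
Qed.
End Evaluation.

(** * The Archimedean property and completeness of the complex numbers *)

Section ComplexNumbers.
Variable R : realType.
Local Notation C := R[i]%C.
Import ComplexField.

Lemma complex_archimedean (t : C) : exists n : nat, `|t| < n%:R.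
Proof.
exists (Num.bound (complex.Re `|t|)).
have tr : `|t| \is Num.real by [].
have E : `|t| = (complex.Re `|t|)%:C%C by rewrite (RRe_real tr).
have E' n : n%:R = (n%:R : R)%:C%C :> C by rewrite rmorph_nat.
by rewrite {1}E E' ltcR; apply: archi_boundP; rewrite -lecR -E normr_ge0.
Qed.

Lemma real_complete (w : nat -> R) M : (forall N, \sum_(i < N) `|w i| <= M) ->
  exists l : R, forall e, 0 < e -> exists N0, forall N, (N0 <= N)%N -> `|l - \sum_(i < N) w i| < e.
Proof.
move=> wM; have cv : cvgn (series w).
  apply: normed_cvg; apply: nondecreasing_is_cvgn.
    by apply: nondecreasing_series => n _ _; rewrite normr_ge0.
  exists M => _ [N _ <-]; apply: le_trans (wM N); rewrite /series /= -(big_mkord xpredT (fun i => `|w i|)).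
  exact: lexx.
exists (lim (series w @ \oo)) => e e0.
move/cvgrPdist_lt: cv => /(_ _ e0) [N0 _ NP]; exists N0 => N /NP.
by rewrite /series /= big_mkord.
Qed.

Lemma complex_complete (w : nat -> C) : (exists M : C, forall N, \sum_(i < N) `|w i| <= M) ->
  exists l, tends (fun N => \sum_(i < N) w i) l.
Proof.
move=> [M wM].
have part (f : C -> R) : (forall z, `|f z|%:C%C <= `|z|) -> exists l : R, forall e, 0 < e ->
    exists N0, forall N, (N0 <= N)%N -> `|l - \sum_(i < N) f (w i)| < e.
  move=> fle; apply: (@real_complete (fun i => f (w i)) (complex.Re M)) => N.
  have := wM N; rewrite lecE => /andP[_]; apply: le_trans.
  have -> : complex.Re (\sum_(i < N) `|w i|) = \sum_(i < N) complex.Re `|w i|.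
    by apply: (big_morph (@complex.Re R)) => // -[? ?] [? ?].
  apply: ler_sum => i _; have := fle (w i).
  by rewrite -[X in _ <= X](RRe_real (normr_real _)) lecR.
have [a aP] := part (@complex.Re R) (@normc_ge_Re R).
have [|b bP] := part (@complex.Im R).
  move=> z; have := normc_ge_Re (z * 'i%C); rewrite ReiNIm normrN normrM.
  rewrite (_ : `|'i%C| = 1) ?mulr1 //.
  by rewrite normc_def /= expr0n expr1n add0r sqrtr1.
exists (a +i* b)%C => e e0.
have [er ei] : e = (complex.Re e)%:C%C /\ True by rewrite RRe_real // gtr0_real.
have e20 : 0 < complex.Re e / 2 by rewrite divr_gt0 // -ltcR -er.
have [N1 N1P] := aP _ e20; have [N2 N2P] := bP _ e20.
exists (maxn N1 N2) => N; rewrite geq_max => /andP[/N1P h1 /N2P h2].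
have -> : (a +i* b)%C - \sum_(i < N) w i =
    (a - \sum_(i < N) complex.Re (w i))%:C%C + 'i%C * (b - \sum_(i < N) complex.Im (w i))%:C%C.
  have -> : \sum_(i < N) w i = ((\sum_(i < N) complex.Re (w i)) +i* (\sum_(i < N) complex.Im (w i)))%C.
    by elim/big_rec3: _ => [|i p q s _ ->] //; case: (w i).
  by simpc.
apply: le_lt_trans (ler_normD _ _) _; rewrite normrM.
rewrite (_ : `|'i%C| = 1) ?mul1r; last by rewrite normc_def /= expr0n expr1n add0r sqrtr1.
have nR (k : R) : `|k%:C%C| = `|k|%:C%C :> C by rewrite normc_def /= expr0n addr0 sqrtr_sqr.
by rewrite !nR -rmorphD er ltcR [ltRHS]splitr ltrD.
Qed.
End ComplexNumbers.

(** * The dictionary between germs of functions and convergent series *)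

Section Germs.
Variable K : numClosedFieldType.
Notation O := (cps K).
Notation x := (vx K).
Notation y := (vy K).
Hypothesis archimedean : forall t : K, exists n : nat, `|t| < n%:R.
Hypothesis complete : forall w : nat -> K, (exists M : K, forall N, \sum_(i < N) `|w i| <= M) ->
  exists l, tends (fun N => \sum_(i < N) w i) l.
Implicit Types (z : C2 K) (a b : O) (f g : C2 K -> K).

Lemma adm_ex a : exists rho : K, 0 < rho /\ forall r, 0 <= r <= rho -> adm r a.
Proof.
have [rho [M [rho0 aM]]] := cpsP a; exists rho; split=> // r h.
by apply: (adm_shrink h); split; [exact: ltW|exists M].
Qed.

Lemma near_ball (r : K) : 0 < r -> \forall z \near (0 : C2 K), in_ball r z.
Proof. by move=> r0; apply/near0P; exists r; split=> // z /ltW ? /ltW. Qed.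

Lemma near_adm a : \forall z \near (0 : C2 K), exists r, adm r a /\ in_ball r z.
Proof.
have [rho [rho0 h]] := adm_ex a; have := near_ball rho0; apply: filterS => z zr.
by exists rho; split=> //; apply: h; rewrite ltW //=.
Qed.

Lemma near_adm2 a b : \forall z \near (0 : C2 K), exists r, [/\ adm r a, adm r b & in_ball r z].
Proof.
have [rho [rho0 h]] := adm_ex a; have [rho' [rho'0 h']] := adm_ex b.
have [r [r0 rr rr']] : exists r : K, [/\ 0 < r, r <= rho & r <= rho'].
  have /orP[le|le] := real_leVge (gtr0_real rho0) (gtr0_real rho'0).
    by exists rho; split.
  by exists rho'; split.
have := near_ball r0; apply: filterS => z zr.
by exists r; split=> //; [apply: h|apply: h']; rewrite ltW //=.
Qed.

Definition rep f a := \forall z \near (0 : C2 K), f z = ev z a.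

Lemma rep_ev a : rep (fun z => ev z a) a. Proof. by apply/near0P; exists 1; split. Qed.

Lemma rep_holo f a : rep f a -> holo f.
Proof.
move=> fa; exists a; near=> z.
have [r [[r0 [M aM]] zr]] : exists r, adm r a /\ in_ball r z by near: z; exact: near_adm.
split; first by exists M => N; exact: psum2_term_norm aM zr.
have -> : f z = ev z a by near: z.
apply/tendsP; exact (evP complete r0 aM zr).
Unshelve. all: by end_near. Qed.

(** Absolute convergence at the single point (e / 2, e / 2) is already the norm bound with radius e
    / 2. *)
Lemma holo_rep f : holo f -> exists a, rep f a.
Proof.
move=> [a0 /near0P[e [e0 eP]]]; have e20 : 0 < e / 2 by rewrite divr_gt0.
have ca : conv (a0 : fps (fps K)).
  have lt : `|e / 2| < e by rewrite gtr0_norm // ltr_pdivrMr // mulr_natr mulr2n ltrDl.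
  have [[M MP] _] := eP (e / 2, e / 2) lt lt.
  exists (e / 2), M; split=> // N; apply: le_trans (MP N); apply: ler_psum2 => i j _ _ /=.
  by rewrite !normrM !normrX (gtr0_norm e20) mulrA.
exists (mk_cps ca); apply/near0P; exists e; split=> // z z1 z2.
have [_ h] := eP z z1 z2; symmetry; apply: ev_tends.
have := (@tendsP K (fun N => psum2 (fun j k => a0 j k * z.1 ^+ j * z.2 ^+ k) N) (f z)).1 h.
by [].
Qed.

Lemma repB f g a b : rep f a -> rep g b -> rep (fun z => f z - g z) (a - b).
Proof.
move=> fa gb; near=> z; have [r [ar br zr]] : exists r, [/\ adm r a, adm r b & in_ball r z].
  by near: z; exact: near_adm2.
rewrite (evB complete ar br zr).
by have -> : f z = ev z a; [near: z|have -> : g z = ev z b by near: z].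
Unshelve. all: by end_near. Qed.

Lemma repM f g a b : rep f a -> rep g b -> rep (fun z => f z * g z) (a * b).
Proof.
move=> fa gb; near=> z; have [r [ar br zr]] : exists r, [/\ adm r a, adm r b & in_ball r z].
  by near: z; exact: near_adm2.
rewrite (evM archimedean complete ar br zr).
by have -> : f z = ev z a; [near: z|have -> : g z = ev z b by near: z].
Unshelve. all: by end_near. Qed.

Lemma ev_cst z k : ev z (cst k) = k.
Proof. by have := ev_mono k 0 0 z; rewrite !expr0 !mulr1. Qed.

Lemma ev_vx z : ev z x = z.1.
Proof. by have := ev_mono 1 1 0 z; rewrite rmorph1 !expr0 !expr1 !mulr1 !mul1r. Qed.

Lemma ev_vy z : ev z y = z.2.
Proof. by have := ev_mono 1 0 1 z; rewrite rmorph1 !expr0 !expr1 !mul1r. Qed.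

Lemma rep_cst k : rep (fun=> k) (cst k).
Proof. by apply/near0P; exists 1; split=> // z _ _; rewrite ev_cst. Qed.

Lemma rep0 : rep (fun=> 0) 0.
Proof. by rewrite -(rmorph0 (@cst K)); exact: rep_cst. Qed.

Lemma repD f g a b : rep f a -> rep g b -> rep (fun z => f z + g z) (a + b).
Proof.
move=> fa gb; have h := repB rep0 gb; have := repB fa h; rewrite sub0r opprK.
by apply: filterS => z <-; rewrite sub0r opprK.
Qed.

Lemma rep_sum m (F : 'I_m -> C2 K -> K) (A : 'I_m -> O) : (forall i, rep (F i) (A i)) ->
  rep (fun z => \sum_i F i z) (\sum_i A i).
Proof.
elim: m F A => [|m IH] F A FA.
  by rewrite big_ord0; have := rep0; apply: filterS => z <-; rewrite big_ord0.
rewrite big_ord_recl; have := repD (FA ord0) (IH _ _ (fun i => FA (lift ord0 i))).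
by apply: filterS => z <-; rewrite big_ord_recl.
Qed.

Lemma rep_germ f g a : rep f a -> germ_eq f g -> rep g a.
Proof. by move=> fa fg; near=> z; have <- : f z = g z; [near: z|near: z]. Unshelve. all: by end_near. Qed.

Lemma rep_eq f g a : rep f a -> rep g a -> germ_eq f g.
Proof.
by move=> fa ga; near=> z; have -> : f z = ev z a; [near: z|symmetry; near: z].
Unshelve. all: by end_near. Qed.

Lemma ev00 a : ev 0 a = a 0%N 0%N.
Proof.
apply: ev_tends; apply: (@tends_cst _ _ _ 1) => N N0; rewrite (@psum2_single _ _ 0 0) // => [|i j].
  by rewrite /term !expr0 !mulr1.
rewrite /term !expr0n; case: (i =P 0%N) => [_|_] /=; last by rewrite mulr0 mul0r.
by case: (j =P 0%N) => [_|_] //=; rewrite mulr0.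
Qed.

Lemma rep00 f a : rep f a -> f 0 = a 0%N 0%N.
Proof. by move=> fa; rewrite -ev00; exact: nbhs_singleton fa. Qed.

Lemma ev_swap r a z : adm r a -> in_ball r z -> ev z (swap a) = ev (z.2, z.1) a.
Proof.
move=> [r0 [M aM]] zr; have zr' : in_ball r (z.2, z.1) by case: zr.
apply: ev_tends => e /(evP complete r0 aM zr')[N0 NP]; exists N0 => N /NP.
congr (`|_ - _| < e); rewrite /psum2 exchange_big; apply: eq_bigr => i _; apply: eq_bigr => j _.
by rewrite /term /= swapE mulrAC.
Qed.

Lemma rep_swap f a : rep f a -> rep (fun z => f (z.2, z.1)) (swap a).
Proof.
move=> /near0P[e [e0 fe]]; have [rho [rho0 h]] := adm_ex a.
near=> z; have zr : in_ball rho z by near: z; exact: near_ball.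
have -> : ev z (swap a) = ev (z.2, z.1) a.
  by apply: (@ev_swap rho) => //; apply: h; rewrite lexx ltW.
apply: fe => /=.
  by near: z; apply/near0P; exists e; split.
by near: z; apply/near0P; exists e; split.
Unshelve. all: by end_near. Qed.

(** The remainder is at most p^2 |h|^2 sg^(p-2); the factor sg^2 on the left avoids the exponent p -
    2, which would be truncated for p < 2. *)
Lemma power_taylor (s h sg : K) p : 0 <= sg -> `|s| <= sg -> `|s + h| <= sg ->
  sg ^+ 2 * `|(s + h) ^+ p - s ^+ p - h * (p%:R * s ^+ p.-1)| <= (p ^ 2)%:R * `|h| ^+ 2 * sg ^+ p.
Proof.
move=> sg0 ss sh; elim: p => [|p IH].
  by rewrite !expr0 mul0r mulr0 subrr subr0 normr0 mulr0 !mulr_ge0 ?exprn_ge0.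
have -> : (s + h) ^+ p.+1 - s ^+ p.+1 - h * (p.+1%:R * s ^+ p) =
  (s + h) * ((s + h) ^+ p - s ^+ p - h * (p%:R * s ^+ p.-1)) + p%:R * (h ^+ 2 * s ^+ p.-1).
  case: p {IH} => [|p] /=; first by rewrite !expr0 !expr1; ring.
  by rewrite -[p.+2%:R]natr1 !exprS; ring.
apply: (@le_trans _ _ (sg * ((p ^ 2)%:R * `|h| ^+ 2 * sg ^+ p) + p%:R * `|h| ^+ 2 * sg ^+ p.+1)).
  apply: (@le_trans _ _ (sg ^+ 2 * (`|s + h| * `|(s + h) ^+ p - s ^+ p - h * (p%:R * s ^+ p.-1)|) +
      sg ^+ 2 * (p%:R * (`|h| ^+ 2 * `|s| ^+ p.-1)))).
    rewrite -mulrDr ler_wpM2l ?exprn_ge0 //; apply: le_trans (ler_normD _ _) _.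
    by rewrite !normrM normr_nat !normrX.
  apply: lerD.
    rewrite mulrCA; apply: ler_pM => //; first by rewrite mulr_ge0 ?exprn_ge0.
  case: p {IH} => [|p]; first by rewrite !mul0r mulr0.
  rewrite mulrCA -[leRHS]mulrA ler_wpM2l // mulrCA ler_wpM2l ?exprn_ge0 //=.
  by rewrite -[p.+2]/(2 + p)%N exprD ler_wpM2l ?exprn_ge0 // lerXn2r ?nnegrE.
rewrite [sg ^+ p.+1]exprS.
have -> : sg * ((p ^ 2)%:R * `|h| ^+ 2 * sg ^+ p) + p%:R * `|h| ^+ 2 * (sg * sg ^+ p) =
  (p ^ 2 + p)%:R * `|h| ^+ 2 * (sg * sg ^+ p) by rewrite natrD; ring.
rewrite -!mulrA ler_wpM2r //; first by rewrite !mulr_ge0 ?exprn_ge0.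
by rewrite ler_nat -!mulnn mulSn mulnS [(p + p * p)%N]addnC leq_addl.
Qed.

Lemma dX_mono k p q : dX (cst k * (x ^+ p * y ^+ q)) = cst (k * p%:R) * (x ^+ p.-1 * y ^+ q).
Proof.
rewrite -!cmonoX -!cmono_cst; apply: cps_ext => i j; rewrite dXE !cmonoE.
case: p => [|p] /=; first by rewrite mulr0 mulr0; case: ifP.
by rewrite eqSS; case: ifP => [/andP[/eqP -> _]|_]; rewrite ?mulr0 // mulrC.
Qed.

(** By [functional_bound] it suffices to treat monomials, where a constant independent of p results
    from p^2 (rho / 4)^p <= rho^p. *)
Lemma ev_taylor (rho M s t h : K) a : 0 < rho -> norm_le rho rho a M ->
  `|s| <= rho / 4 -> `|s + h| <= rho / 4 -> `|t| <= rho / 4 ->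
  `|ev (s + h, t) a - ev (s, t) a - h * ev (s, t) (dX a)| <= `|h| ^+ 2 / (rho / 4) ^+ 2 * M.
Proof.
move=> rho0 aM ss sh st; have sg0 : 0 < rho / 4 by rewrite divr_gt0.
have r2 : 0 <= rho / 2 by rewrite divr_ge0 ?ltW.
have le4 : rho / 4 <= rho / 2 by rewrite ler_pM2l // lef_pV2 ?posrE // ler_nat.
have le2 : rho / 2 <= rho by rewrite ler_pdivrMr // mulr_natr mulr2n lerDl ltW.
have i2 w : `|w| <= rho / 4 -> `|w| <= rho / 2 by move/le_trans; apply.
have iR w : `|w| <= rho / 4 -> `|w| <= rho by move/i2/le_trans; apply.
have B1 : in_ball rho (s + h, t) by split; apply: iR.
have B2 : in_ball rho (s, t) by split; apply: iR.
have B3 : in_ball (rho / 2) (s, t) by split; apply: i2.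
pose L b := ev (s + h, t) b - ev (s, t) b - h * ev (s, t) (dX b).
have dM b N : norm_le rho rho b N -> norm_le (rho / 2) (rho / 2) (dX b) (N / rho).
  exact: norm_le_dx.
have := @functional_bound _ archimedean rho L (`|h| ^+ 2 / (rho / 4) ^+ 2) (1 + 1 + `|h| / rho).
apply => //; first by rewrite divr_ge0 ?exprn_ge0 // ltW.
- by rewrite !addr_ge0 ?divr_ge0 // ltW.
- move=> b c ab ac; rewrite /L raddfB /= (evB complete ab ac B1) (evB complete ab ac B2).
  case: ab ac => _ [N bN] [_ [N' cN']].
  rewrite (evB complete (conj r2 (ex_intro _ _ (dM _ _ bN))) (conj r2 (ex_intro _ _ (dM _ _ cN'))) B3).
  ring.
- move=> b N bN; rewrite !mulrDl mul1r; apply: le_trans (ler_normB _ _) _; apply: lerD.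
    by apply: le_trans (ler_normB _ _) _; apply: lerD; apply: (ev_norm complete (ltW rho0) bN).
  rewrite normrM -mulrA ler_wpM2l // [_ * N]mulrC.
  have := ev_norm complete r2 (dM _ _ bN) B3; exact.
- move=> k p q; rewrite /L dX_mono !ev_mono /=.
  have -> : k * (s + h) ^+ p * t ^+ q - k * s ^+ p * t ^+ q - h * (k * p%:R * s ^+ p.-1 * t ^+ q) =
    k * (t ^+ q * ((s + h) ^+ p - s ^+ p - h * (p%:R * s ^+ p.-1))) by ring.
  rewrite !normrM normrX [leRHS]mulrCA ler_wpM2l //.
  rewrite [rho ^+ p * _]mulrC [leRHS]mulrCA ler_pM ?exprn_ge0 //.
    by rewrite lerXn2r ?nnegrE ?(ltW rho0) ?iR.
  have := power_taylor p (ltW sg0) ss sh.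
  rewrite -ler_pdivlMl ?exprn_gt0 // => /le_trans; apply.
  rewrite [leLHS](_ : _ = `|h| ^+ 2 / (rho / 4) ^+ 2 * ((p ^ 2)%:R * (rho / 4) ^+ p)); last by ring.
  rewrite ler_wpM2l ?divr_ge0 ?exprn_ge0 ?(ltW sg0) // exprMn mulrCA exprVn.
  rewrite -[leRHS]mulr1 ler_wpM2l ?exprn_ge0 ?(ltW rho0) // ler_pdivrMr ?exprn_gt0 // mul1r.
  have -> : 4 ^+ p = (2 ^+ p * 2 ^+ p : K) by rewrite -exprMn -natrM.
  by rewrite natrX expr2 ler_pM //; apply: le_trans (succ_le_exp2 _ _); rewrite ler_nat.
- exact: ltW.
Qed.

Lemma derive1_taylor (g : K -> K) (t l C d : K) : 0 < d -> 0 <= C ->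
  (forall h, `|h| < d -> `|g (t + h) - g t - h * l| <= C * `|h| ^+ 2) -> derive1 g t = l.
Proof.
move=> d0 C0 gC; apply: cvg_lim; first exact: norm_hausdorff.
apply/cvgrPdist_le => e e0.
have C1 : 0 < C + 1 by rewrite ltr_wpDl.
near=> h.
have h0 : h != 0 by near: h; exact: nbhs_dnbhs_neq.
have hd : `|h| < d.
  near: h; apply: nbhs_dnbhs; apply/nbhs_ballP; exists d => //= w; by rewrite -ball_normE /= sub0r normrN.
have he : `|h| < e / (C + 1).
  near: h; apply: nbhs_dnbhs; apply/nbhs_ballP; exists (e / (C + 1)); first exact: divr_gt0.
  by move=> w; rewrite -ball_normE /= sub0r normrN.
have -> : l - h^-1 *: (g (h + t) - g t) = - (h^-1 * (g (t + h) - g t - h * l)).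
  by rewrite [h + t]addrC /GRing.scale /=; field.
rewrite normrN normrM normfV ler_pdivrMl ?normr_gt0 //; apply: le_trans (gC _ hd) _.
rewrite expr2 mulrCA ler_wpM2l //.
move: he; rewrite ltr_pdivlMr // => /ltW; apply: le_trans.
by rewrite mulrC ler_wpM2l // lerDl.
Unshelve. all: by end_near. Qed.

Lemma rep_dx f a : rep f a -> rep (dx f) (dX a).
Proof.
move=> /near0P[e [e0 fe]]; have [rho [M [rho0 aM]]] := cpsP a.
have [d [d0 de dr]] : exists d : K, [/\ 0 < d, d + d <= e & d + d <= rho / 4].
  have r8 : 0 < rho / 4 by rewrite divr_gt0.
  have /orP[le|le] := real_leVge (gtr0_real e0) (gtr0_real r8).
    by exists (e / 2); rewrite -splitr; split=> //; rewrite divr_gt0.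
  by exists (rho / 4 / 2); rewrite -splitr; split=> //; rewrite divr_gt0.
apply/near0P; exists d; split=> // -[s t] /= sd td; rewrite /dx /=.
have dd : d <= d + d by rewrite lerDl ltW.
have M0 := norm_le_ge0 aM.
apply: (@derive1_taylor _ _ _ (((rho / 4) ^+ 2)^-1 * M) d) => //.
  by rewrite mulr_ge0 ?invr_ge0 ?exprn_ge0 // divr_ge0 ?ltW.
move=> h hd; have shd : `|s + h| < d + d by apply: le_lt_trans (ler_normD _ _) _; rewrite ltrD.
rewrite !fe /=; try by apply: lt_le_trans de => //; apply: lt_le_trans dd.
have := @ev_taylor rho M s t h a rho0 aM.
have -> : `|h| ^+ 2 / (rho / 4) ^+ 2 * M = ((rho / 4) ^+ 2)^-1 * M * `|h| ^+ 2 by ring.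
by apply; apply: le_trans dr; rewrite ltW //; apply: lt_le_trans dd.
Qed.

Lemma rep_dy f a : rep f a -> rep (dy f) (dY a).
Proof.
move=> fa; have := rep_swap (rep_dx (rep_swap fa)); rewrite /dY.
by apply: filterS => z <-.
Qed.

(** All derivatives of the zero function vanish, and the coefficients of its series are read off
    from their values at 0. *)
Lemma rep_zero a : rep (fun=> 0) a -> a = 0.
Proof.
have zx b : rep (fun=> 0) b -> rep (fun=> 0) (dX b).
  move/rep_dx; apply: filterS => z <-; symmetry; exact: derive1_cst.
have zy b : rep (fun=> 0) b -> rep (fun=> 0) (dY b).
  move/rep_dy; apply: filterS => z <-; symmetry; exact: derive1_cst.
move=> a0; apply: cps_ext => i j; rewrite c0E.
elim: i j a a0 => [|i IH] j a a0.
  elim: j a a0 => [|j IH] a a0; first by rewrite -(rep00 a0).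
  have := IH _ (zy _ a0); rewrite dYE => /eqP; rewrite mulf_eq0 pnatr_eq0 /= => /eqP ->.
  by [].
have := IH j _ (zx _ a0); rewrite dXE => /eqP; rewrite mulf_eq0 pnatr_eq0 /= => /eqP ->.
by [].
Qed.

Lemma rep_uniq f g a b : rep f a -> rep g b -> germ_eq f g -> a = b.
Proof.
move=> fa gb fg; apply/eqP; rewrite -subr_eq0; apply/eqP; apply: rep_zero.
have := repB (rep_germ fa fg) gb; apply: filterS => z <-; by rewrite subrr.
Qed.
End Germs.

(** * Zeros of non-unit germs accumulate at the origin *)

Section ZerosOfGerms.
Variable K : numClosedFieldType.
Notation O := (cps K).
Notation x := (vx K).
Notation y := (vy K).
Hypothesis archimedean : forall t : K, exists n : nat, `|t| < n%:R.
Hypothesis complete : forall w : nat -> K, (exists M : K, forall N, \sum_(i < N) `|w i| <= M) ->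
  exists l, tends (fun N => \sum_(i < N) w i) l.
Implicit Types (z : C2 K) (a b q : O) (f g : C2 K -> K).

Lemma min_pos (e e' : K) : 0 < e -> 0 < e' -> exists d : K, [/\ 0 < d, d <= e & d <= e'].
Proof.
move=> e0 e'0; have /orP[le|le] := real_leVge (gtr0_real e0) (gtr0_real e'0).
  by exists e; split.
by exists e'; split.
Qed.

Lemma near_forall d (P : 'I_d -> C2 K -> Prop) : (forall k, \forall z \near (0 : C2 K), P k z) ->
  \forall z \near (0 : C2 K), forall k, P k z.
Proof. by move=> h; exact: (@filter_forall (C2 K) 'I_d P (nbhs (0 : C2 K)) _ h). Qed.

Lemma ev_small (u : O) (eta : K) : u 0%N 0%N = 0 -> 0 < eta ->
  \forall z \near (0 : C2 K), `|ev z u| <= eta.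
Proof.
move=> u0 eta0; have [rho [rho0 h]] := small_norm_eps u0 eta0.
have := near_ball rho0; apply: filterS => z zr.
by apply: (ev_norm complete (ltW rho0) (h _ _) zr); rewrite lexx ltW.
Qed.

Lemma rep_comp f (g k : C2 K -> K) a (u v : O) : u 0%N 0%N = 0 -> v 0%N 0%N = 0 ->
  rep f a -> rep g u -> rep k v -> rep (fun z => f (g z, k z)) (comp a u v).
Proof.
move=> u0 v0 /near0P[e [e0 fe]] gu kv; have [rho' [rho'0 aadm]] := adm_ex a.
have e20 : 0 < e / 2 by rewrite divr_gt0.
have [rho [rho0 rhoe rhorho]] := min_pos e20 rho'0.
have [r1 [r10 un]] := small_norm_eps u0 rho0; have [r2 [r20 vn]] := small_norm_eps v0 rho0.
have [r [r0 rr1 rr2]] := min_pos r10 r20.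
have ur : norm_le r r u rho by apply: un; rewrite ltW.
have vr : norm_le r r v rho by apply: vn; rewrite ltW.
near=> z; have zr : in_ball r z by near: z; exact: near_ball.
rewrite (@ev_comp _ archimedean complete r rho) ?ltW //; last by apply: aadm; rewrite ltW.
have -> : g z = ev z u by near: z.
have -> : k z = ev z v by near: z.
have lt : rho < e by apply: le_lt_trans rhoe _; rewrite ltr_pdivrMr // mulr_natr mulr2n ltrDl.
by apply: fe => /=; apply: le_lt_trans lt; apply: (ev_norm complete (ltW r0) _ zr).
Unshelve. all: by end_near. Qed.

Lemma ev_xonly (r : K) a z : adm r a -> in_ball r z -> xonly a -> ev z a = ev (z.1, 0) a.
Proof.
move=> [r0 [M aM]] [z1 z2] ax; have z0r : in_ball r (z.1, 0) by split=> //=; rewrite normr0.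
apply: ev_tends => e /(evP complete r0 aM z0r)[N0 NP]; exists N0 => N /NP.
congr (`|_ - _| < e); apply: eq_psum2 => i j _ _; rewrite /term /=.
by case: j => [|j]; rewrite ?expr0 // ax // !mul0r.
Qed.

Lemma ydeg_expand d (r : O) : ydeg_lt d r ->
  exists R : nat -> O, (forall k, xonly (R k)) /\ r = \sum_(k < d) R k * y ^+ k.
Proof.
elim: d r => [|d IH] r rd.
  exists (fun=> 0); split=> [k|]; first exact: ydeg_lt0.
  by rewrite big_ord0; apply: cps_ext => i j; rewrite c0E rd.
have [c [g [cx gd rE]]] := ydeg_top rd; have [R [Rx gE]] := IH _ gd.
exists (fun k => if (k < d)%N then R k else c); split=> [k|]; first by case: ifP.
rewrite big_ord_recr /= ltnn rE gE addrC; congr (_ + _).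
by apply: eq_bigr => k _; rewrite ltn_ord.
Qed.

(** If |T| >= eps, each |c k T^k| eps^d is at most eta |T|^d, and the sum of d such terms is too
    small to equal |T|^d eps^d. *)
Lemma root_small (c : nat -> K) (T eta eps : K) d : 0 < eps -> eps <= 1 -> 0 <= eta ->
  d%:R * eta < eps ^+ d -> (forall k, (k < d)%N -> `|c k| <= eta) ->
  T ^+ d = \sum_(k < d) c k * T ^+ k -> `|T| < eps.
Proof.
move=> eps0 eps1 eta0 small cb TE; rewrite real_ltNge ?normr_real ?gtr0_real //; apply/negP => le.
have T0 : 0 < `|T| by exact: lt_le_trans le.
have : eps ^+ d * `|T| ^+ d < eps ^+ d * `|T| ^+ d; last by rewrite ltxx.
apply: (@le_lt_trans _ _ (d%:R * eta * `|T| ^+ d)); last by rewrite ltr_pM2r ?exprn_gt0.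
rewrite -normrX TE -mulrA mulr_natl -[X in _ *+ X]card_ord -sumr_const.
apply: (@le_trans _ _ (eps ^+ d * \sum_(k < d) `|c k * T ^+ k|)).
  by rewrite ler_pM2l ?exprn_gt0 // ler_norm_sum.
rewrite mulr_sumr; apply: ler_sum => k _; rewrite normrM normrX mulrCA -TE normrX.
apply: ler_pM; rewrite ?mulr_ge0 ?exprn_ge0 ?(ltW eps0) ?cb //.
case: k => k /= /ltnW kd; rewrite -(subnK kd) !exprD -mulrA ler_pM ?mulr_ge0 ?exprn_ge0 ?(ltW eps0) //.
  by rewrite lerXn2r ?nnegrE ?(ltW eps0).
by rewrite ler_piMl ?exprn_ge0 // exprn_ile1 // ltW.
Qed.

(** If x divides q, points (0, y) serve. Otherwise dividing y^d by q gives y^d = c q + r with c a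
    unit and the coefficients of r in C{x} vanishing at 0. For a small x <> 0, a root of y^d = r(x,
    y) exists because the field is closed; it is small, and q vanishes there. *)
Lemma zero_ex q (e : K) : q 0%N 0%N = 0 -> 0 < e ->
  exists z, [/\ z <> 0, `|z.1| < e, `|z.2| < e & ev z q = 0].
Proof.
move=> q0 e0; have [[g qE]|[d qd]] := yregP q.
  have /near0P[e' [e'0 he']] := repM archimedean complete (rep_ev x) (rep_ev g).
  have [r [r0 re re']] := min_pos e0 e'0.
  have r2 : `|r / 2| < r by rewrite gtr0_norm ?divr_gt0 // ltr_pdivrMr // mulr_natr mulr2n ltrDl.
  exists (0, r / 2); split => /=; rewrite ?normr0 //; last 2 first.
  - exact: lt_le_trans re.
  - rewrite qE -he' /= ?ev_vx ?normr0 ?mul0r //; exact: lt_le_trans re'.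
  by case=> /eqP; rewrite gt_eqF ?divr_gt0.
have d0 : (0 < d)%N by case: d qd => // -[_]; rewrite q0.
have [c [r [yE rd]]] := weierstrass_division (y ^+ d) qd.
have rowcq k : (k < d)%N -> (c * q : O) 0%N k = 0.
  move=> kd; rewrite row0M big1 // => -[i ik] _ /=.
  by rewrite (qd.1 (k - i)%N) ?mulr0 //; apply: leq_ltn_trans kd; exact: leq_subr.
have yd k : (y ^+ d : O) 0%N k = (k == d)%:R.
  have := cmonoX K 0 d; rewrite expr0 mul1r => <-; rewrite cmonoE /=; by case: eqP.
have row k : (k < d)%N -> r 0%N k = 0.
  move=> kd; have : (y ^+ d : O) 0%N k = (c * q + r : O) 0%N k by rewrite -yE.
  by rewrite yd cDE rowcq // add0r (ltn_eqF kd).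
(* Compare the coefficients of y^d at x = 0: it is 1 on the left, while on the right r has none and
   q starts at y^d. *)
have c00 : c 0%N 0%N <> 0.
  move=> c0; have : (y ^+ d : O) 0%N d = (c * q + r : O) 0%N d by rewrite -yE.
  rewrite yd eqxx cDE rd // addr0 row0M big_ord_recl c0 mul0r add0r big1 => [/eqP|i _].
    by rewrite oner_eq0.
  rewrite (qd.1 (d - lift ord0 i)%N) ?mulr0 //.
  by rewrite -subSn ?leq_subLR ?addSnnS ?leq_addl //; exact: ltn_ord.
have [c' c'c] := unit_inv c00.
have [R [Rx rE]] := ydeg_expand rd.
have R0 k : (k < d)%N -> R k 0%N 0%N = 0.
  move=> kd; rewrite -(row k kd) rE c_sumE (bigD1 (Ordinal kd)) //= big1 ?addr0.
    by rewrite mulrC vyXM leqnn subnn.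
  move=> j jk; rewrite mulrC vyXM; case: ifP => // jlek; rewrite Rx // subn_gt0 ltn_neqAle jlek andbT.
  by apply: contra_neq jk => jk; exact/val_inj.
have powy k : rep (fun z => z.2 ^+ k) (y ^+ k).
  apply/near0P; exists 1; split=> // z _ _.
  by have := ev_mono 1 0 k z; rewrite rmorph1 !expr0 !mul1r.
have near1 : \forall z \near (0 : C2 K), ev z c * ev z q + \sum_(k < d) ev z (R k) * z.2 ^+ k = z.2 ^+ d.
  have rsum : rep (fun z => \sum_(k < d) ev z (R k) * z.2 ^+ k) r.
    rewrite rE; apply: (rep_sum complete) => k; exact: (repM archimedean complete (rep_ev _) (powy k)).
  have := repD complete (repM archimedean complete (rep_ev c) (rep_ev q)) rsum.
  rewrite -yE => h; exact: (rep_eq h (powy d)).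
have near2 : \forall z \near (0 : C2 K), ev z c' * ev z c = 1.
  have := repM archimedean complete (rep_ev c') (rep_ev c).
  rewrite c'c -(rmorph1 (@cst K)) => h; exact: (rep_eq h (rep_cst 1)).
have near3 : \forall z \near (0 : C2 K), forall k : 'I_d, ev z (R k) = ev (z.1, 0) (R k).
  apply: near_forall => k; have := near_adm (R k); apply: filterS => z [rr [ra zr]].
  exact: (ev_xonly ra zr (Rx k)).
have /near0P[e1 [e10 he1]] : \forall z \near (0 : C2 K),
    [/\ ev z c * ev z q + \sum_(k < d) ev z (R k) * z.2 ^+ k = z.2 ^+ d, ev z c' * ev z c = 1 &
      forall k : 'I_d, ev z (R k) = ev (z.1, 0) (R k)].
  by near=> z; split; near: z.
have [e2 [e20 e2e e2e1]] := min_pos e0 e10; have [eps [eps0 epse2 eps1]] := min_pos e20 ltr01.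
pose eta := eps ^+ d / d.+1%:R.
have eta0 : 0 < eta by rewrite divr_gt0 ?exprn_gt0.
have eta_small : d%:R * eta < eps ^+ d.
  by rewrite mulrC /eta -mulrA gtr_pMr ?exprn_gt0 // mulrC ltr_pdivrMr // mul1r ltr_nat.
have /near0P[e3 [e30 he3]] : \forall z \near (0 : C2 K), forall k : 'I_d, `|ev z (R k)| <= eta.
  by apply: near_forall => k; apply: ev_small => //; exact: R0.
have [del' [del'0 del'e3 del'eps]] := min_pos e30 eps0.
have del0 : 0 < del' / 2 by rewrite divr_gt0.
have del : `|del' / 2| < del' by rewrite gtr0_norm // ltr_pdivrMr // mulr_natr mulr2n ltrDl.
have [T TE] := solve_monicpoly (fun k => ev (del' / 2, 0) (R k)) d0.
have Teps : `|T| < eps.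
  apply: (@root_small (fun k => ev (del' / 2, 0) (R k)) T eta eps d eps0 eps1 (ltW eta0) eta_small _ TE) => k kd.
  have := he3 (del' / 2, 0) _ _ (Ordinal kd); apply; rewrite /= ?normr0 //.
  exact: lt_le_trans del'e3.
have deps : `|del' / 2| < eps by exact: lt_le_trans del'eps.
have [//=||h1 h2 h3] := he1 (del' / 2, T).
- by rewrite /=; apply: lt_le_trans e2e1; exact: lt_le_trans epse2.
- by rewrite /=; apply: lt_le_trans e2e1; exact: lt_le_trans epse2.
exists (del' / 2, T); split => /=.
- by case=> /eqP; rewrite gt_eqF.
- by apply: lt_le_trans e2e; exact: lt_le_trans epse2.
- by apply: lt_le_trans e2e; exact: lt_le_trans epse2.
have cq0 : ev (del' / 2, T) c * ev (del' / 2, T) q = 0.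
  move: h1; rewrite /= TE; under eq_bigr do rewrite h3; move=> h1.
  by apply: (addIr (\sum_(k < d) ev (del' / 2, 0) (R k) * T ^+ k)); rewrite add0r.
by rewrite -[LHS]mul1r -[X in X * _]h2 -mulrA cq0 mulr0.
Unshelve. all: by end_near. Qed.
End ZerosOfGerms.

(** * Singular points, separatrices and centralizers of germs of fields *)

Section Bridge.
Variable K : numClosedFieldType.
Notation O := (cps K).
Notation x := (vx K).
Notation y := (vy K).
Hypothesis archimedean : forall t : K, exists n : nat, `|t| < n%:R.
Hypothesis complete : forall w : nat -> K, (exists M : K, forall N, \sum_(i < N) `|w i| <= M) ->
  exists l, tends (fun N => \sum_(i < N) w i) l.
Implicit Types (z : C2 K) (a b q : O) (f g : C2 K -> K) (V W : C2 K -> C2 K) (A B : O * O).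

Definition vrep V A := rep (fun z => (V z).1) A.1 /\ rep (fun z => (V z).2) A.2.

Lemma holo_vrep V : holo_map V <-> exists A, vrep V A.
Proof.
split=> [[/holo_rep[a Va] /holo_rep[b Vb]]|[A [VA VB]]]; first by exists (a, b).
by split; [exact: (rep_holo complete VA)|exact: (rep_holo complete VB)].
Qed.

Lemma rep_lieD V f A a : vrep V A -> rep f a -> rep (lieD V f) (der A a).
Proof.
move=> [V1 V2] fa; apply: (repD complete).
  exact: (repM archimedean complete V1 (rep_dx archimedean complete fa)).
exact: (repM archimedean complete V2 (rep_dy archimedean complete fa)).
Qed.

Lemma centralizerP V A W : vrep V A -> centralizer V W <-> exists B, vrep W B /\ commute A B.
Proof.
move=> VA; have br B : vrep W B -> vrep (bracket V W) (brk A B).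
  move=> WB; have [V1 V2] := VA; have [W1 W2] := WB.
  split; apply: (repB complete); exact: rep_lieD.
split=> [[/holo_vrep[B WB] b0]|[B [WB /commuteP AB]]].
  exists B; split=> //; apply/commuteP; have [b1 b2] := br _ WB.
  rewrite [brk A B]surjective_pairing.
  congr (_, _); apply: (rep_zero archimedean complete).
    by apply: (rep_germ b1); apply: filterS b0 => z ->.
  by apply: (rep_germ b2); apply: filterS b0 => z ->.
split; first by apply/holo_vrep; exists B.
have [b1 b2] := br _ WB; rewrite AB /= in b1 b2.
have h1 := rep_eq b1 (rep0 K); have h2 := rep_eq b2 (rep0 K).
near=> z; rewrite [LHS]surjective_pairing.
by congr (_, _); near: z.
Unshelve. all: by end_near. Qed.

Definition vcomb m (c : 'I_m -> K) (B : 'I_m -> O * O) : O * O :=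
  (\sum_i cst (c i) * (B i).1, \sum_i cst (c i) * (B i).2).

Lemma vrep_comb m (Y : 'I_m -> C2 K -> C2 K) (B : 'I_m -> O * O) (c : 'I_m -> K) :
  (forall i, vrep (Y i) (B i)) -> vrep (fun z => \sum_i c i *: Y i z) (vcomb c B).
Proof.
move=> YB; split.
  have : rep (fun z => \sum_i c i * (Y i z).1) (\sum_i cst (c i) * (B i).1).
    apply: (rep_sum complete) => i; apply: (repM archimedean complete (rep_cst _)).
    by case: (YB i).
  by apply: filterS => z <-; rewrite (raddf_sum (@fst K K)).
have : rep (fun z => \sum_i c i * (Y i z).2) (\sum_i cst (c i) * (B i).2).
  apply: (rep_sum complete) => i; apply: (repM archimedean complete (rep_cst _)).
  by case: (YB i).
by apply: filterS => z <-; rewrite (raddf_sum (@snd K K)).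
Qed.

Lemma vrep_eq V W A : vrep V A -> vrep W A -> germ_eq V W.
Proof.
move=> [V1 V2] [W1 W2]; have h1 := rep_eq V1 W1; have h2 := rep_eq V2 W2.
near=> z; rewrite [LHS]surjective_pairing [RHS]surjective_pairing.
by congr (_, _); near: z.
Unshelve. all: by end_near. Qed.

Lemma vrep_uniq V W A B : vrep V A -> vrep W B -> germ_eq V W -> A = B.
Proof.
move=> [V1 V2] [W1 W2] VW; rewrite [A]surjective_pairing [B]surjective_pairing.
congr (_, _); [apply: (rep_uniq archimedean complete V1 W1)|
  apply: (rep_uniq archimedean complete V2 W2)]; by apply: filterS VW => z ->.
Qed.

Lemma vrep0 : vrep (fun=> 0) (0, 0).
Proof. by split; exact: rep0. Qed.

Definition evf A z : C2 K := (ev z A.1, ev z A.2).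

Lemma vrep_evf A : vrep (evf A) A.
Proof. by split; exact: rep_ev. Qed.

Definition commuting_basis A m (B : 'I_m -> O * O) :=
  commuting_family A B /\ forall W : O * O, commute A W -> exists c, W = vcomb c B.

Lemma centralizer_dimP V A n : vrep V A ->
  centralizer_dim V n <-> exists B : 'I_n -> O * O, commuting_basis A B.
Proof.
move=> VA; split=> [[Y [Yc Yi Ys]]|[B [[Bc Bi] Bs]]].
  have /choice[B BP] : forall i, exists B, vrep (Y i) B /\ commute A B.
    by move=> i; apply/(centralizerP _ VA).
  have YB i : vrep (Y i) (B i) by case: (BP i).
  exists B; split.
    split=> [i|c c1 c2]; first by case: (BP i).
    apply: Yi; apply: (@vrep_eq _ _ (0, 0)); last exact: vrep0.
    by have := vrep_comb c YB; rewrite /vcomb c1 c2.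
  move=> W AW; have [|c cW] := Ys (evf W).
    by apply/(centralizerP _ VA); exists W; split=> //; exact: vrep_evf.
  by exists c; apply: vrep_uniq cW; [exact: vrep_evf|exact: vrep_comb].
exists (fun i => evf (B i)); have YB i := vrep_evf (B i); split.
- by move=> i; apply/(centralizerP _ VA); exists (B i).
- move=> c c0; have := vrep_uniq (vrep_comb c YB) vrep0 c0.
  by case=> c1 c2; apply: Bi.
- move=> W /(centralizerP _ VA)[W' [WW' /Bs[c cE]]]; exists c.
  by apply: vrep_eq WW' _; rewrite cE; exact: vrep_comb.
Qed.

Lemma basis_bound A n m (B : 'I_n -> O * O) (B' : 'I_m -> O * O) :
  commuting_basis A B -> commuting_family A B' -> (m <= n)%N.
Proof.
move=> [_ Bs] [B'c B'i]; rewrite leqNgt; apply/negP => nm.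
have /choice[c cE] : forall j, exists c, B' j = vcomb c B by move=> j; exact: Bs.
have [d [[j dj] dE]] := linear_dependence (fun j => \row_i c j i) nm.
have d0 i : \sum_j d j * c j i = 0.
  have : (\sum_j d j *: (\row_i c j i : 'rV[K]_n)) 0 i = 0 by rewrite dE mxE.
  by rewrite summxE => h; rewrite -[RHS]h; apply: eq_bigr => k _; rewrite !mxE.
have comb (G : 'I_n -> O) : \sum_j cst (d j) * (\sum_i cst (c j i) * G i) = 0.
  under eq_bigr do rewrite mulr_sumr.
  rewrite exchange_big /= big1 // => i _.
  under eq_bigr do rewrite mulrA -rmorphM.
  by rewrite -mulr_suml -rmorph_sum /= d0 rmorph0 mul0r.
by apply: dj; apply: B'i; under eq_bigr do rewrite cE /=; exact: comb.
Qed.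

(** An independent family that cannot be enlarged spans the centralizer. *)
Lemma basis_ex A N : (forall m (B : 'I_m -> O * O), commuting_family A B -> (m <= N)%N) ->
  exists n (B : 'I_n -> O * O), (n <= N)%N /\ commuting_basis A B.
Proof.
move=> bound.
have [n [[B [Bc Bi]] max]] : exists n, (exists B : 'I_n -> O * O, commuting_family A B) /\
    ~ exists B : 'I_n.+1 -> O * O, commuting_family A B.
  apply: contrapT => nex.
  have all n : exists B : 'I_n -> O * O, commuting_family A B.
    elim: n => [|n IH]; first by exists (fun=> (0, 0)); split=> [|c _ _] [].
    by apply: contrapT => h; apply: nex; exists n.
  by have [B /bound] := all N.+1; rewrite ltnn.
exists n, B; split; first by apply: (@bound _ B); split.
split=> // W AW; apply: contrapT => nspan; apply: max.
exists (fun i => if unlift ord0 i is Some j then B j else W); split.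
  by move=> i; case: unliftP.
move=> c; rewrite !big_ord_recl unlift_none.
pose d i := c (lift ord0 i).
have -> : \sum_(i < n) cst (c (lift ord0 i)) *
    (if unlift ord0 (lift ord0 i) is Some j then B j else W).1 = (vcomb d B).1.
  by apply: eq_bigr => i _; rewrite liftK.
have -> : \sum_(i < n) cst (c (lift ord0 i)) *
    (if unlift ord0 (lift ord0 i) is Some j then B j else W).2 = (vcomb d B).2.
  by apply: eq_bigr => i _; rewrite liftK.
move=> e1 e2; have [c0|/eqP c0] := eqVneq (c ord0) 0.
  move: e1 e2; rewrite c0 rmorph0 !mul0r !add0r => e1 e2 i.
  by case: (unliftP ord0 i) => [j ->|->] //; exact: (Bi d e1 e2).
exfalso; apply: nspan; exists (fun i => - (c ord0)^-1 * d i).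
have solve (w s : O) : cst (c ord0) * w + s = 0 -> w = cst (- (c ord0)^-1) * s.
  move/eqP; rewrite addr_eq0 => /eqP e.
  have -> : s = - (cst (c ord0) * w) by rewrite e opprK.
  rewrite rmorphN mulrNN mulrA -rmorphM mulVf ?rmorph1 ?mul1r //; exact/eqP.
rewrite [W]surjective_pairing (solve _ _ e1) (solve _ _ e2) /vcomb /= !mulr_sumr.
by congr (_, _); apply: eq_bigr => i _; rewrite mulrA -rmorphM.
Qed.

(** A common non-unit factor of the components would have zeros other than 0 arbitrarily near 0, by
    [zero_ex], and V vanishes at these. *)
Lemma isolated_coprime V A : vrep V A -> isolated_singularity V ->
  [/\ A.1 0%N 0%N = 0, A.2 0%N 0%N = 0 & coprime_germs A.1 A.2].
Proof.
move=> [V1 V2] [V0 iso].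
split; rewrite -?(rep00 V1) -?(rep00 V2) ?V0 //.
have [//|[q [q0 [s1 sE1] [s2 sE2]]]] := coprime_or_common A.1 A.2.
have van s (g : C2 K -> K) a : a = s * q -> rep g a ->
    \forall z \near (0 : C2 K), ev z q = 0 -> g z = 0.
  move=> -> ga; have := rep_eq ga (repM archimedean complete (rep_ev s) (rep_ev q)).
  by apply: filterS => z -> ->; rewrite mulr0.
have /near0P[e [e0 he]] : \forall z \near (0 : C2 K), ev z q = 0 -> z = 0.
  have h1 := van _ _ _ sE1 V1; have h2 := van _ _ _ sE2 V2.
  near=> z; move=> qz.
  have i0 : V z = 0 -> z = 0 by near: z.
  have i1 : ev z q = 0 -> (V z).1 = 0 by near: z.
  have i2 : ev z q = 0 -> (V z).2 = 0 by near: z.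
  by apply: i0; rewrite [V z]surjective_pairing i1 ?i2.
have [z [z0 z1 z2 zq]] := zero_ex archimedean complete q0 e0.
by case: z0; exact: he.
Unshelve. all: by end_near. Qed.

Lemma irreducible_germ_irred f a : rep f a -> irreducible_germ f -> irred a.
Proof.
move=> fa [_ f0 nf irr]; split.
- by move=> a0; apply: nf; apply: (rep_eq fa); rewrite a0; exact: rep0.
- by rewrite -(rep00 fa).
move=> g h agh; have := irr (fun z => ev z g) (fun z => ev z h)
  (rep_holo complete (rep_ev g)) (rep_holo complete (rep_ev h)).
rewrite !ev00; apply; apply: (rep_eq fa); rewrite agh.
exact: (repM archimedean complete (rep_ev g) (rep_ev h)).
Qed.

Definition invariant_branch A (S : set (C2 K)) a :=
  [/\ irred a, dvd a (der A a) & \forall z \near (0 : C2 K), S z <-> ev z a = 0].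

(** Pointwise tangency has to become divisibility. If f did not divide X(f), powers of x and y would
    lie in (f, X(f)), which vanishes on {f = 0}; the curve would reduce to the origin, against
    [zero_ex]. *)
Lemma separatrix_branch V A S : vrep V A -> separatrix V S -> exists a, invariant_branch A S a.
Proof.
move=> VA [f [firr Sf _ inv]]; have [fh _ _ _] := firr; have [a fa] := holo_rep fh.
have airr := irreducible_germ_irred fa firr.
have Sa : \forall z \near (0 : C2 K), S z <-> ev z a = 0.
  near=> z; have <- : f z = ev z a by near: z.
  by near: z.
exists a; split=> //.
have [[[M [u [v xE]]] [N [u' [v' yE]]]]|//] := irred_dichotomy (der A a) airr.
have powx : rep (fun z => z.1 ^+ M) (x ^+ M).
  apply/near0P; exists 1; split=> // z _ _.
  by have := ev_mono 1 M 0 z; rewrite rmorph1 !expr0 !mul1r !mulr1.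
have powy : rep (fun z => z.2 ^+ N) (y ^+ N).
  apply/near0P; exists 1; split=> // z _ _.
  by have := ev_mono 1 0 N z; rewrite rmorph1 !expr0 !mul1r.
have comb s t : rep (fun z => ev z s * ev z a + ev z t * lieD V f z) (s * a + t * der A a).
  apply: (repD complete); apply: (repM archimedean complete); try exact: rep_ev.
  exact: rep_lieD.
have hx := comb u v; rewrite -xE in hx; have hy := comb u' v'; rewrite -yE in hy.
have {}hx := rep_eq powx hx; have {}hy := rep_eq powy hy.
have /near0P[e [e0 he]] : \forall z \near (0 : C2 K), ev z a = 0 -> z = 0.
  near=> z; move=> az.
  have Sz : S z by apply: (iffRL (_ : S z <-> ev z a = 0)) => //; near: z.
  have Lz : lieD V f z = 0 by move: Sz; near: z.
  have zx : z.1 ^+ M = ev z u * ev z a + ev z v * lieD V f z by near: z.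
  have zy : z.2 ^+ N = ev z u' * ev z a + ev z v' * lieD V f z by near: z.
  move: zx zy; rewrite az Lz !mulr0 addr0 => /eqP zx /eqP zy.
  move: zx zy; rewrite !expf_eq0 => /andP[_ /eqP z1] /andP[_ /eqP z2].
  by rewrite [z]surjective_pairing z1 z2.
have [_ a0 _] := airr.
have [z [z0 z1 z2 za]] := zero_ex archimedean complete a0 e0.
by case: z0; exact: he.
Unshelve. all: by end_near. Qed.

(** If a divides the irreducible a', the quotient is a unit, invertible near 0, and the zero sets
    agree there. *)
Lemma branch_distinct A S S' a a' : invariant_branch A S a -> invariant_branch A S' a' ->
  ~ set_germ_eq S S' -> ~ dvd a a'.
Proof.
move=> [[_ a0 _] _ Sa] [[_ _ irr] _ S'a'] nSS' [q qE]; apply: nSS'.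
have [q0|//] := irr _ _ qE; have [p pq] := unit_inv q0.
have h := repM archimedean complete (rep_ev q) (rep_ev a); rewrite -qE in h.
have h' := repM archimedean complete (rep_ev p) (rep_ev q); rewrite pq -(rmorph1 (@cst K)) in h'.
have {}h' := rep_eq h' (rep_cst 1).
rewrite /set_germ_eq; near=> z.
have qa : ev z q * ev z a = ev z a' by near: z.
have pq1 : ev z p * ev z q = 1 by near: z.
have Sz : S z <-> ev z a = 0 by near: z.
have S'z : S' z <-> ev z a' = 0 by near: z.
rewrite Sz S'z -qa; split=> [->|qa0]; first by rewrite mulr0.
by rewrite -[LHS]mul1r -[X in X * _]pq1 -mulrA qa0 mulr0.
Unshelve. all: by end_near. Qed.

Lemma chart_equivalence V A (u v : O) (s : K) n (Z : C2 K -> C2 K) : vrep V A ->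
  (forall w, Z w = (w.1, n%:R * w.2)) -> u 0%N 0%N = 0 -> v 0%N 0%N = 0 -> jac u v <> 0 ->
  s <> 0 -> der A u = cst s * u -> der A v = cst (s * n%:R) * v -> equiv_mod_const V Z.
Proof.
move=> VA ZE u0 v0 J s0 Au Av; exists s, (evf (u, v)); split=> //.
  have uvh : vrep (evf (u, v)) (u, v) := vrep_evf _.
  have uv0 : evf (u, v) 0 = 0 by rewrite /evf !ev00 u0 v0.
  have [p [q [[p0 q0] [cu cv] [cp cq]]]] := inverse_function u0 v0 J.
  have inv (a b c d : O) : a 0%N 0%N = 0 -> b 0%N 0%N = 0 -> comp c a b = x -> comp d a b = y ->
      germ_eq (evf (c, d) \o evf (a, b)) id.
    move=> a0 b0 cE dE; apply: (@vrep_eq _ _ (x, y)).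
      have h e := rep_comp archimedean complete a0 b0 (rep_ev e) (rep_ev a) (rep_ev b).
      by split; [have := h c; rewrite cE|have := h d; rewrite dE].
    by split; apply/near0P; exists 1; split=> // z _ _; rewrite ?ev_vx ?ev_vy.
  split=> //; first by apply/holo_vrep; exists (u, v).
  exists (evf (p, q)); split.
  - by apply/holo_vrep; exists (p, q); exact: vrep_evf.
  - by rewrite /evf !ev00 p0 q0.
  - exact: inv.
  - exact: inv.
apply: (@vrep_eq _ _ (cst s * u, cst (s * n%:R) * v)).
  by split; rewrite /= -?Au -?Av; apply: rep_lieD VA _; exact: rep_ev.
split.
  have := repM archimedean complete (rep_cst s) (rep_ev u); apply: filterS => z <-.
  by rewrite ZE.
have := repM archimedean complete (rep_cst (s * n%:R)) (rep_ev v); apply: filterS => z <-.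
by rewrite ZE -mulrA.
Qed.

Lemma commuting_family_lshift A m k (B : 'I_(m + k) -> O * O) : commuting_family A B ->
  commuting_family A (fun i : 'I_m => B (lshift k i)).
Proof.
move=> [Bc Bi]; split=> // c c1 c2 i.
pose d (j : 'I_(m + k)) := if fintype.split j is inl j' then c j' else 0.
have dl j : d (lshift k j) = c j by rewrite /d -[lshift k j]/(unsplit (inl j)) unsplitK.
have dr j : d (rshift m j) = 0 by rewrite /d -[rshift m j]/(unsplit (inr j)) unsplitK.
have sum (G : 'I_(m + k) -> O) : \sum_j cst (d j) * G j = \sum_j cst (c j) * G (lshift k j).
  rewrite big_split_ord /= [X in _ + X]big1 ?addr0 => [|j _]; last by rewrite dr rmorph0 mul0r.
  by apply: eq_bigr => j _; rewrite dl.
by rewrite -dl; apply: Bi; rewrite sum.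
Qed.

Theorem dicritical_centralizer V : holo_map V -> isolated_singularity V -> dicritical V ->
  (exists n : nat, (n <= 4)%N /\ centralizer_dim V n) /\
  (centralizer_dim V 3 -> exists n : nat, (2 <= n)%N /\ equiv_mod_const V (@diag_field K n)) /\
  (centralizer_dim V 4 -> equiv_mod_const V (@radial_field K)).
Proof.
move=> /holo_vrep[A VA] /(isolated_coprime VA)[A1 A2 cop] [S [Ssep Sdist]].
have /choice[F FP] : forall i, exists a, invariant_branch A (S i) a.
  by move=> i; apply: (separatrix_branch VA); exact: Ssep.
have F_irred j : irred (F j) by case: (FP j).
have F_inv j : dvd (F j) (der A (F j)) by case: (FP j).
have F_distinct i j : i <> j -> ~ dvd (F i) (F j).
  by move=> ij; apply: branch_distinct (FP i) (FP j) _; exact: Sdist.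
have class k (B : 'I_(3 + k) -> O * O) : commuting_family A B ->
    exists (u v : O) (s : K) n, [/\ u 0%N 0%N = 0 /\ v 0%N 0%N = 0, jac u v <> 0,
    s <> 0 /\ (0 < n)%N, der A u = cst s * u & der A v = cst (s * n%:R) * v].
  by move/commuting_family_lshift; exact: (classification cop A1 A2 F_irred F_inv F_distinct).
(* Bounding all independent families, not only bases, also yields the finiteness of d(X). *)
have bound m (B : 'I_m -> O * O) : commuting_family A B -> (m <= 4)%N.
  have [m3 _|m3] := ltnP m 3; first by rewrite (leq_trans (ltnW m3)).
  have [k mk] : exists k, m = (3 + k)%N by exists (m - 3)%N; rewrite subnKC.
  subst m => Bf; have [u [v [s [n [[u0 v0] J [s0 n0] Au Av]]]]] := class _ _ Bf.
  have [n1|n1] := ltnP 1 n.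
    by apply: leq_trans (family_size_nonradial A1 A2 u0 v0 J s0 n0 Au Av n1 Bf) _.
  have {}n1 : n = 1%N by apply/eqP; rewrite eqn_leq n1.
  exact: (family_size_radial A1 A2 u0 v0 J s0 Au Av n1 Bf).
split; first by have [n [B [n4 BB]]] := basis_ex bound; exists n; split=> //; apply/(centralizer_dimP _ VA); exists B.
split=> /(centralizer_dimP _ VA)[B BB]; have Bf := BB.1.
  have [u [v [s [n [[u0 v0] J [s0 n0] Au Av]]]]] := class 0%N B Bf.
  have [n1|n1] := ltnP 1 n; last first.
    have {}n1 : n = 1%N by apply/eqP; rewrite eqn_leq n1.
    (* The radial case has four independent commuting fields, too many for dimension 3. *)
    have [B' /(basis_bound BB)] := family_radial J Au Av n1.
    by [].
  by exists n; split=> //; apply: (chart_equivalence VA _ u0 v0 J s0 Au Av).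
have [u [v [s [n [[u0 v0] J [s0 n0] Au Av]]]]] := class 1%N B Bf.
have [n1|n1] := ltnP 1 n.
  by have := family_size_nonradial A1 A2 u0 v0 J s0 n0 Au Av n1 Bf.
have {}n1 : n = 1%N by apply/eqP; rewrite eqn_leq n1.
apply: (chart_equivalence VA _ u0 v0 J s0 Au Av) => w.
by rewrite n1 mul1r -surjective_pairing.
Qed.
End Bridge.

Theorem corollary3p9 (R : realType) (X : C2 R[i]%C -> C2 R[i]%C)
    (X_holo : holo_map X)
    (X_isolated : isolated_singularity X)
    (X_dicritical : dicritical X) :
  (exists n : nat, (n <= 4)%N /\ centralizer_dim X n) /\
  (centralizer_dim X 3 ->
     exists n : nat, (2 <= n)%N /\ equiv_mod_const X (@diag_field R[i]%C n)) /\
  (centralizer_dim X 4 -> equiv_mod_const X (@radial_field R[i]%C)).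
Proof.
exact: (dicritical_centralizer (@complex_archimedean R) (@complex_complete R)).
Qed.
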